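(* Let $n=1$, let $g:\mathbb{R}\to\mathbb{R}$ be Lipschitz continuous, $\mathbb{Z}$-periodic and such that $g(y)>0$ for every $y$, let $0<\alpha<1$, and let $u_0:\mathbb{R}\to\mathbb{R}$ be a Lipschitz function. For $\varepsilon>0$ let $u^\varepsilon_\alpha$ be the solution to $$u^\varepsilon_t-\varepsilon^\alpha u^\varepsilon_{xx}-g\left(\frac{u^\varepsilon}{\varepsilon}\right)=0\ \text{ in }\mathbb{R}\times(0,+\infty),\qquad u^\varepsilon(x,0)=u_0(x)\ \text{ in }\mathbb{R}.$$ Then, as $\varepsilon\to0$, $u^\varepsilon_\alpha$ converges locally uniformly to a unique function $u$ (that is, the whole family converges, with no extraction of subsequences).
   Context: The solution $u^\varepsilon_\alpha$ is the unique (classical) solution, of class $C^{2+\gamma,1+\gamma/2}$ for all $\gamma\in(0,1)$. Locally uniform convergence is on $\mathbb{R}\times[0,+\infty)$. *)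

(* Defs.v *)
From Stdlib Require Import Reals.
From Coquelicot Require Import Coquelicot.
Open Scope R_scope.

Definition Lipschitz (f : R -> R) : Prop :=
  exists L : R, forall x y : R, Rabs (f x - f y) <= L * Rabs (x - y).

Definition Z_periodic (f : R -> R) : Prop :=
  forall (x : R) (k : Z), f (x + IZR k) = f x.

(* Functions on space-time are curried as [u x t]; only their values for
   t >= 0 matter.  All derivatives below are taken at times t > 0. *)
Definition D_t (u : R -> R -> R) (x t : R) : R := Derive (fun s => u x s) t.
Definition D_x (u : R -> R -> R) (x t : R) : R := Derive (fun y => u y t) x.
Definition D_xx (u : R -> R -> R) (x t : R) : R :=
  Derive_n (fun y => u y t) 2 x.

Definition box (M tau T : R) (x t : R) : Prop :=
  Rabs x <= M /\ tau <= t <= T.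

Definition parabolic_dist (x t y s : R) : R :=
  Rmax (Rabs (x - y)) (sqrt (Rabs (t - s))).

(* The class C^{gamma, gamma/2}.  Coinciding points are excluded because
   [Rpower 0 a = 1]. *)
Definition parabolic_Holder_on (K : R -> R -> Prop) (gamma : R)
    (w : R -> R -> R) : Prop :=
  exists C : R, forall x t y s : R, K x t -> K y s ->
    0 < parabolic_dist x t y s ->
    Rabs (w x t - w y s) <= C * Rpower (parabolic_dist x t y s) gamma.

Definition time_Holder_on (K : R -> R -> Prop) (beta : R)
    (w : R -> R -> R) : Prop :=
  exists C : R, forall x t s : R, K x t -> K x s -> t <> s ->
    Rabs (w x t - w x s) <= C * Rpower (Rabs (t - s)) beta.

(* The class C^{2+gamma, 1+gamma/2} on the compact subsets of R x (0,+oo):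
   u_t and u_xx are in C^{gamma, gamma/2}, and u_x is Hoelder in time with
   exponent (1+gamma)/2, as in the usual definition of parabolic Hoelder
   spaces.  The estimates are local because u_0 is merely Lipschitz (no
   regularity up to t = 0) and possibly unbounded. *)
Definition C_2gamma_1gamma (gamma : R) (u : R -> R -> R) : Prop :=
  (forall x t : R, 0 < t ->
     ex_derive (fun s => u x s) t /\
     ex_derive (fun y => u y t) x /\
     ex_derive_n (fun y => u y t) 2 x) /\
  (forall M tau T : R, 0 < tau ->
     parabolic_Holder_on (box M tau T) gamma (D_t u) /\
     parabolic_Holder_on (box M tau T) gamma (D_xx u) /\
     time_Holder_on (box M tau T) ((1 + gamma) / 2) (D_x u)).

Definition continuous_on_closed_half_plane (u : R -> R -> R) : Prop :=
  forall x t : R, 0 <= t ->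
    filterlim (fun p : R * R => u (fst p) (snd p))
      (within (fun p : R * R => 0 <= snd p) (locally (x, t)))
      (locally (u x t)).

(* Growth condition at infinity in space.  On the whole line the Cauchy
   problem is well posed only within a class of controlled growth (Tychonoff's
   non-uniqueness phenomenon); with Lipschitz data, linear growth is the
   natural class. *)
Definition linear_growth (u : R -> R -> R) : Prop :=
  forall T : R, exists C : R, forall x t : R, 0 <= t <= T ->
    Rabs (u x t) <= C * (1 + Rabs x).

Definition is_solution (g u0 : R -> R) (alpha eps : R)
    (u : R -> R -> R) : Prop :=
  continuous_on_closed_half_plane u /\
  (forall gamma : R, 0 < gamma < 1 -> C_2gamma_1gamma gamma u) /\
  linear_growth u /\
  (forall x t : R, 0 < t ->
     D_t u x t - Rpower eps alpha * D_xx u x t - g (u x t / eps) = 0) /\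
  (forall x : R, u x 0 = u0 x).

(* Uniform convergence, as eps -> 0+, on each [-M,M] x [0,T]; every compact
   subset of R x [0,+oo) lies in such a rectangle. *)
Definition converges_locally_uniformly (ueps : R -> R -> R -> R)
    (u : R -> R -> R) : Prop :=
  forall M T eta : R, 0 < eta ->
    exists delta : R, 0 < delta /\
      forall eps : R, 0 < eps < delta ->
        forall x t : R, box M 0 T x t ->
          Rabs (ueps eps x t - u x t) < eta.

(* Main.v *)
Require Import Defs.
From Stdlib Require Import Reals ZArith Lra Lia Psatz Classical IndefiniteDescription.
From Coquelicot Require Import Coquelicot.
Open Scope R_scope.

(** Why the whole family converges.  Let [c] be the mean of [g] over a period and
    [c0 <= c] its harmonic mean.  Where the solution has slope [p], it looks like
    [eps W((p x + lam t)/eps)], where [W] solves the wave equation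
    [q W'' + g(W) = lam W'] with [q = eps^(alpha - 1) p^2].  As [alpha < 1], [q] is
    huge as soon as [p <> 0]; diffusion then averages [g], and [lam] is close to [c].
    Flat pieces follow the ordinary differential equation [u' = g(u/eps)] and move at
    the speed [c0].  Formally the limit solves [u_t = c] where [u_x <> 0] and
    [u_t = c0] where [u_x = 0].  This Hamiltonian is discontinuous, so the limit is
    not identified through a comparison principle for the limit equation, but through
    its levels.

    Fix [x0], [t >= 0] and a level [l].  Suppose first that one can go from [x0] to a
    point [y] with [u0 >= l] on the way and [u0 y >= l + (c - c0) t].  Up to time [t]
    the solution at [y] stays above [l + c s], even at the slow speed [c0], and a
    barrier of small non-zero slope between [x0] and [y] transports the speed [c] back
    to [x0]: asymptotically [u(x0, t) >= l + c t] ([slope_lower_bound]).  Otherwise [x0]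
    lies in an interval on which [u0 <= l + (c - c0) t] and at whose finite ends
    [u0 <= l].  The ends stay below [l + c s], and the flat solution started from
    [l + (c - c0) t] dominates on the interval: [u(x0, t) <= l + c t]
    ([plateau_upper_bound]).  Every level being of one of the two kinds
    ([level_dichotomy]), the pointwise limit exists.  Because integer multiples of
    [eps] can be added to solutions, the solutions are Lipschitz in space up to an
    error [eps] ([space_modulus]), and they are equicontinuous in time
    ([time_modulus]); hence the convergence is locally uniform.

    These bounds need barriers with speeds in all directions: at most [c] and at least
    [c0] whatever the slope, and nearly [c] for slopes away from 0.  They are built
    from wave inequalities.  The speed [m = W'], as a function of the height, solves
    the first order equation [q m m' = lam m - g], whose periodic solutions come from a
    contraction ([profile_exists]).  Integrating this equation, with [lam = c] or
    [lam = c0], compares the mean of [1/m] with 1, and adding a constant to [m] turns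
    the comparison into an equality at the price of an inequality of the right sign
    ([super_wave], [sub_wave_slow], [sub_wave_steep]).  A barrier of variable slope is
    the minimum, or maximum, of waves of frozen slopes with penalised phases
    ([barrier_at_scale]). *)

(** * Continuity and maxima on the closed half plane *)

Lemma cont_eps (w : R -> R -> R) (x t e : R) :
  continuous_on_closed_half_plane w -> 0 <= t -> 0 < e ->
  exists d, 0 < d /\ forall y s, Rabs (y - x) < d -> Rabs (s - t) < d -> 0 <= s ->
    Rabs (w y s - w x t) < e.
Proof.
  intros Hw Ht He.
  destruct (proj1 (filterlim_locally _ _) (Hw x t Ht) (mkposreal e He)) as [d Hd].
  exists d; split; [apply cond_pos|].
  intros y s Hy Hs Hs0.
  exact (Hd (y, s) (conj Hy Hs) Hs0).
Qed.

Lemma cont_comp2 (h : R -> R -> R) (f g : R -> R -> R) :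
  (forall a b, filterlim (fun z : R * R => h (fst z) (snd z))
     (filter_prod (locally a) (locally b)) (locally (h a b))) ->
  continuous_on_closed_half_plane f -> continuous_on_closed_half_plane g ->
  continuous_on_closed_half_plane (fun x t => h (f x t) (g x t)).
Proof.
  intros Hh Hf Hg x t Ht.
  eapply filterlim_comp_2; [exact (Hf x t Ht)|exact (Hg x t Ht)|apply Hh].
Qed.

Lemma cont_plus (f g : R -> R -> R) :
  continuous_on_closed_half_plane f -> continuous_on_closed_half_plane g ->
  continuous_on_closed_half_plane (fun x t => f x t + g x t).
Proof.
  apply (cont_comp2 Rplus); intros a b.
  exact (filterlim_plus (K := R_AbsRing) (V := R_NormedModule) a b).
Qed.

Lemma cont_mult (f g : R -> R -> R) :
  continuous_on_closed_half_plane f -> continuous_on_closed_half_plane g ->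
  continuous_on_closed_half_plane (fun x t => f x t * g x t).
Proof.
  apply (cont_comp2 Rmult); intros a b.
  exact (filterlim_mult (K := R_AbsRing) a b).
Qed.

Lemma cont_comp (h : R -> R) (f : R -> R -> R) :
  (forall a, continuous h a) -> continuous_on_closed_half_plane f ->
  continuous_on_closed_half_plane (fun x t => h (f x t)).
Proof.
  intros Hh Hf x t Ht.
  eapply filterlim_comp; [exact (Hf x t Ht)|apply Hh].
Qed.

Lemma cont_space (h : R -> R) :
  (forall a, continuous h a) -> continuous_on_closed_half_plane (fun x _ => h x).
Proof.
  intros Hh x t Ht.
  eapply filterlim_filter_le_1; [apply filter_le_within|].
  eapply (filterlim_comp _ _ _ fst h); [|apply Hh].
  intros P [d Hd]; exists d; intros [y s] [Hy _]; apply Hd, Hy.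
Qed.

Lemma cont_time (h : R -> R) :
  (forall a, continuous h a) -> continuous_on_closed_half_plane (fun _ t => h t).
Proof.
  intros Hh x t Ht.
  eapply filterlim_filter_le_1; [apply filter_le_within|].
  eapply (filterlim_comp _ _ _ snd h); [|apply Hh].
  intros P [d Hd]; exists d; intros [y s] [_ Hs]; apply Hd, Hs.
Qed.

Lemma cont_const (c : R) : continuous_on_closed_half_plane (fun _ _ => c).
Proof. apply (cont_space (fun _ => c)); intros a; apply continuous_const. Qed.

Lemma cont_scal (c : R) (f : R -> R -> R) :
  continuous_on_closed_half_plane f ->
  continuous_on_closed_half_plane (fun x t => c * f x t).
Proof. intros Hf; exact (cont_mult _ _ (cont_const c) Hf). Qed.

Lemma cont_minus (f g : R -> R -> R) :
  continuous_on_closed_half_plane f -> continuous_on_closed_half_plane g ->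
  continuous_on_closed_half_plane (fun x t => f x t - g x t).
Proof.
  intros Hf Hg. apply cont_plus; [exact Hf|].
  apply (cont_comp Ropp); [|exact Hg].
  intros a; exact (continuous_opp (fun x : R => x) a (continuous_id a)).
Qed.

Lemma cont_ext (f g : R -> R -> R) :
  (forall x t, f x t = g x t) ->
  continuous_on_closed_half_plane f -> continuous_on_closed_half_plane g.
Proof.
  intros E Hf x t Ht. rewrite <- E.
  eapply filterlim_ext; [|exact (Hf x t Ht)].
  intros p; simpl; apply E.
Qed.

Lemma cont_max (f g : R -> R -> R) :
  continuous_on_closed_half_plane f -> continuous_on_closed_half_plane g ->
  continuous_on_closed_half_plane (fun x t => Rmax (f x t) (g x t)).
Proof.
  intros Hf Hg.
  apply (cont_ext (fun x t => / 2 * (f x t + g x t + Rabs (f x t - g x t)))).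
  - intros x t. unfold Rmax. destruct (Rle_dec (f x t) (g x t)).
    + rewrite Rabs_left1 by lra. lra.
    + rewrite Rabs_right by lra. lra.
  - apply cont_scal, cont_plus; [apply cont_plus; assumption|].
    apply (cont_comp Rabs); [exact continuous_Rabs|].
    apply cont_minus; assumption.
Qed.

(** Compactness of [[a, b]] as an induction: a property of intervals that holds
    near every point and passes to adjacent unions holds on the whole interval. *)
Lemma interval_cover (Q : R -> R -> Prop) (a b : R) :
  a <= b ->
  (forall c, a <= c <= b -> exists d, 0 < d /\
     forall p q, c - d < p -> p <= q -> q < c + d -> Q p q) ->
  (forall p q r, p <= q <= r -> Q p q -> Q q r -> Q p r) ->
  Q a b.
Proof.
  intros Hab Hloc Hglue.
  set (E := fun c => a <= c <= b /\ Q a c).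
  assert (Ha : E a).
  { destruct (Hloc a) as [d [Hd H]]; [lra|]. split; [lra|]. apply H; lra. }
  destruct (completeness E) as [s [Hub Hlub]].
  { exists b; intros c [Hc _]; lra. }
  { exists a; exact Ha. }
  assert (Hs : a <= s <= b).
  { split; [apply Hub, Ha|]. apply Hlub; intros c [Hc _]; lra. }
  destruct (Hloc s Hs) as [d [Hd H]].
  assert (Hc : exists c, E c /\ s - d < c).
  { apply NNPP; intros Hn.
    assert (s <= s - d); [|lra].
    apply Hlub; intros c Hc. apply Rnot_lt_le; intros Hlt.
    apply Hn; exists c; split; assumption. }
  destruct Hc as [c [[Hc HQ] Hcs]].
  assert (Hcs' : c <= s) by (apply Hub; split; assumption).
  destruct (Rlt_le_dec s b) as [Hsb|Hsb].
  - exfalso. set (q := Rmin b (s + d / 2)).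
    assert (Hq : s < q <= b /\ q < s + d).
    { unfold q, Rmin. destruct (Rle_dec b (s + d / 2)); lra. }
    assert (q <= s); [|lra].
    apply Hub. split; [lra|].
    apply (Hglue a c q); [lra|exact HQ|]. apply H; lra.
  - apply (Hglue a c b); [lra|exact HQ|]. apply H; lra.
Qed.

(** If the maximum were not attained, every point would have a neighbourhood on
    which [w] stays below one single value of [w]; this passes from rows to the
    whole rectangle by [interval_cover], and is absurd at the dominating point. *)
Lemma max_on_rectangle (w : R -> R -> R) (A B t0 T : R) :
  continuous_on_closed_half_plane w -> A <= B -> 0 <= t0 <= T ->
  exists x t, A <= x <= B /\ t0 <= t <= T /\
    forall y s, A <= y <= B -> t0 <= s <= T -> w y s <= w x t.
Proof.
  intros Hw HAB HT. apply NNPP; intros Hn.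
  assert (Hup : forall x t, A <= x <= B -> t0 <= t <= T ->
    exists y s, A <= y <= B /\ t0 <= s <= T /\ w x t < w y s).
  { intros x t Hx Ht. apply NNPP; intros Hm. apply Hn. exists x, t.
    repeat split; try lra. intros y s Hy Hs. apply Rnot_lt_le; intros Hlt.
    apply Hm. exists y, s. repeat split; lra. }
  assert (Htot : exists y s, A <= y <= B /\ t0 <= s <= T /\
    forall x' t', A <= x' <= B -> t0 <= t' <= T -> t0 <= t' <= T -> w x' t' < w y s).
  { apply (interval_cover (fun p q => exists y s, A <= y <= B /\ t0 <= s <= T /\
      forall x' t', A <= x' <= B -> t0 <= t' <= T -> p <= t' <= q -> w x' t' < w y s) t0 T);
      [lra| |].
    - intros t Ht.
      assert (Hrow : exists y s d, A <= y <= B /\ t0 <= s <= T /\ 0 < d /\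
        forall x' t', A <= x' <= B -> A <= x' <= B -> t0 <= t' <= T -> Rabs (t' - t) < d ->
          w x' t' < w y s).
      { apply (interval_cover (fun p q => exists y s d, A <= y <= B /\ t0 <= s <= T /\ 0 < d /\
          forall x' t', A <= x' <= B -> p <= x' <= q -> t0 <= t' <= T -> Rabs (t' - t) < d ->
          w x' t' < w y s) A B); [lra| |].
        - intros x Hx. destruct (Hup x t Hx Ht) as [y [s [Hy [Hs Hlt]]]].
          destruct (cont_eps w x t (w y s - w x t) Hw) as [d [Hd H]]; [lra|lra|].
          exists d; split; [exact Hd|]. intros p q Hp Hpq Hq.
          exists y, s, d. repeat split; try lra.
          intros x' t' _ Hx' Ht' Hd'.
          assert (Hb : Rabs (w x' t' - w x t) < w y s - w x t).
          { apply H; [apply Rabs_def1; lra|exact Hd'|lra]. }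
          apply Rabs_def2 in Hb. lra.
        - intros p q r Hpqr [y1 [s1 [d1 [Hy1 [Hs1 [Hd1 H1]]]]]]
            [y2 [s2 [d2 [Hy2 [Hs2 [Hd2 H2]]]]]].
          assert (Hd : 0 < Rmin d1 d2) by (apply Rmin_pos; assumption).
          pose proof (Rmin_l d1 d2). pose proof (Rmin_r d1 d2).
          destruct (Rle_dec (w y1 s1) (w y2 s2)) as [Hc|Hc].
          + exists y2, s2, (Rmin d1 d2). repeat split; try lra.
            intros x' t' Hx' Hx'' Ht' Hd'. destruct (Rle_dec x' q).
            * eapply Rlt_le_trans; [apply H1; lra|exact Hc].
            * apply H2; lra.
          + exists y1, s1, (Rmin d1 d2). repeat split; try lra.
            intros x' t' Hx' Hx'' Ht' Hd'. destruct (Rle_dec x' q).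
            * apply H1; lra.
            * eapply Rlt_trans; [apply H2; lra|lra]. }
      destruct Hrow as [y [s [d [Hy [Hs [Hd H]]]]]].
      exists d; split; [exact Hd|]. intros p q Hp Hpq Hq.
      exists y, s. repeat split; try lra. intros x' t' Hx' Ht' Hpq'.
      apply H; try lra. apply Rabs_def1; lra.
    - intros p q r Hpqr [y1 [s1 [Hy1 [Hs1 H1]]]] [y2 [s2 [Hy2 [Hs2 H2]]]].
      destruct (Rle_dec (w y1 s1) (w y2 s2)) as [Hc|Hc].
      + exists y2, s2. repeat split; try lra. intros x' t' Hx' Ht' Hpr.
        destruct (Rle_dec t' q).
        * eapply Rlt_le_trans; [apply H1; lra|exact Hc].
        * apply H2; lra.
      + exists y1, s1. repeat split; try lra. intros x' t' Hx' Ht' Hpr.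
        destruct (Rle_dec t' q).
        * apply H1; lra.
        * eapply Rlt_trans; [apply H2; lra|lra]. }
  destruct Htot as [y [s [Hy [Hs H]]]].
  specialize (H y s Hy Hs Hs). lra.
Qed.

(** * The maximum principle *)

(** The derivatives that the operator [w_t - a w_xx] sees at one point; [w_x] is
    only asked to exist, on the whole time slice. *)
Definition jet (w : R -> R -> R) (x t wt wxx : R) : Prop :=
  is_derive (fun s => w x s) t wt /\
  exists wx : R -> R, (forall y, is_derive (fun y' => w y' t) y (wx y)) /\
    is_derive wx x wxx.

(** A maximum over a rectangle may sit on its final time, so only earlier times
    can be compared. *)
Lemma derive_left_max (f : R -> R) (t l d : R) :
  is_derive f t l -> 0 < d -> (forall s, t - d < s < t -> f s <= f t) -> 0 <= l.
Proof.
  intros Hf Hd Hmax. apply Rnot_lt_le; intros Hl.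
  apply is_derive_Reals in Hf.
  destruct (Hf (- l / 2)) as [e He]; [lra|].
  set (h := - (Rmin (d / 2) (e / 2))).
  assert (Hpos : 0 < Rmin (d / 2) (e / 2)).
  { apply Rmin_pos; [lra|]. pose proof (cond_pos e); lra. }
  pose proof (Rmin_l (d / 2) (e / 2)). pose proof (Rmin_r (d / 2) (e / 2)).
  pose proof (cond_pos e).
  specialize (He h). assert (Hh : h < 0) by (unfold h; lra).
  assert (Hq : Rabs ((f (t + h) - f t) / h - l) < - l / 2).
  { apply He; [lra|]. unfold h; rewrite Rabs_Ropp, Rabs_right; lra. }
  apply Rabs_def2 in Hq.
  assert (0 <= (f (t + h) - f t) / h); [|lra].
  replace ((f (t + h) - f t) / h) with ((f t - f (t + h)) * / - h) by (field; lra).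
  apply Rmult_le_pos.
  - assert (f (t + h) <= f t); [apply Hmax; unfold h; lra|lra].
  - left; apply Rinv_0_lt_compat; lra.
Qed.

Lemma derive_max_zero (f : R -> R) (x l d : R) :
  is_derive f x l -> 0 < d -> (forall y, x - d < y < x + d -> f y <= f x) -> l = 0.
Proof.
  intros Hf Hd Hmax. apply Rle_antisym.
  - assert (0 <= - l); [|lra].
    apply (derive_left_max (fun y => f (- y)) (- x) (- l) d).
    + replace (- l) with (scal (- 1) l) by (unfold scal; simpl; unfold mult; simpl; ring).
      apply (is_derive_comp f (fun y => - y)).
      * rewrite Ropp_involutive; exact Hf.
      * auto_derive; [trivial|ring].
    + exact Hd.
    + intros s Hs. rewrite Ropp_involutive. apply Hmax; lra.
  - apply (derive_left_max f x l d Hf Hd). intros s Hs; apply Hmax; lra.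
Qed.

Lemma second_derive_max (f f1 : R -> R) (x l d : R) :
  (forall y, is_derive f y (f1 y)) -> is_derive f1 x l -> 0 < d ->
  (forall y, x - d < y < x + d -> f y <= f x) -> l <= 0.
Proof.
  intros Hf Hf1 Hd Hmax. apply Rnot_lt_le; intros Hl.
  assert (H0 : f1 x = 0) by (apply (derive_max_zero f x (f1 x) d); auto).
  apply is_derive_Reals in Hf1.
  destruct (Hf1 (l / 2)) as [e He]; [lra|].
  pose proof (cond_pos e).
  set (h := Rmin (d / 2) (e / 2)).
  assert (Hpos : 0 < h) by (apply Rmin_pos; lra).
  pose proof (Rmin_l (d / 2) (e / 2)). pose proof (Rmin_r (d / 2) (e / 2)).
  fold h in H1, H2.
  destruct (MVT_cor2 f f1 x (x + h)) as [c [Heq Hc]]; [lra| |].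
  { intros y _; apply is_derive_Reals, Hf. }
  assert (f (x + h) <= f x) by (apply Hmax; lra).
  assert (Hq : Rabs ((f1 (x + (c - x)) - f1 x) / (c - x) - l) < l / 2).
  { apply He; [lra|]. rewrite Rabs_right; lra. }
  replace (x + (c - x)) with c in Hq by ring. rewrite H0 in Hq.
  apply Rabs_def2 in Hq.
  assert (Hp : 0 < (f1 c - 0) / (c - x)) by lra.
  apply (Rmult_lt_compat_r (c - x)) in Hp; [|lra].
  unfold Rdiv in Hp. rewrite Rmult_assoc, Rinv_l in Hp by lra.
  assert (0 < f1 c * (x + h - x)) by (apply Rmult_lt_0_compat; lra). lra.
Qed.

Lemma jet_lin (c1 c2 : R) (f g : R -> R -> R) (x t ft fxx gt gxx : R) :
  jet f x t ft fxx -> jet g x t gt gxx ->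
  jet (fun y s => c1 * f y s + c2 * g y s) x t (c1 * ft + c2 * gt) (c1 * fxx + c2 * gxx).
Proof.
  intros [Hft [fx [Hfx Hfxx]]] [Hgt [gx [Hgx Hgxx]]].
  assert (Hlin : forall (p q : R -> R) z dp dq, is_derive p z dp -> is_derive q z dq ->
    is_derive (fun y => c1 * p y + c2 * q y) z (c1 * dp + c2 * dq)).
  { intros p q z dp dq Hp Hq.
    apply (is_derive_plus (fun y => c1 * p y) (fun y => c2 * q y));
      apply is_derive_scal; assumption. }
  split; [apply Hlin; assumption|].
  exists (fun y => c1 * fx y + c2 * gx y). split; [intros y|]; apply Hlin; auto.
Qed.

Lemma jet_eq (w : R -> R -> R) (x t wt wxx wt' wxx' : R) :
  jet w x t wt wxx -> wt = wt' -> wxx = wxx' -> jet w x t wt' wxx'.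
Proof. intros H -> ->; exact H. Qed.

Lemma jet_ext (f g : R -> R -> R) (x t ft fxx : R) :
  (forall y s, f y s = g y s) -> jet f x t ft fxx -> jet g x t ft fxx.
Proof.
  intros E [Hft [fx [Hfx Hfxx]]]. split.
  - eapply is_derive_ext; [|exact Hft]. intros s; apply E.
  - exists fx; split; [|exact Hfxx]. intros y.
    eapply is_derive_ext; [|exact (Hfx y)]. intros s; apply E.
Qed.

(** The differential inequality is only tested on a function touching [w] from
    below, so that [w] may be a maximum of smooth functions (equivalently, the
    barrier a minimum of smooth barriers).  Discounting by [exp (- (K + 1) t)]
    absorbs the zero order term: at a positive maximum of the discounted
    function, [w_t >= (K + 1) w] and [w_xx <= 0]. *)
Lemma max_principle_rectangle (w : R -> R -> R) (a K A B t0 T : R) :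
  0 <= a -> A <= B -> 0 <= t0 <= T ->
  continuous_on_closed_half_plane w ->
  (forall x t, A <= x <= B -> t0 <= t <= T -> 0 < w x t ->
     A < x < B /\ t0 < t /\
     exists (o : R -> R -> R) (ot oxx : R),
       (forall y s, A <= y <= B -> t0 <= s <= T -> o y s <= w y s) /\
       o x t = w x t /\ jet o x t ot oxx /\ ot - a * oxx <= K * o x t) ->
  forall x t, A <= x <= B -> t0 <= t <= T -> w x t <= 0.
Proof.
  intros Ha HAB HT Hw Htouch.
  set (E := fun s => exp (- (K + 1) * s)).
  assert (HE : forall s, 0 < E s) by (intros s; apply exp_pos).
  assert (HdE : forall s, is_derive E s (- (K + 1) * E s)).
  { intros s. unfold E. auto_derive; [trivial|ring]. }
  assert (Hc : continuous_on_closed_half_plane (fun x s => w x s * E s)).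
  { apply cont_mult; [exact Hw|]. apply cont_time. intros s.
    apply (ex_derive_continuous E). eexists; apply HdE. }
  destruct (max_on_rectangle _ A B t0 T Hc HAB HT) as [x [t [Hx [Ht Hmax]]]].
  assert (Hneg : w x t <= 0).
  { apply Rnot_lt_le; intros Hpos.
    destruct (Htouch x t Hx Ht Hpos) as
      [HxI [HtI [o [ot [oxx [Hle [Heq [[Hot [ox [Hox Hoxx]]] Hineq]]]]]]]].
    assert (Homax : forall y s, A <= y <= B -> t0 <= s <= T -> o y s * E s <= o x t * E t).
    { intros y s Hy Hs. rewrite Heq. eapply Rle_trans; [|apply (Hmax y s Hy Hs)].
      apply Rmult_le_compat_r; [left; apply HE|apply Hle; assumption]. }
    assert (Hxx : oxx <= 0).
    { apply (second_derive_max (fun y => o y t) ox x oxx (Rmin (x - A) (B - x)) Hox Hoxx).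
      - apply Rmin_pos; lra.
      - intros y Hy. pose proof (Rmin_l (x - A) (B - x)). pose proof (Rmin_r (x - A) (B - x)).
        apply (Rmult_le_reg_r (E t)); [apply HE|]. apply Homax; lra. }
    assert (Htt : 0 <= ot * E t + o x t * (- (K + 1) * E t)).
    { apply (derive_left_max (fun s => o x s * E s) t _ (t - t0)).
      - apply (is_derive_mult (fun s => o x s) E t); [exact Hot|apply HdE|].
        intros n m; unfold mult; simpl; ring.
      - lra.
      - intros s Hs. apply Homax; lra. }
    assert (0 <= (ot - (K + 1) * o x t) * E t) by lra.
    assert (0 <= ot - (K + 1) * o x t).
    { apply (Rmult_le_reg_r (E t)); [apply HE|lra]. }
    assert (0 <= a * - oxx) by (apply Rmult_le_pos; lra).
    lra. }
  intros y s Hy Hs. apply (Rmult_le_reg_r (E s)); [apply HE|].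
  rewrite Rmult_0_l. eapply Rle_trans; [apply (Hmax y s Hy Hs)|].
  pose proof (HE t). nra.
Qed.

(** Linear growth from above is beaten by the penalisation
    [k (1 + x^2) exp (K2 t)], which confines the positive part of [w] to a bounded
    region; then [k] tends to 0. *)
Lemma max_principle (w : R -> R -> R) (a K C : R) (A B : Rbar) (t0 T : R) :
  0 <= a -> 0 <= K -> 0 <= t0 <= T ->
  continuous_on_closed_half_plane w ->
  (forall x t, t0 <= t <= T -> w x t <= C * (1 + Rabs x)) ->
  (forall x t : R, Rbar_le A x -> Rbar_le x B -> t0 <= t <= T -> 0 < w x t ->
     Rbar_lt A x /\ Rbar_lt x B /\ t0 < t /\
     exists wt wxx, jet w x t wt wxx /\ wt - a * wxx <= K * w x t) ->
  forall x t : R, Rbar_le A x -> Rbar_le x B -> t0 <= t <= T -> w x t <= 0.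
Proof.
  intros Ha HK HT Hw Hgrow Hin x t HxA HxB Ht.
  set (K2 := K + 2 * a).
  set (pen := fun (y s : R) => (1 + y ^ 2) * exp (K2 * s)).
  assert (Hexp : forall s, 0 <= s -> 1 <= exp (K2 * s)).
  { intros s Hs. rewrite <- exp_0. destruct (Req_dec (K2 * s) 0) as [->|Hne]; [lra|].
    left; apply exp_increasing. assert (0 <= K2 * s); [|lra].
    apply Rmult_le_pos; unfold K2; lra. }
  assert (Hpencont : continuous_on_closed_half_plane pen).
  { apply cont_mult.
    - apply (cont_space (fun y => 1 + y ^ 2)). intros y.
      apply (ex_derive_continuous (fun y : R => 1 + y ^ 2)). auto_derive; trivial.
    - apply (cont_time (fun s => exp (K2 * s))). intros s.
      apply (ex_derive_continuous (fun s : R => exp (K2 * s))). auto_derive; trivial. }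
  assert (Hpenjet : forall y s, jet pen y s (K2 * pen y s) (2 * exp (K2 * s))).
  { intros y s. unfold pen. split.
    - auto_derive; [trivial|ring].
    - exists (fun z => 2 * z * exp (K2 * s)). split; [intros z|];
        (auto_derive; [trivial|ring]). }
  assert (Hkap : forall k, 0 < k -> w x t <= k * pen x t).
  { intros k Hk.
    set (C' := Rmax C 0). assert (HC' : 0 <= C') by apply Rmax_r.
    assert (HCC : C <= C') by apply Rmax_l.
    set (N := 1 + Rabs x + 2 * C' / k).
    assert (HCk : 0 <= 2 * C' / k) by (apply Rdiv_le_0_compat; lra).
    pose proof (Rabs_pos x) as Hax.
    assert (HN : forall y s, t0 <= s <= T -> N <= Rabs y -> w y s <= k * pen y s).
    { intros y s Hs Hy. unfold pen. pose proof (Rabs_pos y) as Hay.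
      apply Rle_trans with (C' * (1 + Rabs y)).
      { eapply Rle_trans; [apply Hgrow; lra|]. apply Rmult_le_compat_r; lra. }
      apply Rle_trans with (k * (1 + y ^ 2)).
      - rewrite <- (pow2_abs y).
        assert (HC2 : 2 * C' = 2 * C' / k * k) by (field; lra).
        assert (2 * C' / k <= Rabs y) by (unfold N in Hy; lra).
        assert (1 <= Rabs y) by (unfold N in Hy; lra).
        assert (C' * (1 + Rabs y) <= 2 * C' * Rabs y) by nra.
        assert (2 * C' * Rabs y <= Rabs y * k * Rabs y).
        { apply Rmult_le_compat_r; [lra|]. rewrite HC2. apply Rmult_le_compat_r; lra. }
        nra.
      - assert (1 <= exp (K2 * s)) by (apply Hexp; lra).
        rewrite <- Rmult_assoc. rewrite <- (Rmult_1_r (k * (1 + y ^ 2))) at 1.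
        apply Rmult_le_compat_l; [|lra]. apply Rmult_le_pos; [lra|]. pose proof (pow2_ge_0 y); lra. }
    assert (Hends : exists A' B', A' <= x <= B' /\ - N <= A' /\ B' <= N /\
      (A' = - N \/ (A = Finite A')) /\ (B' = N \/ B = Finite B') /\ Rbar_le A A' /\ Rbar_le B' B).
    { assert (HxN : - N <= x <= N).
      { unfold N. pose proof (Rle_abs x). pose proof (Rle_abs (- x)).
        rewrite Rabs_Ropp in H0. lra. }
      assert (HA : exists A', A' <= x /\ - N <= A' /\ (A' = - N \/ (A = Finite A')) /\ Rbar_le A A').
      { destruct A as [A0| |]; simpl in HxA; [|easy|].
        - destruct (Rle_dec (- N) A0).
          + exists A0. repeat split; simpl; try lra. right; reflexivity.
          + exists (- N). repeat split; simpl; try lra.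
        - exists (- N). repeat split; simpl; try lra. }
      assert (HB : exists B', x <= B' /\ B' <= N /\ (B' = N \/ (B = Finite B')) /\ Rbar_le B' B).
      { destruct B as [B0| |]; simpl in HxB; [| |easy].
        - destruct (Rle_dec B0 N).
          + exists B0. repeat split; simpl; try lra. right; reflexivity.
          + exists N. repeat split; simpl; try lra.
        - exists N. repeat split; simpl; try lra. }
      destruct HA as [A' [? [? [? ?]]]], HB as [B' [? [? [? ?]]]].
      exists A', B'. repeat split; auto; lra. }
    destruct Hends as [A' [B' [Hx' [HA1 [HB1 [HA2 [HB2 [HA3 HB3]]]]]]]].
    assert (Hmain : w x t - k * pen x t <= 0); [|lra].
    apply (max_principle_rectangle (fun y s => w y s - k * pen y s) a K A' B' t0 T);
      try assumption; try lra.
    - apply cont_minus; [exact Hw|]. apply cont_scal, Hpencont.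
    - intros y s Hy Hs Hpos.
      assert (Hpen : 0 < pen y s).
      { unfold pen. apply Rmult_lt_0_compat; [|apply exp_pos].
        pose proof (pow2_ge_0 y); lra. }
      assert (Hwpos : 0 < w y s) by nra.
      assert (HyN : Rabs y < N).
      { apply Rnot_le_lt; intros Hge. specialize (HN y s Hs Hge). lra. }
      apply Rabs_def2 in HyN.
      destruct (Hin y s) as [HAy [HyB [Hts [wt [wxx [Hjet Hineq]]]]]]; try assumption.
      { eapply Rbar_le_trans; [exact HA3|]. simpl; lra. }
      { eapply Rbar_le_trans; [|exact HB3]. simpl; lra. }
      split; [split|split; [exact Hts|]].
      + destruct HA2 as [->| ->]; [lra|exact HAy].
      + destruct HB2 as [->| ->]; [lra|exact HyB].
      + exists (fun y s => w y s - k * pen y s), (wt - k * (K2 * pen y s)),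
          (wxx - k * (2 * exp (K2 * s))).
        split; [intros; lra|split; [reflexivity|split]].
        * apply (jet_ext (fun y s => 1 * w y s + - k * pen y s)); [intros; ring|].
          eapply jet_eq; [apply jet_lin; [exact Hjet|apply Hpenjet]| |]; ring.
        * assert (Hpe : exp (K2 * s) <= pen y s).
          { unfold pen. rewrite <- (Rmult_1_l (exp (K2 * s))) at 1.
            apply Rmult_le_compat_r; [left; apply exp_pos|]. pose proof (pow2_ge_0 y); lra. }
          assert (0 <= 2 * a * k * (pen y s - exp (K2 * s))).
          { apply Rmult_le_pos; [apply Rmult_le_pos|]; lra. }
          unfold K2 in *. lra. }
  apply Rnot_lt_le; intros Hpos.
  assert (Hpen : 0 < pen x t).
  { unfold pen. apply Rmult_lt_0_compat; [|apply exp_pos]. pose proof (pow2_ge_0 x); lra. }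
  specialize (Hkap (w x t / (2 * pen x t))).
  assert (0 < w x t / (2 * pen x t)) by (apply Rdiv_lt_0_compat; lra).
  specialize (Hkap H).
  replace (w x t / (2 * pen x t) * pen x t) with (w x t / 2) in Hkap by (field; lra). lra.
Qed.

(** * Periodic functions and their flows *)

Definition cont (f : R -> R) : Prop := forall x, continuous f x.
Definition periodic (f : R -> R) : Prop := forall x, f (x + 1) = f x.

Lemma derive_cont (f f1 : R -> R) : (forall x, is_derive f x (f1 x)) -> cont f.
Proof.
  intros H x. apply (ex_derive_continuous f). exists (f1 x); apply H.
Qed.

Lemma cont_ex_RInt (f : R -> R) (a b : R) : cont f -> ex_RInt f a b.
Proof. intros Hf. apply (ex_RInt_continuous (V := R_CompleteNormedModule)); intros z _; apply Hf. Qed.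

Lemma lipschitz_cont (f : R -> R) (K : R) :
  (forall x y, Rabs (f x - f y) <= K * Rabs (x - y)) -> cont f.
Proof.
  intros Hf x. apply filterlim_locally. intros e.
  assert (HK : 0 < Rabs K + 1) by (pose proof (Rabs_pos K); lra).
  assert (Hd : 0 < e / (Rabs K + 1)) by (apply Rdiv_lt_0_compat; [apply cond_pos|exact HK]).
  exists (mkposreal _ Hd). intros y Hy.
  change (Rabs (y - x) < e / (Rabs K + 1)) in Hy. change (Rabs (f y - f x) < e).
  eapply Rle_lt_trans; [apply Hf|].
  apply Rle_lt_trans with ((Rabs K + 1) * Rabs (y - x)).
  - apply Rmult_le_compat_r; [apply Rabs_pos|]. pose proof (Rle_abs K); lra.
  - apply (Rmult_lt_compat_l (Rabs K + 1)) in Hy; [|exact HK].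
    replace (pos e) with ((Rabs K + 1) * (e / (Rabs K + 1))) by (field; lra). exact Hy.
Qed.

Lemma lipschitz_constant_nonneg (f : R -> R) (K : R) :
  (forall x y, Rabs (f x - f y) <= K * Rabs (x - y)) -> 0 <= K.
Proof.
  intros H. specialize (H 0 1). pose proof (Rabs_pos (f 0 - f 1)).
  replace (Rabs (0 - 1)) with 1 in H by (rewrite Rabs_left1; lra). lra.
Qed.

Lemma cont_div (f g : R -> R) : cont f -> cont g -> (forall x, g x <> 0) ->
  cont (fun x => f x / g x).
Proof.
  intros Hf Hg H0 x.
  apply (continuous_mult (K := R_AbsRing) f (fun y => / g y)); [apply Hf|].
  apply continuous_Rinv_comp; [apply Hg|apply H0].
Qed.

Lemma cont_inv (g : R -> R) : cont g -> (forall x, 0 < g x) -> cont (fun x => / g x).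
Proof.
  intros Hg H0 x. apply continuous_Rinv_comp; [apply Hg|]. specialize (H0 x); lra.
Qed.

Lemma is_derive_eq (f : R -> R) (x l l' : R) : is_derive f x l -> l = l' -> is_derive f x l'.
Proof. intros H <-; exact H. Qed.

Lemma primitive_derive (f : R -> R) (x : R) :
  cont f -> is_derive (fun w => RInt f 0 w) x (f x).
Proof.
  intros Hf. apply (is_derive_RInt f (fun w => RInt f 0 w) 0 x); [|apply Hf].
  exists (mkposreal 1 Rlt_0_1). intros y _.
  apply (RInt_correct f), cont_ex_RInt, Hf.
Qed.

Lemma derive_zero_const (f : R -> R) (x y : R) :
  (forall z, is_derive f z 0) -> f x = f y.
Proof.
  intros H. destruct (MVT_gen f x y (fun _ => 0)) as [c [_ E]].
  - intros z _; apply H.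
  - intros z _. apply continuity_pt_filterlim, (derive_cont f (fun _ => 0)), H.
  - lra.
Qed.

Lemma is_derive_shift (f : R -> R) (x c l : R) :
  is_derive f (x + c) l -> is_derive (fun y => f (y + c)) x l.
Proof.
  intros H. eapply is_derive_eq.
  - apply (is_derive_comp f (fun y => y + c)); [exact H|].
    auto_derive; [trivial|reflexivity].
  - unfold scal; simpl; unfold mult; simpl; ring.
Qed.

Lemma primitive_periodic (f : R -> R) (w : R) :
  cont f -> periodic f -> RInt f 0 (w + 1) = RInt f 0 w + RInt f 0 1.
Proof.
  intros Hf Hp.
  assert (E : RInt f 0 (w + 1) - RInt f 0 w = RInt f 0 (0 + 1) - RInt f 0 0).
  { apply (derive_zero_const (fun w => RInt f 0 (w + 1) - RInt f 0 w)).
    intros z. eapply is_derive_eq.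
    - apply (is_derive_minus (fun w => RInt f 0 (w + 1)) (fun w => RInt f 0 w)).
      + apply (is_derive_shift (fun w => RInt f 0 w)), primitive_derive, Hf.
      + apply primitive_derive, Hf.
    - rewrite Hp. unfold minus, plus, opp; simpl; ring. }
  rewrite RInt_point, Rplus_0_l in E. unfold zero in E; simpl in E. lra.
Qed.

Lemma periodic_nat (f : R -> R) (x : R) (n : nat) : periodic f -> f (x + INR n) = f x.
Proof.
  intros Hp. induction n as [|n IH]; [simpl; rewrite Rplus_0_r; reflexivity|].
  rewrite S_INR, <- Rplus_assoc, Hp. exact IH.
Qed.

Lemma periodic_Z (f : R -> R) (x : R) (k : Z) : periodic f -> f (x + IZR k) = f x.
Proof.
  intros Hp. destruct (Z.le_gt_cases 0 k) as [H|H].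
  - rewrite <- (Z2Nat.id k H), <- INR_IZR_INZ. apply periodic_nat, Hp.
  - rewrite <- (periodic_nat f (x + IZR k) (Z.to_nat (- k)) Hp).
    f_equal. rewrite INR_IZR_INZ, Z2Nat.id by lia. rewrite opp_IZR. ring.
Qed.

Lemma periodic_reduce (f : R -> R) (x : R) : periodic f ->
  exists y, 0 <= y <= 1 /\ f x = f y.
Proof.
  intros Hp. destruct (base_fp x) as [H0 H1].
  exists (frac_part x). split; [lra|].
  rewrite <- (periodic_Z f (frac_part x) (Int_part x) Hp). f_equal.
  unfold frac_part; ring.
Qed.

Lemma periodic_max (f : R -> R) : cont f -> periodic f -> exists w, forall x, f x <= f w.
Proof.
  intros Hf Hp. destruct (continuity_ab_maj f 0 1) as [w [Hw _]]; [lra| |].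
  - intros c _. apply continuity_pt_filterlim, Hf.
  - exists w. intros x. destruct (periodic_reduce f x Hp) as [y [Hy ->]]. apply Hw, Hy.
Qed.

Lemma cont_opp (f : R -> R) : cont f -> cont (fun x => - f x).
Proof. intros Hf x. apply (continuous_opp f), Hf. Qed.

Lemma periodic_min (f : R -> R) : cont f -> periodic f -> exists w, forall x, f w <= f x.
Proof.
  intros Hf Hp. destruct (periodic_max (fun x => - f x)) as [w Hw].
  - apply cont_opp, Hf.
  - intros x; rewrite Hp; reflexivity.
  - exists w; intros x; specialize (Hw x); lra.
Qed.

Lemma RInt_period_shift (f : R -> R) (w : R) :
  cont f -> periodic f -> RInt f w (w + 1) = RInt f 0 1.
Proof.
  intros Hf Hp. pose proof (primitive_periodic f w Hf Hp) as H.
  pose proof (RInt_Chasles f 0 w (w + 1) (cont_ex_RInt _ _ _ Hf) (cont_ex_RInt _ _ _ Hf)) as H2.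
  unfold plus in H2; simpl in H2. lra.
Qed.

(** The flow [W' = m(W)] is the inverse of [Y(w) = int_0^w 1/m], hence needs no
    existence theorem for differential equations.  Since [Y] grows by [P] over each
    period, [W] has mean speed [1/P], up to a bounded error. *)
Lemma periodic_flow (m : R -> R) :
  cont m -> periodic m -> (forall w, 0 < m w) ->
  let P : R := RInt (fun w => / m w) 0 1 in
  0 < P /\
  exists W : R -> R, W 0 = 0 /\ (forall y, is_derive W y (m (W y))) /\
    (forall w, exists y, W y = w) /\
    forall y z, Rabs ((W y - W z) - (y - z) / P) <= 1.
Proof.
  intros Hc Hp Hpos P.
  assert (Hci : cont (fun w => / m w)) by (apply cont_inv; assumption).
  assert (Hpi : periodic (fun w => / m w)) by (intros x; rewrite Hp; reflexivity).
  destruct (periodic_max m Hc Hp) as [wM HM].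
  assert (HP : 0 < P).
  { apply RInt_gt_0; [lra| |].
    - intros x _. apply Rinv_0_lt_compat, Hpos.
    - intros x _. apply Hci. }
  split; [exact HP|].
  set (Y := (fun w => RInt (fun r => / m r) 0 w) : R -> R).
  assert (HY : forall w, is_derive Y w (/ m w)) by (intros w; apply (primitive_derive _ w Hci)).
  assert (HY1 : forall w, Y (w + 1) = Y w + P) by (intros w; apply (primitive_periodic _ w Hci Hpi)).
  assert (HY0 : Y 0 = 0) by (unfold Y; rewrite RInt_point; reflexivity).
  assert (HYn : forall n w, Y (w + INR n) = Y w + INR n * P).
  { induction n as [|n IH]; intros w; [simpl; rewrite Rplus_0_r; ring|].
    rewrite S_INR, <- Rplus_assoc, HY1, IH. ring. }
  assert (HYcont : continuity Y).
  { intros w. apply continuity_pt_filterlim, (derive_cont Y _ HY). }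
  assert (Hmvt : forall u v, exists c, Rmin u v <= c <= Rmax u v /\ Y v - Y u = / m c * (v - u)).
  { intros u v. destruct (MVT_gen Y u v (fun w => / m w)) as [c [Hcc E]].
    - intros z _; apply HY.
    - intros z _; apply HYcont.
    - exists c; split; assumption. }
  assert (Hsurj : forall y, exists w, Y w = y).
  { intros y. destruct (INR_unbounded (Rabs y / P)) as [k' Hk'].
    assert (Hk : Rabs y <= INR k' * P).
    { apply Rmult_gt_compat_r with (r := P) in Hk'; [|exact HP].
      unfold Rdiv in Hk'. rewrite Rmult_assoc, Rinv_l in Hk' by lra. lra. }
    assert (HA : Y (INR k') = INR k' * P).
    { rewrite <- (Rplus_0_l (INR k')) at 1. rewrite HYn, HY0. ring. }
    assert (HB : Y (- INR k') = - (INR k' * P)).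
    { pose proof (HYn k' (- INR k')) as E. rewrite Rplus_opp_l, HY0 in E. lra. }
    destruct (IVT_gen Y (- INR k') (INR k') y HYcont) as [w [_ Hw]].
    - rewrite HA, HB. apply Rcomplements.Rabs_le_between in Hk.
      rewrite Rmin_left, Rmax_right; lra.
    - exists w; exact Hw. }
  destruct (functional_choice (fun y w => Y w = y) Hsurj) as [W HW].
  assert (Hinj : forall u v, Y u = Y v -> u = v).
  { intros u v E. destruct (Hmvt u v) as [c [_ Hc']].
    assert (/ m c <> 0) by (apply Rinv_neq_0_compat; specialize (Hpos c); lra).
    assert (/ m c * (v - u) = 0) by lra.
    apply Rmult_integral in H0. destruct H0; [contradiction|lra]. }
  exists W. split; [|split; [|split]].
  - apply Hinj. rewrite HW, HY0. reflexivity.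
  - intros y. apply is_derive_Reals. intros e He.
    assert (Hcm : continuous m (W y)) by apply Hc.
    apply filterlim_locally with (eps := mkposreal e He) in Hcm.
    destruct Hcm as [d Hd].
    assert (HdM : 0 < d / m wM) by (apply Rdiv_lt_0_compat; [apply cond_pos|apply Hpos]).
    exists (mkposreal _ HdM). intros h Hh Hhd. simpl in Hhd.
    destruct (Hmvt (W y) (W (y + h))) as [c [Hcb E]].
    rewrite !HW in E.
    assert (Ew : W (y + h) - W y = m c * h).
    { transitivity (m c * (/ m c * (W (y + h) - W y))).
      - field. specialize (Hpos c); lra.
      - rewrite <- E. ring. }
    rewrite Ew. replace (m c * h / h) with (m c) by (field; exact Hh).
    assert (Hball : ball (m (W y)) e (m c)); [|exact Hball].
    apply Hd. change (Rabs (c - W y) < d).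
    apply Rle_lt_trans with (Rabs (W (y + h) - W y)).
    + revert Hcb. unfold Rmin, Rmax. destruct (Rle_dec (W y) (W (y + h))); intros Hcb.
      * rewrite !Rabs_right; lra.
      * rewrite !Rabs_left1; lra.
    + rewrite Ew, Rabs_mult, (Rabs_right (m c)) by (specialize (Hpos c); lra).
      apply Rle_lt_trans with (m wM * Rabs h).
      * apply Rmult_le_compat_r; [apply Rabs_pos|apply HM].
      * apply (Rmult_lt_compat_l (m wM)) in Hhd; [|apply Hpos].
        replace (m wM * (d / m wM)) with (pos d) in Hhd; [exact Hhd|].
        field. specialize (Hpos wM); lra.
  - intros w. exists (Y w). apply Hinj, HW.
  - intros y z.
    assert (Hgen : forall u v, u <= v -> Rabs ((Y v - Y u) / P - (v - u)) <= 1).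
    { intros u v Huv.
      destruct (base_fp (v - u)) as [Hf0 Hf1].
      set (r := frac_part (v - u)) in *.
      assert (Hk0 : (0 <= Int_part (v - u))%Z).
      { destruct (base_Int_part (v - u)) as [_ Hb].
        assert (-1 < IZR (Int_part (v - u))) by lra. apply lt_IZR in H. lia. }
      assert (Ev : v = u + r + INR (Z.to_nat (Int_part (v - u)))).
      { rewrite INR_IZR_INZ, Z2Nat.id by exact Hk0. unfold r, frac_part. ring. }
      set (k := Z.to_nat (Int_part (v - u))) in *.
      assert (EY : Y v = Y (u + r) + INR k * P) by (rewrite Ev at 1; apply HYn).
      assert (HYr : 0 <= Y (u + r) - Y u <= P).
      { destruct (Hmvt u (u + r)) as [c [_ Ec]].
        destruct (Hmvt (u + r) (u + 1)) as [c' [_ Ec']].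
        assert (0 < / m c) by (apply Rinv_0_lt_compat, Hpos).
        assert (0 < / m c') by (apply Rinv_0_lt_compat, Hpos).
        rewrite HY1 in Ec'. nra. }
      replace ((Y v - Y u) / P - (v - u)) with ((Y (u + r) - Y u) / P - r)
        by (rewrite EY, Ev at 1; field; lra).
      assert (0 <= (Y (u + r) - Y u) / P <= 1).
      { split; [apply Rdiv_le_0_compat; lra|].
        apply Rmult_le_reg_r with P; [exact HP|]. unfold Rdiv.
        rewrite Rmult_assoc, Rinv_l; lra. }
      apply Rabs_le; lra. }
    destruct (Rle_dec (W z) (W y)) as [Hle|Hle].
    + specialize (Hgen _ _ Hle). rewrite !HW in Hgen.
      rewrite <- Rabs_Ropp. replace (- (W y - W z - (y - z) / P)) with
        ((y - z) / P - (W y - W z)) by ring. exact Hgen.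
    + specialize (Hgen (W y) (W z) ltac:(lra)). rewrite !HW in Hgen.
      replace (W y - W z - (y - z) / P) with
        ((z - y) / P - (W z - W y)) by (field; lra). exact Hgen.
Qed.

(** * Periodic solutions of the profile equation *)

Lemma geometric_limit (f : nat -> R -> R) (th D : R) :
  0 <= th < 1 ->
  (forall n x, Rabs (f (S n) x - f n x) <= D * th ^ n) ->
  exists F, forall n x, Rabs (F x - f n x) <= D * th ^ n / (1 - th).
Proof.
  intros Hth Hf.
  assert (Hp : forall p n x, Rabs (f (n + p)%nat x - f n x) <= D * th ^ n / (1 - th)).
  { induction p as [|p IH]; intros n x.
    - rewrite Nat.add_0_r, Rminus_diag, Rabs_R0.
      pose proof (Rle_trans _ _ _ (Rabs_pos _) (Hf n x)).
      apply Rdiv_le_0_compat; lra.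
    - rewrite Nat.add_succ_r, <- Nat.add_succ_l.
      replace (f (S n + p)%nat x - f n x) with
        ((f (S n + p)%nat x - f (S n) x) + (f (S n) x - f n x)) by ring.
      eapply Rle_trans; [apply Rabs_triang|].
      eapply Rle_trans; [apply Rplus_le_compat; [apply IH|apply Hf]|].
      right. simpl. field. lra. }
  assert (Hlim : forall x, exists l : R, is_lim_seq (fun n => f n x) l).
  { intros x. apply ex_lim_seq_cauchy_corr. intros e.
    assert (Hgeo : is_lim_seq (fun n => 2 * D / (1 - th) * th ^ n) 0).
    { replace (Finite 0) with (Rbar_mult (2 * D / (1 - th)) 0) by (simpl; f_equal; ring).
      apply is_lim_seq_scal_l. apply is_lim_seq_geom. rewrite Rabs_right; lra. }
    apply is_lim_seq_spec in Hgeo. destruct (Hgeo e) as [N HN].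
    assert (HN' : 2 * (D * th ^ N / (1 - th)) < e).
    { specialize (HN N (Nat.le_refl N)). rewrite Rminus_0_r in HN.
      eapply Rle_lt_trans; [|exact HN]. eapply Rle_trans; [|apply Rle_abs].
      right; field; lra. }
    exists N. intros n m Hn Hm.
    replace n with (N + (n - N))%nat by lia. replace m with (N + (m - N))%nat by lia.
    pose proof (Hp (n - N)%nat N x) as H1. pose proof (Hp (m - N)%nat N x) as H2.
    rewrite Rabs_minus_sym in H2.
    eapply Rle_lt_trans; [|exact HN'].
    match goal with |- Rabs (?a - ?b) <= _ =>
      replace (a - b) with ((a - f N x) + (f N x - b)) by ring end.
    eapply Rle_trans; [apply Rabs_triang|]. lra. }
  destruct (functional_choice _ Hlim) as [F HF].
  exists F. intros n x.
  assert (H : is_lim_seq (fun p => Rabs (f (p + n)%nat x - f n x)) (Rabs (F x - f n x))).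
  { apply (is_lim_seq_abs _ (F x - f n x)). apply is_lim_seq_minus'; [|apply is_lim_seq_const].
    exact (proj1 (is_lim_seq_incr_n (fun k => f k x) n (F x)) (HF x)). }
  apply (is_lim_seq_le _ (fun _ => D * th ^ n / (1 - th)) _ _) with (2 := H)
    (3 := is_lim_seq_const _).
  intros p. rewrite Nat.add_comm. apply Hp.
Qed.

Lemma derive_max_global (f : R -> R) (x l : R) :
  is_derive f x l -> (forall y, f y <= f x) -> l = 0.
Proof. intros Hd Hm. apply (derive_max_zero f x l 1 Hd); [lra|]. intros y _; apply Hm. Qed.

(** At a maximum of [m1 - m2] the derivatives agree, so [mu (m1 - m2) = F1 - F2]
    there. *)
Lemma periodic_ode_compare (mu d : R) (m1 m2 F1 F2 : R -> R) :
  0 < mu -> periodic m1 -> periodic m2 ->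
  (forall w, is_derive m1 w (mu * m1 w - F1 w)) ->
  (forall w, is_derive m2 w (mu * m2 w - F2 w)) ->
  (forall w, F1 w <= F2 w + mu * d) -> forall w, m1 w <= m2 w + d.
Proof.
  intros Hmu Hp1 Hp2 Hm1 Hm2 HF w.
  assert (Hd : forall w, is_derive (fun w => m1 w - m2 w) w
    ((mu * m1 w - F1 w) - (mu * m2 w - F2 w))).
  { intros v. apply (is_derive_minus m1 m2); [apply Hm1|apply Hm2]. }
  destruct (periodic_max (fun w => m1 w - m2 w)) as [v Hv].
  - eapply derive_cont; exact Hd.
  - intros x. rewrite Hp1, Hp2. reflexivity.
  - pose proof (derive_max_global _ _ _ (Hd v) Hv) as E.
    specialize (HF v). specialize (Hv w).
    assert (mu * (m1 v - m2 v) <= mu * d) by lra.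
    apply Rmult_le_reg_l in H; [|exact Hmu]. lra.
Qed.

(** The periodic solution of [m' = mu m - F], namely
    [int_0^oo exp (- mu s) F(w + s) ds], folded onto one period. *)
Definition linear_response (mu : R) (F : R -> R) (w : R) : R :=
  / (1 - exp (- mu)) * exp (mu * w) *
  (RInt (fun r => exp (- mu * r) * F r) 0 (w + 1) -
   RInt (fun r => exp (- mu * r) * F r) 0 w).

Lemma linear_response_ode (mu : R) (F : R -> R) :
  0 < mu -> cont F -> periodic F ->
  periodic (linear_response mu F) /\
  forall w, is_derive (linear_response mu F) w (mu * linear_response mu F w - F w).
Proof.
  intros Hmu HF Hp.
  set (G := fun r => exp (- mu * r) * F r).
  assert (HG : cont G).
  { intros x. apply (continuous_mult (K := R_AbsRing) (fun r => exp (- mu * r)) F); [|apply HF].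
    apply (ex_derive_continuous (fun r => exp (- mu * r))). auto_derive; trivial. }
  assert (HG1 : forall r, G (r + 1) = exp (- mu) * G r).
  { intros r. unfold G. rewrite Hp. replace (- mu * (r + 1)) with (- mu + - mu * r) by ring.
    rewrite exp_plus. ring. }
  set (Phi := (fun w => RInt G 0 w) : R -> R).
  assert (HPhi : forall w, is_derive Phi w (G w)) by (intros w; apply primitive_derive, HG).
  assert (Hk : 1 - exp (- mu) <> 0).
  { assert (exp (- mu) < 1); [|lra]. rewrite <- exp_0. apply exp_increasing; lra. }
  assert (Hdiff : forall w, Phi (w + 1) - exp (- mu) * Phi w = Phi (0 + 1) - exp (- mu) * Phi 0).
  { intros w. apply (derive_zero_const (fun w => Phi (w + 1) - exp (- mu) * Phi w)).
    intros z. eapply is_derive_eq.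
    - apply (is_derive_minus (fun w => Phi (w + 1)) (fun w => exp (- mu) * Phi w)).
      + apply (is_derive_shift Phi), HPhi.
      + apply is_derive_scal, HPhi.
    - rewrite HG1. unfold minus, plus, opp; simpl; ring. }
  change (linear_response mu F) with
    (fun w => / (1 - exp (- mu)) * exp (mu * w) * (Phi (w + 1) - Phi w)).
  split.
  - intros w.
    replace (mu * (w + 1)) with (mu + mu * w) by ring. rewrite exp_plus.
    pose proof (Hdiff w) as E1. pose proof (Hdiff (w + 1)) as E2.
    assert (E : Phi (w + 1 + 1) - Phi (w + 1) = exp (- mu) * (Phi (w + 1) - Phi w)) by lra.
    rewrite E. rewrite exp_Ropp. field.
    assert (1 < exp mu) by (rewrite <- exp_0; apply exp_increasing; lra).
    split; lra.
  - intros w. eapply is_derive_eq.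
    + apply (is_derive_mult (fun w => / (1 - exp (- mu)) * exp (mu * w))
        (fun w => Phi (w + 1) - Phi w) w (/ (1 - exp (- mu)) * (mu * exp (mu * w)))
        (G (w + 1) - G w)).
      * apply is_derive_scal. auto_derive; [trivial|ring].
      * apply (is_derive_minus (fun w => Phi (w + 1)) Phi); [|apply HPhi].
        apply (is_derive_shift Phi), HPhi.
      * intros; apply Rmult_comm.
    + unfold plus, mult; simpl. rewrite HG1. unfold G.
      replace (- mu * w) with (- (mu * w)) by ring. rewrite !(exp_Ropp (mu * w)).
      field. split; [exact Hk|apply Rgt_not_eq, exp_pos].
Qed.

(** The equation [q m m' = lam m - g] is what the wave equation
    [q W'' + g(W) = lam W'] becomes for the speed [m = W'] as a function of the
    height [W].  Written as [m' = mu m - psi(w, m)] with [mu] large, [psi] increases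
    in [m] more slowly than [mu m] on the band between the constant sub- and
    supersolution [gm/lam] and [gM/lam], so the response operator is a contraction
    of that band. *)
Lemma profile_exists (g : R -> R) (gm gM lam q : R) :
  cont g -> periodic g -> 0 < gm -> (forall w, gm <= g w <= gM) -> 0 < lam -> 0 < q ->
  exists m m1 : R -> R, (forall w, is_derive m w (m1 w)) /\ periodic m /\
    (forall w, gm / lam <= m w <= gM / lam) /\
    (forall w, q * m w * m1 w = lam * m w - g w).
Proof.
  intros Hg Hgp Hgm Hgb Hlam Hq.
  assert (HgmM : gm <= gM) by (specialize (Hgb 0); lra).
  set (a := gm / lam). set (b := gM / lam).
  assert (Ha : 0 < a) by (apply Rdiv_lt_0_compat; lra).
  assert (Hab : a <= b).
  { unfold a, b, Rdiv. apply Rmult_le_compat_r; [left; apply Rinv_0_lt_compat|]; lra. }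
  assert (Ela : lam * a = gm) by (unfold a; field; lra).
  assert (Elb : lam * b = gM) by (unfold b; field; lra).
  set (mu := gM / (q * (a * a))). set (nu := gm / (q * (b * b))).
  assert (Haa : 0 < a * a) by nra. assert (Hbb : 0 < b * b) by nra.
  assert (Hqa : 0 < q * (a * a)) by (apply Rmult_lt_0_compat; lra).
  assert (Hqb : 0 < q * (b * b)) by (apply Rmult_lt_0_compat; lra).
  assert (Hmu : 0 < mu) by (apply Rdiv_lt_0_compat; lra).
  assert (Hnu : 0 < nu) by (apply Rdiv_lt_0_compat; lra).
  set (psi := fun w m => mu * m - (lam - g w / m) / q).
  assert (Hpsi : forall w u v, a <= u -> u <= v -> v <= b ->
    0 <= psi w v - psi w u <= (mu - nu) * (v - u)).
  { intros w u v Hu Huv Hv.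
    replace (psi w v - psi w u) with ((mu - g w / (q * (u * v))) * (v - u))
      by (unfold psi; field; lra).
    specialize (Hgb w).
    assert (Huv1 : a * a <= u * v) by (apply Rmult_le_compat; lra).
    assert (Huv2 : u * v <= b * b) by (apply Rmult_le_compat; lra).
    assert (H1 : g w / (q * (u * v)) <= mu).
    { unfold mu, Rdiv. apply Rmult_le_compat; try lra.
      - left; apply Rinv_0_lt_compat. apply Rmult_lt_0_compat; lra.
      - apply Rinv_le_contravar; [exact Hqa|]. apply Rmult_le_compat_l; lra. }
    assert (H2 : nu <= g w / (q * (u * v))).
    { unfold nu, Rdiv. apply Rmult_le_compat; try lra.
      - left; apply Rinv_0_lt_compat, Hqb.
      - apply Rinv_le_contravar; [apply Rmult_lt_0_compat; lra|]. apply Rmult_le_compat_l; lra. }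
    split; [apply Rmult_le_pos; lra|]. apply Rmult_le_compat_r; lra. }
  assert (Hpsia : forall w, mu * a <= psi w a).
  { intros w. unfold psi. specialize (Hgb w).
    assert (lam <= g w / a).
    { apply Rmult_le_reg_r with a; [exact Ha|]. unfold Rdiv.
      rewrite Rmult_assoc, Rinv_l; lra. }
    assert ((lam - g w / a) / q <= 0); [|lra].
    unfold Rdiv at 1. assert (0 < / q) by (apply Rinv_0_lt_compat; lra). nra. }
  assert (Hpsib : forall w, psi w b <= mu * b).
  { intros w. unfold psi. specialize (Hgb w).
    assert (g w / b <= lam).
    { apply Rmult_le_reg_r with b; [lra|]. unfold Rdiv.
      rewrite Rmult_assoc, Rinv_l; lra. }
    assert (0 <= (lam - g w / b) / q); [|lra].
    apply Rdiv_le_0_compat; lra. }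
  assert (Hpsic : forall m, cont m -> (forall w, a <= m w) -> cont (fun w => psi w (m w))).
  { intros m Hm Hma w.
    apply (continuous_minus (fun w => mu * m w) (fun w => (lam - g w / m w) / q)).
    - apply (continuous_scal_r mu m), Hm.
    - apply (continuous_mult (K := R_AbsRing) (fun w => lam - g w / m w) (fun _ => / q));
        [|apply continuous_const].
      apply (continuous_minus (fun _ => lam) (fun w => g w / m w)); [apply continuous_const|].
      apply (cont_div g m); auto. intros x. specialize (Hma x); lra. }
  assert (Hpsip : forall m, periodic m -> periodic (fun w => psi w (m w))).
  { intros m Hm w. unfold psi. rewrite Hm, Hgp. reflexivity. }
  set (th := (mu - nu) / mu).
  assert (Hmunu : nu <= mu).
  { specialize (Hpsi 0 a b). destruct (Rle_lt_or_eq_dec a b Hab) as [Hlt|Heq].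
    - destruct Hpsi; try lra. assert (0 <= (mu - nu) * (b - a)) by lra.
      apply Rmult_le_reg_r with (b - a); lra.
    - unfold nu, mu. rewrite <- Heq. apply Rmult_le_compat_r; [|lra].
      left; apply Rinv_0_lt_compat, Hqa. }
  assert (Hth : 0 <= th < 1).
  { unfold th. split; [apply Rdiv_le_0_compat; lra|].
    apply Rmult_lt_reg_r with mu; [exact Hmu|]. unfold Rdiv. rewrite Rmult_assoc, Rinv_l; lra. }
  assert (Emuth : mu * th = mu - nu) by (unfold th; field; lra).
  assert (Hlip : forall w u v d, a <= u <= b -> a <= v <= b -> Rabs (u - v) <= d ->
    psi w u <= psi w v + mu * (th * d)).
  { intros w u v d Hu Hv Hd. apply Rcomplements.Rabs_le_between in Hd.
    rewrite <- Rmult_assoc, Emuth.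
    destruct (Rle_dec u v) as [H|H].
    - destruct (Hpsi w u v) as [H0 _]; try lra.
      assert (0 <= (mu - nu) * d) by (apply Rmult_le_pos; lra). lra.
    - destruct (Hpsi w v u) as [_ H1]; try lra.
      assert ((mu - nu) * (u - v) <= (mu - nu) * d) by (apply Rmult_le_compat_l; lra). lra. }
  set (T := fun m => linear_response mu (fun w => psi w (m w))).
  set (good := fun m : R -> R => cont m /\ periodic m /\ forall w, a <= m w <= b).
  assert (HTode : forall m, good m -> periodic (T m) /\
    forall w, is_derive (T m) w (mu * T m w - psi w (m w))).
  { intros m [Hmc [Hmp Hmb]]. apply (linear_response_ode mu (fun w => psi w (m w)) Hmu).
    - apply Hpsic; [exact Hmc|]. intros w; apply Hmb.
    - apply Hpsip, Hmp. }
  assert (HTgood : forall m, good m -> good (T m)).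
  { intros m Hm. destruct (HTode m Hm) as [Hper Hode]. destruct Hm as [Hmc [Hmp Hmb]].
    split; [eapply derive_cont; exact Hode|]. split; [exact Hper|].
    assert (Hconst : forall c w, is_derive (fun _ : R => c) w (mu * c - mu * c)).
    { intros c w. rewrite Rminus_diag. apply (is_derive_const c). }
    intros w. split.
    - rewrite <- (Rplus_0_r (T m w)).
      apply (periodic_ode_compare mu 0 (fun _ => a) (T m) (fun _ => mu * a)
        (fun w => psi w (m w))); try assumption; try (intros ?; reflexivity).
      + apply Hconst.
      + intros v. rewrite Rmult_0_r, Rplus_0_r. specialize (Hmb v).
        destruct (Hpsi v a (m v)); try lra. specialize (Hpsia v). lra.
    - rewrite <- (Rplus_0_r b).
      apply (periodic_ode_compare mu 0 (T m) (fun _ => b) (fun w => psi w (m w))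
        (fun _ => mu * b)); try assumption; try (intros ?; reflexivity).
      + apply Hconst.
      + intros v. rewrite Rmult_0_r, Rplus_0_r. specialize (Hmb v).
        destruct (Hpsi v (m v) b); try lra. specialize (Hpsib v). lra. }
  assert (HTcontr : forall m m' d, good m -> good m' ->
    (forall w, Rabs (m w - m' w) <= d) -> forall w, Rabs (T m w - T m' w) <= th * d).
  { intros m m' d Hm Hm' Hd w.
    destruct (HTode m Hm) as [Hper Hode]. destruct (HTode m' Hm') as [Hper' Hode'].
    destruct Hm as [Hmc [Hmp Hmb]], Hm' as [Hmc' [Hmp' Hmb']].
    assert (T m w <= T m' w + th * d).
    { apply (periodic_ode_compare mu (th * d) (T m) (T m') _ _ Hmu Hper Hper' Hode Hode').
      intros v. apply Hlip; auto. }
    assert (T m' w <= T m w + th * d).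
    { apply (periodic_ode_compare mu (th * d) (T m') (T m) _ _ Hmu Hper' Hper Hode' Hode).
      intros v. apply Hlip; auto. rewrite Rabs_minus_sym; apply Hd. }
    apply Rabs_le; lra. }
  set (f := fix f n := match n with O => fun _ : R => a | S n => T (f n) end).
  assert (Hfgood : forall n, good (f n)).
  { induction n as [|n IH]; [|apply HTgood, IH].
    split; [intros x; apply continuous_const|]. split; [intros x; reflexivity|].
    intros w; simpl; lra. }
  assert (Hfstep : forall n x, Rabs (f (S n) x - f n x) <= (b - a) * th ^ n).
  { induction n as [|n IH]; intros x.
    - destruct (Hfgood 1%nat) as [_ [_ Hb]]. specialize (Hb x).
      rewrite pow_O, Rmult_1_r. change (f O x) with a. apply Rabs_le; lra.
    - replace ((b - a) * th ^ S n) with (th * ((b - a) * th ^ n)) by (simpl; ring).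
      apply (HTcontr (f (S n)) (f n)); auto. }
  destruct (geometric_limit f th (b - a) Hth Hfstep) as [m Hm].
  set (r := fun n => (b - a) * th ^ n / (1 - th)) in *.
  assert (Hr : forall e, 0 < e -> exists n, r n < e).
  { intros e He.
    assert (Hgeo : is_lim_seq r 0).
    { apply (is_lim_seq_ext (fun n => (b - a) / (1 - th) * th ^ n)).
      { intros n; unfold r; field; lra. }
      replace (Finite 0) with (Rbar_mult ((b - a) / (1 - th)) 0) by (simpl; f_equal; ring).
      apply is_lim_seq_scal_l. apply is_lim_seq_geom. rewrite Rabs_right; lra. }
    apply is_lim_seq_spec in Hgeo. destruct (Hgeo (mkposreal e He)) as [N HN].
    exists N. specialize (HN N (Nat.le_refl N)). rewrite Rminus_0_r in HN. simpl in HN.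
    eapply Rle_lt_trans; [apply Rle_abs|exact HN]. }
  assert (Hmgood : good m).
  { split; [|split].
    - intros x. apply filterlim_locally. intros e.
      destruct (Hr (e / 3)) as [n Hn]; [pose proof (cond_pos e); lra|].
      destruct (Hfgood n) as [Hc _]. specialize (Hc x).
      assert (He3 : 0 < e / 3) by (pose proof (cond_pos e); lra).
      apply filterlim_locally with (eps := mkposreal _ He3) in Hc.
      revert Hc. apply filter_imp. intros y Hy.
      change (Rabs (f n y - f n x) < e / 3) in Hy. change (Rabs (m y - m x) < e).
      pose proof (Hm n x) as H1. pose proof (Hm n y) as H2. fold (r n) in H1, H2.
      apply Rabs_def2 in Hy. apply Rcomplements.Rabs_le_between in H1, H2.
      apply Rabs_def1; lra.
    - intros x. apply cond_eq. intros e He.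
      destruct (Hr (e / 2)) as [n Hn]; [lra|].
      destruct (Hfgood n) as [_ [Hp _]]. specialize (Hp x).
      pose proof (Hm n x) as H1. pose proof (Hm n (x + 1)) as H2. fold (r n) in H1, H2.
      apply Rcomplements.Rabs_le_between in H1, H2. apply Rabs_def1; lra.
    - intros w. split; apply le_epsilon; intros e He; destruct (Hr e He) as [n Hn];
        destruct (Hfgood n) as [_ [_ Hb]]; specialize (Hb w);
        pose proof (Hm n w) as H1; fold (r n) in H1;
        apply Rcomplements.Rabs_le_between in H1; lra. }
  assert (Hfix : forall w, T m w = m w).
  { intros w. apply cond_eq. intros e He.
    destruct (Hr (e / 2)) as [n Hn]; [lra|].
    assert (H1 : Rabs (T m w - T (f n) w) <= th * r n).
    { apply (HTcontr m (f n) (r n) Hmgood (Hfgood n)). intros v; apply (Hm n v). }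
    pose proof (Hm (S n) w) as H2. fold (r (S n)) in H2.
    assert (E : r (S n) = th * r n) by (unfold r; simpl; field; lra).
    rewrite E in H2. change (f (S n) w) with (T (f n) w) in H2.
    assert (Hrn : 0 <= r n) by (eapply Rle_trans; [apply Rabs_pos|apply (Hm n w)]).
    assert (th * r n <= r n) by nra.
    apply Rcomplements.Rabs_le_between in H1, H2. apply Rabs_def1; lra. }
  destruct (HTode m Hmgood) as [_ Hode].
  exists m, (fun w => (lam - g w / m w) / q).
  destruct Hmgood as [Hmc [Hmp Hmb]].
  split; [|split; [exact Hmp|split; [exact Hmb|]]].
  - intros w. apply (is_derive_ext (T m)); [exact Hfix|].
    eapply is_derive_eq; [apply Hode|]. rewrite Hfix. unfold psi. ring.
  - intros w. specialize (Hmb w). field. lra.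
Qed.

(** * Waves *)

Definition speed (g : R -> R) (Lg gm gM : R) : Prop :=
  (forall x y, Rabs (g x - g y) <= Lg * Rabs (x - y)) /\ periodic g /\
  0 < gm /\ forall w, gm <= g w <= gM.

Definition mean (f : R -> R) : R := RInt f 0 1.

(** Wave inequalities at squared slope [q] and speed [lam]: super-waves for
    [s = 1], sub-waves for [s = -1].  That [W] advances by one period when its phase
    does is recorded as [|W y - y| <= 1].  The curvature is bounded by the speed both
    uniformly in [q] and with a factor [1/q]: small and large slopes will both
    tolerate a small mismatch between [q] and the true squared slope. *)
Definition wave (g : R -> R) (s lam q C : R) (W W1 W2 : R -> R) : Prop :=
  (forall y, is_derive W y (W1 y)) /\ (forall y, is_derive W1 y (W2 y)) /\
  (forall y, Rabs (W y - y) <= 1) /\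
  forall y, 0 < W1 y /\ Rabs (W2 y) <= C * W1 y /\ q * Rabs (W2 y) <= C * W1 y /\
    0 <= s * (lam * W1 y - q * W2 y - g (W y)).

Lemma wave_weaken (g : R -> R) (s lam q C C' : R) (W W1 W2 : R -> R) :
  C <= C' -> wave g s lam q C W W1 W2 -> wave g s lam q C' W W1 W2.
Proof.
  intros HC [H1 [H2 [H3 H4]]]. split; [exact H1|]. split; [exact H2|]. split; [exact H3|].
  intros z. destruct (H4 z) as [K1 [K2 [K3 K4]]].
  assert (C * W1 z <= C' * W1 z) by (apply Rmult_le_compat_r; lra).
  repeat split; lra.
Qed.

Lemma wave_of_profile (g : R -> R) (s lam q C : R) (n n1 : R -> R) :
  (forall w, is_derive n w (n1 w)) -> periodic n -> (forall w, 0 < n w) ->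
  mean (fun w => / n w) = 1 ->
  (forall w, Rabs (n1 w) <= C) -> (forall w, q * Rabs (n1 w) <= C) ->
  (forall w, 0 <= s * (lam * n w - q * n w * n1 w - g w)) ->
  exists W W1 W2, wave g s lam q C W W1 W2.
Proof.
  intros Hn Hp Hpos Hmean HC HqC Hin.
  destruct (periodic_flow n (derive_cont _ _ Hn) Hp Hpos) as [_ [W [HW0 [HW [_ HWb]]]]].
  fold (mean (fun w => / n w)) in HWb. rewrite Hmean in HWb.
  exists W, (fun y => n (W y)), (fun y => n (W y) * n1 (W y)).
  split; [exact HW|split; [|split]].
  - intros y. apply (is_derive_comp n W); [apply Hn|apply HW].
  - intros y. specialize (HWb y 0). rewrite HW0 in HWb.
    replace (W y - y) with (W y - 0 - (y - 0) / 1) by field. exact HWb.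
  - intros y. specialize (Hpos (W y)). specialize (HC (W y)). specialize (HqC (W y)).
    specialize (Hin (W y)).
    rewrite Rabs_mult, (Rabs_right (n (W y))) by lra.
    split; [exact Hpos|]. split; [|split].
    + rewrite (Rmult_comm C). apply Rmult_le_compat_l; lra.
    + replace (q * (n (W y) * Rabs (n1 (W y)))) with (n (W y) * (q * Rabs (n1 (W y)))) by ring.
      rewrite (Rmult_comm C). apply Rmult_le_compat_l; lra.
    + replace (lam * n (W y) - q * (n (W y) * n1 (W y)) - g (W y)) with
        (lam * n (W y) - q * n (W y) * n1 (W y) - g (W y)) by ring. exact Hin.
Qed.

Lemma derive_right_max (f : R -> R) (x l : R) :
  is_derive f x l -> (forall y, x < y -> f y <= f x) -> l <= 0.
Proof.
  intros Hf Hm. assert (0 <= - l); [|lra].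
  apply (derive_left_max (fun y => f (- y)) (- x) (- l) 1); [|lra|].
  - eapply is_derive_eq.
    + apply (is_derive_comp f (fun y => - y) (- x) l (- 1)).
      * rewrite Ropp_involutive; exact Hf.
      * auto_derive; [trivial|ring].
    + unfold scal; simpl; unfold mult; simpl; ring.
  - intros y Hy. rewrite Ropp_involutive. apply Hm; lra.
Qed.

(** The factor [1/q] is read off the equation.  For the uniform bound, let
    [f = lam m - g] be maximal at [w]: then [lam m' <= Lg] at [w] as [g] is Lipschitz,
    so [f <= q m Lg / lam] there, and [q m m' = f] everywhere. *)
Lemma profile_slope_bound (g : R -> R) (Lg gm gM lam q : R) (m m1 : R -> R) :
  speed g Lg gm gM -> 0 < lam -> 0 < q ->
  (forall w, is_derive m w (m1 w)) -> periodic m ->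
  (forall w, gm / lam <= m w <= gM / lam) ->
  (forall w, q * m w * m1 w = lam * m w - g w) ->
  forall w, Rabs (m1 w) <= gM * Lg / (lam * gm) /\ q * Rabs (m1 w) <= lam + lam * gM / gm.
Proof.
  intros [HLg [Hgp [Hgm Hgb]]] Hlam Hq Hm Hmp Hmb Hode.
  set (f := fun w => lam * m w - g w).
  assert (Hfc : cont f).
  { intros x. apply (continuous_minus (fun w => lam * m w) g).
    - apply (continuous_scal_r lam m), (derive_cont m m1 Hm).
    - apply (lipschitz_cont g Lg HLg). }
  assert (Hfp : periodic f) by (intros x; unfold f; rewrite Hmp, Hgp; reflexivity).
  pose proof (lipschitz_constant_nonneg g Lg HLg) as HL0.
  assert (HgM : gm <= gM) by (specialize (Hgb 0); lra).
  assert (Hm0 : forall w, 0 < m w).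
  { intros w. specialize (Hmb w). assert (0 < gm / lam) by (apply Rdiv_lt_0_compat; lra). lra. }
  assert (Hlm : forall w, gm <= lam * m w <= gM).
  { intros w. specialize (Hmb w).
    replace gm with (lam * (gm / lam)) by (field; lra).
    replace gM with (lam * (gM / lam)) by (field; lra).
    split; apply Rmult_le_compat_l; lra. }
  assert (Hlip : forall w y, w < y -> g y - g w <= Lg * (y - w) /\ g w - g y <= Lg * (y - w)).
  { intros w y Hwy. specialize (HLg y w). rewrite (Rabs_right (y - w)) in HLg by lra.
    apply Rcomplements.Rabs_le_between in HLg. lra. }
  assert (Hder : forall c d w, is_derive (fun y => c * m y + d * y) w (c * m1 w + d)).
  { intros c d w. apply (is_derive_plus (fun y => c * m y) (fun y => d * y)).
    - apply is_derive_scal, Hm.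
    - auto_derive; [trivial|ring]. }
  set (B := q * (gM * Lg / (lam * lam))).
  assert (Hfb : forall w, - B <= f w <= B).
  { assert (Hext : forall w, lam * m1 w <= Lg -> f w <= B).
    { intros w Hw. unfold f, B. rewrite <- Hode, Rmult_assoc.
      apply Rmult_le_compat_l; [lra|].
      replace (gM * Lg / (lam * lam)) with (gM / lam * (Lg / lam)) by (field; lra).
      apply Rle_trans with (m w * (Lg / lam)).
      - apply Rmult_le_compat_l; [specialize (Hm0 w); lra|].
        apply Rmult_le_reg_l with lam; [exact Hlam|].
        replace (lam * (Lg / lam)) with Lg by (field; lra). exact Hw.
      - apply Rmult_le_compat_r; [|apply Hmb]. apply Rdiv_le_0_compat; lra. }
    assert (Hext' : forall w, - Lg <= lam * m1 w -> - B <= f w).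
    { intros w Hw. unfold f, B. rewrite <- Hode, Rmult_assoc.
      assert (- (m w * m1 w) <= gM * Lg / (lam * lam)); [|nra].
      replace (gM * Lg / (lam * lam)) with (gM / lam * (Lg / lam)) by (field; lra).
      apply Rle_trans with (m w * (Lg / lam)).
      - replace (- (m w * m1 w)) with (m w * - m1 w) by ring.
        apply Rmult_le_compat_l; [specialize (Hm0 w); lra|].
        apply Rmult_le_reg_l with lam; [exact Hlam|].
        replace (lam * (Lg / lam)) with Lg by (field; lra). lra.
      - apply Rmult_le_compat_r; [|apply Hmb]. apply Rdiv_le_0_compat; lra. }
    destruct (periodic_max f Hfc Hfp) as [wM HwM].
    destruct (periodic_min f Hfc Hfp) as [wm Hwm].
    intros w. split.
    - eapply Rle_trans; [|apply Hwm]. apply Hext'.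
      assert (- lam * m1 wm + - Lg <= 0); [|lra].
      apply (derive_right_max (fun y => - lam * m y + - Lg * y) wm); [apply Hder|].
      intros y Hy. specialize (Hwm y). specialize (Hlip wm y Hy). unfold f in Hwm. lra.
    - eapply Rle_trans; [apply HwM|]. apply Hext.
      assert (lam * m1 wM + - Lg <= 0); [|lra].
      apply (derive_right_max (fun y => lam * m y + - Lg * y) wM); [apply Hder|].
      intros y Hy. specialize (HwM y). specialize (Hlip wM y Hy). unfold f in HwM. lra. }
  assert (Eabs : forall w, q * m w * Rabs (m1 w) = Rabs (f w)).
  { intros w. unfold f. rewrite <- Hode, Rabs_mult, (Rabs_right (q * m w)); [reflexivity|].
    apply Rle_ge, Rmult_le_pos; [lra|]. specialize (Hm0 w); lra. }
  intros w. specialize (Eabs w). specialize (Hmb w). specialize (Hm0 w). specialize (Hlm w).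
  specialize (Hgb w). pose proof (Rabs_pos (m1 w)) as Ha.
  split.
  - assert (Hf : Rabs (f w) <= B) by (apply Rabs_le, Hfb).
    assert (q * (gm / lam) * Rabs (m1 w) <= B).
    { eapply Rle_trans; [|exact Hf]. rewrite <- Eabs. apply Rmult_le_compat_r; [exact Ha|].
      apply Rmult_le_compat_l; lra. }
    assert (Hd : 0 < q * (gm / lam)).
    { apply Rmult_lt_0_compat; [lra|]. apply Rdiv_lt_0_compat; lra. }
    apply Rmult_le_reg_l with (q * (gm / lam)); [exact Hd|].
    eapply Rle_trans; [exact H|]. right. unfold B. field. lra.
  - assert (Hf2 : Rabs (f w) <= lam * m w + gM) by (apply Rabs_le; unfold f; lra).
    apply Rmult_le_reg_l with (m w); [exact Hm0|].
    replace (m w * (q * Rabs (m1 w))) with (q * m w * Rabs (m1 w)) by ring. rewrite Eabs.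
    eapply Rle_trans; [exact Hf2|].
    assert (gM <= m w * (lam * gM / gm)); [|lra].
    apply Rmult_le_reg_r with gm; [exact Hgm|].
    replace (m w * (lam * gM / gm) * gm) with (gM * (lam * m w)) by (field; lra).
    apply Rmult_le_compat_l; lra.
Qed.

(** Adding a constant to a profile keeps the wave inequality on the good side
    (see [wave_of_shifted_profile]); by the intermediate value theorem it can be
    chosen so that the profile crosses one period of height in unit phase. *)
Lemma normalise_profile (m : R -> R) (c b0 b1 : R) :
  cont m -> 0 < c -> b0 <= b1 -> (forall w, c <= m w + b0) ->
  1 <= mean (fun w => / (m w + b0)) -> mean (fun w => / (m w + b1)) <= 1 ->
  exists b, b0 <= b <= b1 /\ mean (fun w => / (m w + b)) = 1.
Proof.
  intros Hm Hc Hb Hlow H0 H1.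
  set (J := (fun b => mean (fun w => / Rmax c (m w + b))) : R -> R).
  assert (Hmaxc : forall b, cont (fun w => Rmax c (m w + b))).
  { intros b x. unfold Rmax.
    apply (continuous_ext (fun w => / 2 * (c + (m w + b) + Rabs (c - (m w + b))))).
    { intros w. destruct (Rle_dec c (m w + b)).
      - rewrite Rabs_left1; lra.
      - rewrite Rabs_right; lra. }
    assert (Hs : continuous (fun w => m w + b) x)
      by (apply (continuous_plus m (fun _ => b)); [apply Hm|apply continuous_const]).
    apply (continuous_scal_r (/ 2) (fun w => c + (m w + b) + Rabs (c - (m w + b)))).
    apply (continuous_plus (fun w => c + (m w + b)) (fun w => Rabs (c - (m w + b)))).
    - apply (continuous_plus (fun _ => c) (fun w => m w + b)); [apply continuous_const|exact Hs].
    - apply (continuous_comp (fun w => c - (m w + b)) Rabs); [|apply continuous_Rabs].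
      apply (continuous_minus (fun _ => c) (fun w => m w + b)); [apply continuous_const|exact Hs]. }
  assert (Hmaxpos : forall b w, 0 < Rmax c (m w + b)).
  { intros b w. pose proof (Rmax_l c (m w + b)). lra. }
  assert (Hint : forall b, ex_RInt (fun w => / Rmax c (m w + b)) 0 1).
  { intros b. apply cont_ex_RInt, cont_inv; auto. }
  assert (HJ : forall b, b0 <= b -> J b = mean (fun w => / (m w + b))).
  { intros b Hbb. apply RInt_ext. intros w _. rewrite Rmax_right; [reflexivity|].
    specialize (Hlow w); lra. }
  assert (HJlip : forall b d, Rabs (J b - J d) <= / (c * c) * Rabs (b - d)).
  { intros b d.
    assert (E : J b - J d = RInt (fun w => / Rmax c (m w + b) - / Rmax c (m w + d)) 0 1).
    { symmetry. apply (RInt_minus (fun w => / Rmax c (m w + b)) (fun w => / Rmax c (m w + d)));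
        apply Hint. }
    rewrite E.
    assert (Hex : ex_RInt (fun w => / Rmax c (m w + b) - / Rmax c (m w + d)) 0 1)
      by (apply (ex_RInt_minus (fun w => / Rmax c (m w + b)) (fun w => / Rmax c (m w + d)));
        apply Hint).
    eapply Rle_trans; [apply (abs_RInt_le_const _ 0 1 (/ (c * c) * Rabs (b - d)))|].
    - lra.
    - exact Hex.
    - intros w _.
      pose proof (Rmax_l c (m w + b)) as Hx. pose proof (Rmax_l c (m w + d)) as Hy.
      assert (Hxy : Rabs (Rmax c (m w + d) - Rmax c (m w + b)) <= Rabs (b - d)).
      { unfold Rmax. destruct (Rle_dec c (m w + d)), (Rle_dec c (m w + b));
          unfold Rabs; destruct (Rcase_abs (b - d)); destruct (Rcase_abs _); lra. }
      set (X := Rmax c (m w + b)) in *. set (Z := Rmax c (m w + d)) in *.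
      replace (/ X - / Z) with (/ (X * Z) * (Z - X)) by (field; lra).
      rewrite Rabs_mult. apply Rmult_le_compat; try apply Rabs_pos; [|exact Hxy].
      assert (c * c <= X * Z) by (apply Rmult_le_compat; lra).
      rewrite Rabs_right.
      + apply Rinv_le_contravar; nra.
      + apply Rle_ge. left. apply Rinv_0_lt_compat. nra.
    - right; ring. }
  assert (HJc : continuity J).
  { intros b. apply continuity_pt_filterlim, (lipschitz_cont J _ HJlip). }
  destruct (IVT_gen J b0 b1 1 HJc) as [b [Hbb Eb]].
  { rewrite !HJ by lra. split.
    - eapply Rle_trans; [apply Rmin_r|exact H1].
    - eapply Rle_trans; [exact H0|apply Rmax_l]. }
  rewrite Rmin_left, Rmax_right in Hbb by lra.
  exists b. split; [exact Hbb|]. rewrite <- HJ; [exact Eb|lra].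
Qed.

Lemma mean_le (f h : R -> R) : cont f -> cont h -> (forall w, 0 <= w <= 1 -> f w <= h w) ->
  mean f <= mean h.
Proof.
  intros Hf Hh H. apply RInt_le; [lra| | |].
  - apply cont_ex_RInt, Hf.
  - apply cont_ex_RInt, Hh.
  - intros w Hw; apply H; lra.
Qed.

Lemma mean_const (c : R) : mean (fun _ => c) = c.
Proof. unfold mean. rewrite RInt_const. unfold scal; simpl; unfold mult; simpl. ring. Qed.

Lemma mean_lin (a b : R) (f h : R -> R) : cont f -> cont h ->
  mean (fun w => a * f w + b * h w) = a * mean f + b * mean h.
Proof.
  intros Hf Hh. unfold mean.
  pose proof (cont_ex_RInt f 0 1 Hf) as H1. pose proof (cont_ex_RInt h 0 1 Hh) as H2.
  rewrite (RInt_plus (fun w => a * f w) (fun w => b * h w)).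
  - rewrite (RInt_scal f), (RInt_scal h) by assumption. reflexivity.
  - apply (ex_RInt_scal f); exact H1.
  - apply (ex_RInt_scal h); exact H2.
Qed.

Lemma mean_derive_periodic (F f : R -> R) :
  (forall w, is_derive F w (f w)) -> cont f -> periodic F -> mean f = 0.
Proof.
  intros HF Hf Hp. unfold mean.
  assert (E : minus (F 1) (F 0) = 0).
  { rewrite <- (Rplus_0_l 1), Hp. unfold minus, plus, opp; simpl; ring. }
  rewrite <- E at 2. apply is_RInt_unique, (is_RInt_derive F f); intros x _; [apply HF|apply Hf].
Qed.

Lemma cont_lin (a b : R) (f h : R -> R) : cont f -> cont h -> cont (fun w => a * f w + b * h w).
Proof.
  intros Hf Hh x. apply (continuous_plus (fun w => a * f w) (fun w => b * h w)).
  - apply (continuous_scal_r a f), Hf.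
  - apply (continuous_scal_r b h), Hh.
Qed.

Lemma cont_const1 (c : R) : cont (fun _ => c).
Proof. intros x; apply continuous_const. Qed.

Section Waves.
Context (g : R -> R) (Lg gm gM : R) (Hg : speed g Lg gm gM).

Let gc : cont g := lipschitz_cont g Lg (proj1 Hg).

Lemma speed_pos w : 0 < g w.
Proof. pose proof Hg as [_ [_ [H0 Hb]]]. specialize (Hb w); lra. Qed.

(** For [n = m + b], the defect [lam n - q n m' - g] equals [b g / m], which has
    the sign of [b]: raise the profile for super-waves, lower it for sub-waves. *)
Lemma wave_of_shifted_profile (s lam q b : R) (m m1 : R -> R) :
  0 < lam -> 0 < q ->
  (forall w, is_derive m w (m1 w)) -> periodic m ->
  (forall w, gm / lam <= m w <= gM / lam) ->
  (forall w, q * m w * m1 w = lam * m w - g w) ->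
  0 <= s * b -> (forall w, 0 < m w + b) -> mean (fun w => / (m w + b)) = 1 ->
  exists W W1 W2, wave g s lam q
    (gM * Lg / (lam * gm) + (lam + lam * gM / gm)) W W1 W2.
Proof.
  intros Hlam Hq Hm Hmp Hmb Hode Hsb Hpos Hmean.
  pose proof (profile_slope_bound g Lg gm gM lam q m m1 Hg Hlam Hq Hm Hmp Hmb Hode) as Hbd.
  pose proof Hg as [_ [_ [Hgm Hgb]]].
  apply (wave_of_profile g s lam q _ (fun w => m w + b) m1); auto.
  - intros w. eapply is_derive_eq.
    + apply (is_derive_plus m (fun _ => b)); [apply Hm|apply (is_derive_const b)].
    + apply Rplus_0_r.
  - intros w; rewrite Hmp; reflexivity.
  - intros w. destruct (Hbd w) as [H1 H2].
    assert (0 <= q * Rabs (m1 w)) by (apply Rmult_le_pos; [lra|apply Rabs_pos]). lra.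
  - intros w. destruct (Hbd w) as [H1 H2]. pose proof (Rabs_pos (m1 w)). lra.
  - intros w. specialize (Hode w). specialize (Hmb w). specialize (Hgb w).
    assert (0 < gm / lam) by (apply Rdiv_lt_0_compat; lra).
    assert (E : q * m1 w = lam - g w / m w).
    { apply Rmult_eq_reg_l with (m w); [|lra].
      transitivity (q * m w * m1 w); [ring|]. rewrite Hode. field. lra. }
    replace (s * (lam * (m w + b) - q * (m w + b) * m1 w - g w)) with
      ((s * b) * (g w / m w)).
    + apply Rmult_le_pos; [exact Hsb|]. apply Rdiv_le_0_compat; lra.
    + replace (q * (m w + b) * m1 w) with ((q * m1 w) * (m w + b)) by ring. rewrite E.
      field. lra.
Qed.

(** [q m m'] is the derivative of the periodic function [q m^2 / 2]. *)
Lemma profile_mean (lam q : R) (m m1 : R -> R) : 0 < lam ->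
  (forall w, is_derive m w (m1 w)) -> periodic m ->
  (forall w, q * m w * m1 w = lam * m w - g w) ->
  lam * mean m = mean g.
Proof.
  intros Hlam Hm Hmp Hode.
  assert (Hmc : cont m) by (eapply derive_cont; exact Hm).
  assert (E : mean (fun w => lam * m w + -1 * g w) = 0).
  { apply (mean_derive_periodic (fun w => q / 2 * (m w * m w))).
    - intros w. eapply is_derive_eq.
      + apply is_derive_scal. apply (is_derive_mult m m w (m1 w) (m1 w)); auto.
        intros; apply Rmult_comm.
      + unfold plus, mult; simpl. specialize (Hode w). lra.
    - apply cont_lin; [exact Hmc|exact gc].
    - intros w. rewrite Hmp. reflexivity. }
  rewrite mean_lin in E; [lra|exact Hmc|exact gc].
Qed.

Lemma mean_speed_pos : 0 < mean g.
Proof.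
  pose proof Hg as [_ [_ [Hgm Hgb]]].
  apply Rlt_le_trans with gm; [exact Hgm|]. rewrite <- (mean_const gm).
  apply mean_le; [apply cont_const1|exact gc|]. intros w _; apply Hgb.
Qed.

(** No wave is faster than the mean of [g]: for [lam = mean g] the profile has
    mean 1, hence [1/m] has mean at least 1 by convexity, and raising it restores
    equality. *)
Lemma super_wave : exists C, forall q, 0 < q ->
  exists W W1 W2, wave g 1 (mean g) q C W W1 W2.
Proof.
  set (lam := mean g). assert (Hlam : 0 < lam) by apply mean_speed_pos.
  exists (gM * Lg / (lam * gm) + (lam + lam * gM / gm)). intros q Hq.
  pose proof Hg as [_ [Hgp [Hgm Hgb]]].
  destruct (profile_exists g gm gM lam q gc Hgp Hgm Hgb Hlam Hq) as
    [m [m1 [Hm [Hmp [Hmb Hode]]]]].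
  assert (Hmc : cont m) by (eapply derive_cont; exact Hm).
  assert (Ha : 0 < gm / lam) by (apply Rdiv_lt_0_compat; lra).
  assert (Em : mean m = 1).
  { pose proof (profile_mean lam q m m1 Hlam Hm Hmp Hode) as E. fold lam in E.
    apply Rmult_eq_reg_l with lam; lra. }
  assert (Hshift : forall b, 0 <= b -> cont (fun w => / (m w + b))).
  { intros b Hb. apply cont_inv.
    - intros x. apply (continuous_plus m (fun _ => b)); [apply Hmc|apply continuous_const].
    - intros x. specialize (Hmb x); lra. }
  destruct (normalise_profile m (gm / lam) 0 1 Hmc Ha) as [b [Hb Eb]].
  - lra.
  - intros w. specialize (Hmb w); lra.
  - (* tangent line of the inverse: 1 / m >= 2 - m *)
    apply Rle_trans with (mean (fun w => -1 * m w + 2 * 1)).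
    + rewrite (mean_lin (-1) 2 m (fun _ => 1) Hmc (cont_const1 1)), mean_const. lra.
    + apply mean_le.
      * apply (cont_lin (-1) 2 m (fun _ => 1) Hmc (cont_const1 1)).
      * apply Hshift; lra.
      * intros w _. rewrite Rplus_0_r. specialize (Hmb w).
        apply Rmult_le_reg_r with (m w); [lra|]. rewrite Rinv_l by lra.
        pose proof (pow2_ge_0 (m w - 1)). nra.
  - apply Rle_trans with (mean (fun _ => 1)); [|rewrite mean_const; lra].
    apply mean_le; [apply Hshift; lra|apply cont_const1|].
    intros w _. rewrite <- Rinv_1. apply Rinv_le_contravar; [lra|]. specialize (Hmb w); lra.
  - apply (wave_of_shifted_profile 1 lam q b m m1); auto; try lra.
    intros w. specialize (Hmb w); lra.
Qed.

(** Lowering the profile towards zero makes [1/(m + b)] have a large mean: near a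
    minimum of [m] it dominates [1/(be + D (w - w0))], whose integral over a period is
    [ln (1 + D/be) / D], and [be] is chosen to make this equal to 1. *)
Lemma sub_wave_of_profile (lam q : R) (m m1 : R -> R) :
  0 < lam -> 0 < q ->
  (forall w, is_derive m w (m1 w)) -> periodic m ->
  (forall w, gm / lam <= m w <= gM / lam) ->
  (forall w, q * m w * m1 w = lam * m w - g w) ->
  mean (fun w => / m w) <= 1 ->
  exists W W1 W2, wave g (-1) lam q
    (gM * Lg / (lam * gm) + (lam + lam * gM / gm)) W W1 W2.
Proof.
  intros Hlam Hq Hm Hmp Hmb Hode Hmean.
  pose proof (profile_slope_bound g Lg gm gM lam q m m1 Hg Hlam Hq Hm Hmp Hmb Hode) as Hbd.
  assert (Hgm : 0 < gm) by apply Hg.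
  assert (Hmc : cont m) by (eapply derive_cont; exact Hm).
  assert (Ha : 0 < gm / lam) by (apply Rdiv_lt_0_compat; lra).
  destruct (periodic_min m Hmc Hmp) as [w0 Hw0].
  set (D := gM * Lg / (lam * gm) + 1).
  assert (HD : 0 < D).
  { unfold D. destruct (Hbd 0) as [H _]. pose proof (Rabs_pos (m1 0)). lra. }
  assert (HeD : 1 < exp D) by (rewrite <- exp_0; apply exp_increasing; exact HD).
  set (be := D / (exp D - 1)).
  assert (Hbe : 0 < be) by (apply Rdiv_lt_0_compat; lra).
  set (b0 := Rmin 0 (be - m w0)).
  set (c := Rmin be (m w0)).
  assert (Hc : 0 < c).
  { apply Rmin_pos; [exact Hbe|]. specialize (Hmb w0); lra. }
  assert (Hlow : forall w, c <= m w + b0).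
  { intros w. specialize (Hw0 w). unfold c, b0, Rmin.
    destruct (Rle_dec be (m w0)), (Rle_dec 0 (be - m w0)); lra. }
  assert (Hpos : forall w, 0 < m w + b0) by (intros w; specialize (Hlow w); lra).
  assert (Hb0 : b0 <= 0) by apply Rmin_l.
  assert (Hsc : cont (fun w => m w + b0)).
  { intros x. apply (continuous_plus m (fun _ => b0)); [apply Hmc|apply continuous_const]. }
  assert (Hup : forall w, w0 <= w -> m w + b0 <= be + D * (w - w0)).
  { intros w Hw. destruct (MVT_gen m w0 w m1) as [z [_ Ez]].
    - intros x _; apply Hm.
    - intros x _; apply continuity_pt_filterlim, Hmc.
    - destruct (Hbd z) as [Hz _]. apply Rcomplements.Rabs_le_between in Hz.
      assert (m1 z * (w - w0) <= D * (w - w0)) by (apply Rmult_le_compat_r; unfold D; lra).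
      pose proof (Rmin_r 0 (be - m w0)). fold b0 in H0. lra. }
  destruct (normalise_profile m c b0 0 Hmc Hc Hb0 Hlow) as [b [Hb Eb]].
  - unfold mean. rewrite <- (RInt_period_shift (fun w => / (m w + b0)) w0).
    2:{ apply cont_inv; assumption. }
    2:{ intros w; rewrite Hmp; reflexivity. }
    assert (Hlog : is_RInt (fun w => / (be + D * (w - w0))) w0 (w0 + 1)
      (minus (ln (be + D * (w0 + 1 - w0)) / D) (ln (be + D * (w0 - w0)) / D))).
    { apply (is_RInt_derive (fun w => ln (be + D * (w - w0)) / D)
        (fun w => / (be + D * (w - w0)))).
      - intros x Hx. rewrite Rmin_left, Rmax_right in Hx by lra.
        assert (0 < be + D * (x - w0)) by nra.
        auto_derive; [lra|]. field. split; lra.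
      - intros x Hx. rewrite Rmin_left, Rmax_right in Hx by lra.
        assert (0 < be + D * (x - w0)) by nra.
        apply (ex_derive_continuous (fun w => / (be + D * (w - w0)))).
        auto_derive. lra. }
    assert (Ev : minus (ln (be + D * (w0 + 1 - w0)) / D) (ln (be + D * (w0 - w0)) / D) = 1).
    { replace (be + D * (w0 + 1 - w0)) with (be * exp D).
      2:{ unfold be. field. lra. }
      replace (be + D * (w0 - w0)) with be by ring.
      rewrite ln_mult by (try apply exp_pos; exact Hbe). rewrite ln_exp.
      unfold minus, plus, opp; simpl. field. lra. }
    rewrite Ev in Hlog.
    apply (is_RInt_le (fun w => / (be + D * (w - w0))) (fun w => / (m w + b0)) w0 (w0 + 1)).
    + lra.
    + exact Hlog.
    + apply (RInt_correct (fun w => / (m w + b0))). apply cont_ex_RInt, cont_inv; assumption.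
    + intros w Hw. apply Rinv_le_contravar; [apply Hpos|]. apply Hup; lra.
  - replace (mean (fun w => / (m w + 0))) with (mean (fun w => / m w)); [exact Hmean|].
    apply RInt_ext. intros w _. rewrite Rplus_0_r. reflexivity.
  - apply (wave_of_shifted_profile (-1) lam q b m m1); auto; try lra.
    intros w. specialize (Hpos w); lra.
Qed.

(** No wave is slower than the harmonic mean [lam] of [g]: dividing the profile
    equation by [g m] and using [(lam m - g)^2 >= 0],
    [lam/g - 1/m = q m'/g >= (q/lam) (ln m)'], and the right side has mean zero. *)
Lemma sub_wave_slow : exists C, forall q, 0 < q ->
  exists W W1 W2, wave g (-1) (/ mean (fun w => / g w)) q C W W1 W2.
Proof.
  assert (Hgi : cont (fun w => / g w)) by (apply cont_inv; [exact gc|exact speed_pos]).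
  assert (Hmi : 0 < mean (fun w => / g w)).
  { apply RInt_gt_0; [lra| |].
    - intros w _. apply Rinv_0_lt_compat, speed_pos.
    - intros w _. apply Hgi. }
  set (lam := / mean (fun w => / g w)).
  assert (Hlam : 0 < lam) by (apply Rinv_0_lt_compat; exact Hmi).
  exists (gM * Lg / (lam * gm) + (lam + lam * gM / gm)). intros q Hq.
  pose proof Hg as [_ [Hgp [Hgm Hgb]]].
  destruct (profile_exists g gm gM lam q gc Hgp Hgm Hgb Hlam Hq) as
    [m [m1 [Hm [Hmp [Hmb Hode]]]]].
  assert (Hmc : cont m) by (eapply derive_cont; exact Hm).
  assert (Ha : 0 < gm / lam) by (apply Rdiv_lt_0_compat; lra).
  assert (Hm0 : forall w, 0 < m w) by (intros w; specialize (Hmb w); lra).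
  assert (Hmic : cont (fun w => / m w)) by (apply cont_inv; assumption).
  assert (Hm1 : forall w, m1 w = (lam - g w * / m w) / q).
  { intros w. specialize (Hm0 w). specialize (Hode w).
    apply Rmult_eq_reg_l with (q * m w); [|apply Rgt_not_eq, Rmult_lt_0_compat; lra].
    rewrite Hode. field. lra. }
  assert (Hdln : cont (fun w => m1 w * / m w)).
  { intros x.
    apply (continuous_ext (fun w => (lam * / m w + -1 * (g w * / m w * / m w)) * / q)).
    { intros w. rewrite Hm1. simpl. specialize (Hm0 w). field. lra. }
    apply (continuous_mult (K := R_AbsRing)
      (fun w => lam * / m w + -1 * (g w * / m w * / m w)) (fun _ => / q));
      [|apply continuous_const].
    apply (cont_lin lam (-1) (fun w => / m w) (fun w => g w * / m w * / m w)); [exact Hmic|].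
    intros y. apply (continuous_mult (K := R_AbsRing) (fun w => g w * / m w) (fun w => / m w));
      [|apply Hmic].
    apply (continuous_mult (K := R_AbsRing) g (fun w => / m w)); [apply gc|apply Hmic]. }
  assert (Eln : mean (fun w => m1 w * / m w) = 0).
  { apply (mean_derive_periodic (fun w => ln (m w))); [|exact Hdln|].
    - intros w. eapply is_derive_eq.
      + apply (is_derive_comp ln m); [apply is_derive_ln; apply Hm0|apply Hm].
      + reflexivity.
    - intros w; rewrite Hmp; reflexivity. }
  apply (sub_wave_of_profile lam q m m1); auto.
  replace 1 with (lam * mean (fun w => / g w) + - (q / lam) * mean (fun w => m1 w * / m w)).
  2:{ rewrite Eln. unfold lam. field. lra. }
  rewrite <- mean_lin by assumption.
  apply mean_le; [exact Hmic|apply cont_lin; assumption|].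
  intros w _. specialize (Hm0 w). specialize (Hode w). pose proof (speed_pos w) as Hgw.
  assert (0 <= (lam * m w - g w) * (lam * m w - g w) / (lam * g w * m w * m w)).
  { apply Rdiv_le_0_compat; [apply Rle_0_sqr|].
    repeat apply Rmult_lt_0_compat; lra. }
  replace (- (q / lam) * (m1 w * / m w)) with
    (- ((q * m w * m1 w) / (lam * m w * m w))) by (field; lra).
  rewrite Hode.
  replace (lam * / g w) with (/ m w + ((lam * m w - g w) * (lam * m w - g w) / (lam * g w * m w * m w)
    + (lam * m w - g w) / (lam * m w * m w))) by (field; lra).
  lra.
Qed.

(** For steep slopes the profile is nearly constant, since [q |m'|] is bounded; its
    mean is [mean g / lam > 1], so it is at least 1. *)
Lemma sub_wave_steep (lam : R) : 0 < lam < mean g -> exists C Q, 0 <= Q /\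
  forall q, Q < q -> exists W W1 W2, wave g (-1) lam q C W W1 W2.
Proof.
  intros [Hlam Hlg].
  pose proof Hg as [_ [Hgp [Hgm Hgb]]].
  set (C2 := lam + lam * gM / gm).
  assert (HC2 : 0 < C2).
  { unfold C2. specialize (Hgb 0). assert (0 <= lam * gM / gm); [|lra].
    apply Rdiv_le_0_compat; [apply Rmult_le_pos|]; lra. }
  assert (Hgap : 0 < mean g / lam - 1).
  { assert (1 < mean g / lam); [|lra]. apply Rmult_lt_reg_r with lam; [exact Hlam|].
    unfold Rdiv. rewrite Rmult_assoc, Rinv_l; lra. }
  exists (gM * Lg / (lam * gm) + (lam + lam * gM / gm)), (C2 / (mean g / lam - 1)).
  split; [apply Rdiv_le_0_compat; lra|]. intros q HQ.
  assert (Hq : 0 < q).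
  { eapply Rle_lt_trans; [|exact HQ]. apply Rdiv_le_0_compat; lra. }
  destruct (profile_exists g gm gM lam q gc Hgp Hgm Hgb Hlam Hq) as
    [m [m1 [Hm [Hmp [Hmb Hode]]]]].
  pose proof (profile_slope_bound g Lg gm gM lam q m m1 Hg Hlam Hq Hm Hmp Hmb Hode) as Hbd.
  fold C2 in Hbd.
  assert (Hmc : cont m) by (eapply derive_cont; exact Hm).
  assert (Ha : 0 < gm / lam) by (apply Rdiv_lt_0_compat; lra).
  assert (Hm0 : forall w, 0 < m w) by (intros w; specialize (Hmb w); lra).
  apply (sub_wave_of_profile lam q m m1); auto.
  assert (Hq2 : C2 / q <= mean g / lam - 1).
  { apply Rmult_le_reg_r with q; [exact Hq|]. unfold Rdiv at 1. rewrite Rmult_assoc, Rinv_l by lra.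
    apply (Rmult_lt_compat_r (mean g / lam - 1)) in HQ; [|exact Hgap].
    unfold Rdiv at 1 in HQ. rewrite Rmult_assoc, Rinv_l in HQ; lra. }
  assert (Hge1 : forall w, 0 <= w <= 1 -> 1 <= m w).
  { intros w Hw.
    assert (Hosc : mean m <= m w + C2 / q).
    { rewrite <- (mean_const (m w + C2 / q)). apply mean_le; [exact Hmc|apply cont_const1|].
      intros v Hv. destruct (MVT_gen m w v m1) as [z [_ Ez]].
      - intros x _; apply Hm.
      - intros x _; apply continuity_pt_filterlim, Hmc.
      - destruct (Hbd z) as [_ Hz].
        assert (Hz' : Rabs (m1 z) <= C2 / q).
        { apply Rmult_le_reg_l with q; [exact Hq|].
          replace (q * (C2 / q)) with C2 by (field; lra). exact Hz. }
        assert (Rabs (m1 z * (v - w)) <= C2 / q); [|apply Rcomplements.Rabs_le_between in H; lra].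
        rewrite Rabs_mult, <- (Rmult_1_r (C2 / q)).
        apply Rmult_le_compat; try apply Rabs_pos; [exact Hz'|]. apply Rabs_le; lra. }
    assert (Em : mean m = mean g / lam).
    { rewrite <- (profile_mean lam q m m1 Hlam Hm Hmp Hode). field. lra. }
    lra. }
  rewrite <- (mean_const 1). apply mean_le; [apply cont_inv; assumption|apply cont_const1|].
  intros w Hw. rewrite <- Rinv_1. apply Rinv_le_contravar; [lra|]. apply Hge1, Hw.
Qed.

(** Tangent line of the inverse at [c = mean g]: [1/g >= 2/c - g/c^2]. *)
Lemma harmonic_le_mean : / mean (fun w => / g w) <= mean g.
Proof.
  pose proof mean_speed_pos as Hc.
  assert (Hgi : cont (fun w => / g w)) by (apply cont_inv; [exact gc|exact speed_pos]).
  rewrite <- (Rinv_inv (mean g)). apply Rinv_le_contravar; [apply Rinv_0_lt_compat, Hc|].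
  set (c := mean g) in *.
  replace (/ c) with (mean (fun w => - (/ c * / c) * g w + (2 * / c) * 1)).
  - apply mean_le; [apply (cont_lin _ _ g (fun _ => 1) gc (cont_const1 1))|exact Hgi|].
    intros w _. pose proof (speed_pos w) as Hw.
    assert (0 <= (g w - c) * (g w - c) / (c * c * g w)).
    { apply Rdiv_le_0_compat; [apply Rle_0_sqr|]. repeat apply Rmult_lt_0_compat; lra. }
    replace (/ g w) with ((g w - c) * (g w - c) / (c * c * g w) +
      (- (/ c * / c) * g w + (2 * / c) * 1)) by (field; lra).
    lra.
  - rewrite (mean_lin _ _ g (fun _ => 1) gc (cont_const1 1)), mean_const. fold c. field. lra.
Qed.

End Waves.

(** * Barriers built from waves of frozen slope *)

(** What the argument uses of a solution, with the diffusion coefficient [a]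
    decoupled from [eps]. *)
Definition solves (g : R -> R) (a eps : R) (u : R -> R -> R) : Prop :=
  continuous_on_closed_half_plane u /\ linear_growth u /\
  forall x t, 0 < t -> exists ut uxx, jet u x t ut uxx /\ ut = a * uxx + g (u x t / eps).

Lemma jet_wave (W W1 W2 Z0 Z1 : R -> R) (z2 l eps x t : R) :
  0 < eps ->
  (forall y, is_derive W y (W1 y)) -> (forall y, is_derive W1 y (W2 y)) ->
  (forall y, is_derive Z0 y (Z1 y)) -> is_derive Z1 x z2 ->
  jet (fun y s => eps * W ((Z0 y + l * s) / eps)) x t
    (W1 ((Z0 x + l * t) / eps) * l)
    (W2 ((Z0 x + l * t) / eps) * (Z1 x * Z1 x / eps) + W1 ((Z0 x + l * t) / eps) * z2).
Proof.
  intros He HW HW1 HZ HZ1. split.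
  - eapply is_derive_eq.
    + apply is_derive_scal. apply (is_derive_comp W (fun s => (Z0 x + l * s) / eps) t (W1 ((Z0 x + l * t) / eps)) (l / eps)).
      * apply HW.
      * auto_derive; [lra|field; lra].
    + unfold scal; simpl; unfold mult; simpl. field; lra.
  - assert (Hz : forall y, is_derive (fun y => (Z0 y + l * t) / eps) y (Z1 y / eps)).
    { intros y. apply (is_derive_ext (fun y => / eps * Z0 y + l * t / eps)).
      { intros v; simpl; field; lra. }
      eapply is_derive_eq.
      - apply (is_derive_plus (fun y => / eps * Z0 y) (fun _ => l * t / eps)).
        + apply is_derive_scal, HZ.
        + apply (is_derive_const (l * t / eps)).
      - unfold plus, zero; simpl. field; lra. }
    exists (fun y => W1 ((Z0 y + l * t) / eps) * Z1 y). split.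
    + intros y. eapply is_derive_eq.
      * apply is_derive_scal. apply (is_derive_comp W (fun y => (Z0 y + l * t) / eps)).
        -- apply HW.
        -- apply Hz.
      * unfold scal; simpl; unfold mult; simpl. field; lra.
    + eapply is_derive_eq.
      * apply (is_derive_mult (fun y => W1 ((Z0 y + l * t) / eps)) Z1).
        -- apply (is_derive_comp W1 (fun y => (Z0 y + l * t) / eps)); [apply HW1|apply Hz].
        -- exact HZ1.
        -- intros; apply Rmult_comm.
      * unfold plus, scal; simpl; unfold mult; simpl. field; lra.
Qed.

Fixpoint finite_max (F : nat -> R -> R -> R) (n : nat) (x t : R) : R :=
  match n with O => F O x t | S k => Rmax (finite_max F k x t) (F (S k) x t) end.

Lemma finite_max_cont (F : nat -> R -> R -> R) (n : nat) :
  (forall i, continuous_on_closed_half_plane (F i)) ->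
  continuous_on_closed_half_plane (finite_max F n).
Proof.
  intros H. induction n as [|n IH]; [apply H|].
  apply (cont_max (finite_max F n) (F (S n))); [exact IH|apply H].
Qed.

Lemma finite_max_ge (F : nat -> R -> R -> R) (n i : nat) (x t : R) :
  (i <= n)%nat -> F i x t <= finite_max F n x t.
Proof.
  induction n as [|n IH]; intros Hi.
  - replace i with O by lia. simpl; lra.
  - simpl. destruct (Nat.eq_dec i (S n)) as [->|Hne]; [apply Rmax_r|].
    eapply Rle_trans; [apply IH; lia|apply Rmax_l].
Qed.

Lemma finite_max_attained (F : nat -> R -> R -> R) (n : nat) (x t : R) :
  exists i, (i <= n)%nat /\ finite_max F n x t = F i x t.
Proof.
  induction n as [|n [i [Hi E]]].
  - exists O; split; [lia|reflexivity].
  - simpl. unfold Rmax. destruct (Rle_dec (finite_max F n x t) (F (S n) x t)).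
    + exists (S n); split; [lia|reflexivity].
    + exists i; split; [lia|exact E].
Qed.

(** Half-integer multiples of [rho] avoid the slope 0, where no wave is
    available. *)
Lemma slope_grid (rho M : R) : 0 < rho -> exists (n : nat) (sg : nat -> R),
  (forall i, rho / 2 <= Rabs (sg i)) /\
  forall xi, Rabs xi <= M -> exists i, (i <= n)%nat /\ Rabs (xi - sg i) <= rho / 2.
Proof.
  intros Hrho.
  destruct (INR_unbounded (M / rho)) as [k Hk].
  assert (HM : M <= INR k * rho).
  { apply Rmult_gt_compat_r with (r := rho) in Hk; [|exact Hrho].
    unfold Rdiv in Hk. rewrite Rmult_assoc, Rinv_l in Hk; lra. }
  exists (2 * k)%nat, (fun i => (INR i + / 2 - INR k) * rho). split.
  - intros i. rewrite Rabs_mult, (Rabs_right rho) by lra.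
    assert (/ 2 <= Rabs (INR i + / 2 - INR k)); [|nra].
    destruct (Nat.le_gt_cases k i) as [H|H].
    + apply le_INR in H. rewrite Rabs_right; lra.
    + apply le_INR in H. rewrite S_INR in H. rewrite Rabs_left; lra.
  - intros xi Hxi. apply Rcomplements.Rabs_le_between in Hxi.
    assert (Hz : - INR k <= xi / rho <= INR k).
    { split; apply Rmult_le_reg_r with rho; try exact Hrho; unfold Rdiv;
        rewrite Rmult_assoc, Rinv_l; lra. }
    destruct (nfloor_ex (xi / rho + INR k)) as [i [Hi1 Hi2]]; [lra|].
    exists i. split.
    + apply INR_le. rewrite mult_INR. simpl. lra.
    + replace (xi - (INR i + / 2 - INR k) * rho) with
        ((xi / rho + INR k - INR i - / 2) * rho) by (field; lra).
      rewrite Rabs_mult, (Rabs_right rho) by lra.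
      assert (Rabs (xi / rho + INR k - INR i - / 2) <= / 2) by (apply Rabs_le; lra).
      nra.
Qed.

(** Changing the slope of a wave from [sg] to [X], with [|X - sg|] of the order of
    the mesh, costs little for all slopes at once: [|sg| |W''|] is controlled by the
    first curvature bound if [|sg| <= 1] and by the second one otherwise. *)
Lemma square_gap (X sg rho C w1 w2 : R) :
  0 <= rho -> 0 <= C -> 0 <= w1 -> rho / 2 <= Rabs sg -> Rabs (X - sg) <= 4 * rho ->
  Rabs w2 <= C * w1 -> (sg * sg) * Rabs w2 <= C * w1 ->
  Rabs ((X * X - sg * sg) * w2) <= 40 * rho * C * w1.
Proof.
  intros Hrho HC Hw1 Hsg HX H1 H2.
  assert (Hsum : Rabs (X + sg) <= 10 * Rabs sg).
  { replace (X + sg) with ((X - sg) + 2 * sg) by ring.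
    eapply Rle_trans; [apply Rabs_triang|].
    rewrite (Rabs_mult 2), (Rabs_right 2) by lra. lra. }
  assert (Hs : Rabs sg * Rabs w2 <= C * w1).
  { pose proof (Rabs_pos w2) as Hw2. pose proof (Rabs_pos sg) as Hsp.
    destruct (Rle_dec (Rabs sg) 1) as [Hle|Hgt].
    - nra.
    - assert (Rabs sg <= sg * sg); [|nra].
      replace (sg * sg) with (Rabs sg * Rabs sg); [nra|].
      rewrite <- Rabs_mult. apply Rabs_right. nra. }
  replace ((X * X - sg * sg) * w2) with ((X - sg) * ((X + sg) * w2)) by ring.
  rewrite !Rabs_mult.
  apply Rle_trans with (4 * rho * (10 * (C * w1))); [|right; ring].
  apply Rmult_le_compat; try apply Rabs_pos; [|exact HX|].
  - apply Rmult_le_pos; apply Rabs_pos.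
  - apply Rle_trans with (10 * Rabs sg * Rabs w2).
    + apply Rmult_le_compat_r; [apply Rabs_pos|exact Hsum].
    + rewrite Rmult_assoc. apply Rmult_le_compat_l; lra.
Qed.

Lemma sign_mul_le_abs (s : R) : s = 1 \/ s = -1 -> forall z, s * z <= Rabs z.
Proof.
  intros Hs z. destruct Hs as [-> | ->].
  - pose proof (Rle_abs z); lra.
  - pose proof (Rle_abs (- z)) as H. rewrite Rabs_Ropp in H. lra.
Qed.

Section Barrier.
Context (g : R -> R) (Lg gm gM : R) (Hg : speed g Lg gm gM).
Context (s lam C Q0 : R) (Hs : s = 1 \/ s = -1) (HC : 0 <= C)
  (Hwaves : forall q, Q0 < q -> exists W W1 W2, wave g s lam q C W W1 W2).
Context (p p1 p2 p3 : R -> R) (Hp : forall x, is_derive p x (p1 x))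
  (Hp1 : forall x, is_derive p1 x (p2 x)) (Hp2 : forall x, is_derive p2 x (p3 x)).
Context (A B T M eta : R) (HAB : A <= B) (HT : 0 <= T) (Heta : 0 < eta)
  (HM : forall x, A <= x <= B -> Rabs (p1 x) <= M /\ Rabs (p2 x) <= M /\ Rabs (p3 x) <= M).

Let rho := eta / (80 * (C + 1)).
Let N := 2 / (rho * rho).

(** A barrier that moves at speed about [lam] with the given profile [p].  In units
    of the natural slope [1/b], with [b^2 eps = a], a barrier of slope [p1 x] must be
    built from a wave of slope [b p1 x], which varies with [x].  For each slope [sg i]
    of a fine grid, [V i = eps W_i(phase/eps)] uses the wave of that slope, and its
    phase is shifted by the penalty [eps N (b p1 x - sg i)^2].  All waves stay within
    [eps] of their phase, so in the minimum (maximum if [s = -1]) of the [V i] only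
    those with [|b p1 x - sg i| <= 2 rho] are active, and there the wave inequality
    survives with the slack [eta].  The shift acts on the phase, not on the value,
    so that [g] is evaluated exactly on the wave. *)
Lemma barrier_at_scale (a b eps : R) (u : R -> R -> R) :
  0 < eps -> 0 <= a <= 1 -> 0 < b -> b * b * eps = a -> eps * b <= 1 ->
  2 * N * a * M <= 1 -> a * (M + 2 * N * (M * M + 2 * rho * M)) <= eta / 2 ->
  (forall x sg, A <= x <= B -> rho / 2 <= Rabs sg -> Rabs (b * p1 x - sg) <= 2 * rho ->
     Q0 < sg * sg) ->
  solves g a eps u ->
  (forall x t, A <= x <= B -> 0 <= t <= T -> t = 0 \/ x = A \/ x = B ->
     s * (u x t - p x - (lam + s * eta) * t) <= 0) ->
  forall x t, A <= x <= B -> 0 <= t <= T ->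
    s * (u x t - p x - (lam + s * eta) * t) <= 3 * eps.
Proof.
  intros He Ha Hb Hba Heb Hsmall1 Hsmall2 Hslope [Huc [_ Hueq]] Hbd.
  assert (Hss : s * s = 1) by (destruct Hs as [->| ->]; ring).
  pose proof (sign_mul_le_abs s Hs) as Hsabs.
  assert (HsR : forall z, Rabs (s * z) = Rabs z).
  { intros z. destruct Hs as [->| ->]; [rewrite Rmult_1_l; reflexivity|].
    replace (-1 * z) with (- z) by ring. apply Rabs_Ropp. }
  assert (Hrho : 0 < rho) by (apply Rdiv_lt_0_compat; lra).
  assert (HN : 0 < N) by (apply Rdiv_lt_0_compat; [lra|nra]).
  assert (ENr : N * (rho * rho) = 2) by (unfold N; field; lra).
  assert (Erho : 80 * (C + 1) * rho = eta) by (unfold rho; field; lra).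
  pose proof (proj1 Hg) as HLg.
  destruct (slope_grid rho (b * M) Hrho) as [n [sg [Hsg Hgrid]]].
  set (l := lam + s * eta) in *.
  (* waves for the grid slopes, the identity where none is available *)
  assert (Hfam : forall i, exists w : (R -> R) * (R -> R) * (R -> R),
    (forall y, Rabs (fst (fst w) y - y) <= 1) /\
    (forall y, is_derive (fst (fst w)) y (snd (fst w) y)) /\
    (Q0 < sg i * sg i -> wave g s lam (sg i * sg i) C (fst (fst w)) (snd (fst w)) (snd w))).
  { intros i. destruct (Rlt_dec Q0 (sg i * sg i)) as [H|H].
    - destruct (Hwaves _ H) as [W [W1 [W2 HW]]]. exists (W, W1, W2). simpl.
      pose proof HW as [HW' [_ [HWb _]]]. auto.
    - exists (fun y => y, fun _ => 1, fun _ => 0). simpl.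
      split; [intros y; rewrite Rminus_diag, Rabs_R0; lra|].
      split; [intros y; apply (is_derive_id y)|]. intros; contradiction. }
  destruct (functional_choice _ Hfam) as [Ws HWs].
  set (pen := fun i x => eps + eps * N * ((b * p1 x - sg i) * (b * p1 x - sg i))).
  set (Z0 := fun i x => p x + s * pen i x).
  set (Z1 := fun i x => p1 x + s * (eps * N * (2 * (b * p1 x - sg i) * (b * p2 x)))).
  set (Z2 := fun i x => p2 x + s * (eps * N * (2 * (b * p2 x) * (b * p2 x) +
    2 * (b * p1 x - sg i) * (b * p3 x)))).
  assert (Hlin : forall i x, is_derive (fun x => b * p1 x - sg i) x (b * p2 x)).
  { intros i x. eapply is_derive_eq.
    - apply (is_derive_minus (fun x => b * p1 x) (fun _ => sg i)).
      + apply is_derive_scal, Hp1.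
      + apply (is_derive_const (sg i)).
    - unfold minus, plus, opp, zero; simpl. ring. }
  assert (HZ0 : forall i x, is_derive (Z0 i) x (Z1 i x)).
  { intros i x. apply (is_derive_plus p (fun x => s * pen i x)); [apply Hp|].
    apply is_derive_scal. eapply is_derive_eq.
    - apply (is_derive_plus (fun _ => eps)
        (fun x => eps * N * ((b * p1 x - sg i) * (b * p1 x - sg i)))).
      + apply (is_derive_const eps).
      + apply is_derive_scal.
        apply (is_derive_mult (fun x => b * p1 x - sg i) (fun x => b * p1 x - sg i));
          try apply Hlin. intros; apply Rmult_comm.
    - unfold plus, zero, mult; simpl. ring. }
  assert (HZ1 : forall i x, is_derive (Z1 i) x (Z2 i x)).
  { intros i x. apply (is_derive_plus p1 (fun x => s * (eps * N *
      (2 * (b * p1 x - sg i) * (b * p2 x))))); [apply Hp1|].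
    apply is_derive_scal, is_derive_scal. eapply is_derive_eq.
    - apply (is_derive_mult (fun x => 2 * (b * p1 x - sg i)) (fun x => b * p2 x)).
      + apply is_derive_scal, Hlin.
      + apply is_derive_scal, Hp2.
      + intros; apply Rmult_comm.
    - unfold plus, mult; simpl. ring. }
  set (W := fun i => fst (fst (Ws i))). set (W1 := fun i => snd (fst (Ws i))).
  set (W2 := fun i => snd (Ws i)).
  set (V := fun i x t => eps * W i ((Z0 i x + l * t) / eps)).
  set (om := fun i x t => s * u x t + - s * V i x t).
  assert (HVc : forall i, continuous_on_closed_half_plane (om i)).
  { intros i. apply cont_plus; [apply cont_scal, Huc|]. apply cont_scal. unfold V.
    apply cont_scal. apply (cont_comp (W i) (fun x t => (Z0 i x + l * t) / eps)).
    - exact (derive_cont (W i) (W1 i) (proj1 (proj2 (HWs i)))).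
    - apply cont_mult; [|apply cont_const]. apply cont_plus.
      + apply cont_space, (derive_cont (Z0 i) (Z1 i)), HZ0.
      + apply (cont_time (fun t => l * t)). intros t.
        apply (ex_derive_continuous (fun t => l * t)). auto_derive; trivial. }
  assert (HVZ : forall i x t, Rabs (V i x t - (Z0 i x + l * t)) <= eps).
  { intros i x t. unfold V. destruct (HWs i) as [Hb1 _].
    specialize (Hb1 ((Z0 i x + l * t) / eps)). fold (W i) in Hb1.
    replace (eps * W i ((Z0 i x + l * t) / eps) - (Z0 i x + l * t)) with
      (eps * (W i ((Z0 i x + l * t) / eps) - (Z0 i x + l * t) / eps)) by (field; lra).
    rewrite Rabs_mult, (Rabs_right eps) by lra. nra. }
  assert (HsV : forall i x t, s * (p x + l * t) + eps * N * ((b * p1 x - sg i) * (b * p1 x - sg i))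
      <= s * V i x t <=
      s * (p x + l * t) + eps * N * ((b * p1 x - sg i) * (b * p1 x - sg i)) + 2 * eps).
  { intros i x t. specialize (HVZ i x t).
    rewrite <- HsR in HVZ. apply Rcomplements.Rabs_le_between in HVZ.
    assert (E : s * (V i x t - (Z0 i x + l * t)) = s * V i x t - s * (p x + l * t) -
      (eps + eps * N * ((b * p1 x - sg i) * (b * p1 x - sg i)))).
    { unfold Z0, pen. replace (s * (V i x t - (p x + s * (eps + eps * N *
        ((b * p1 x - sg i) * (b * p1 x - sg i))) + l * t))) with
        (s * V i x t - s * (p x + l * t) - (s * s) * (eps + eps * N *
        ((b * p1 x - sg i) * (b * p1 x - sg i)))) by ring. rewrite Hss. ring. }
    rewrite E in HVZ. lra. }
  assert (Hnear : forall x, A <= x <= B -> exists j, (j <= n)%nat /\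
    eps * N * ((b * p1 x - sg j) * (b * p1 x - sg j)) <= eps * / 2).
  { intros x Hx. destruct (HM x Hx) as [HMx _].
    destruct (Hgrid (b * p1 x)) as [j [Hj Hjd]].
    { rewrite Rabs_mult, (Rabs_right b) by lra. apply Rmult_le_compat_l; lra. }
    exists j; split; [exact Hj|]. rewrite Rmult_assoc. apply Rmult_le_compat_l; [lra|].
    apply Rcomplements.Rabs_le_between in Hjd.
    assert ((b * p1 x - sg j) * (b * p1 x - sg j) <= rho * rho / 4) by nra.
    nra. }
  assert (Hmax : forall x t, A <= x <= B -> 0 <= t <= T -> finite_max om n x t <= 0).
  { intros x0 t0 Hx0 Ht0.
    apply (max_principle_rectangle (finite_max om n) a (Lg / eps) A B 0 T); try lra;
      try assumption; [apply finite_max_cont, HVc|].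
    intros x t Hx Ht Hpos.
    destruct (finite_max_attained om n x t) as [i [Hi Ei]].
    assert (Hom : 0 < om i x t) by (rewrite <- Ei; exact Hpos).
    assert (Hint : ~ (t = 0 \/ x = A \/ x = B)).
    { intros Hc. specialize (Hbd x t Hx Ht Hc). specialize (HsV i x t).
      assert (0 <= eps * N * ((b * p1 x - sg i) * (b * p1 x - sg i))).
      { apply Rmult_le_pos; [apply Rmult_le_pos; lra|apply Rle_0_sqr]. }
      unfold om in Hom. lra. }
    assert (HtI : 0 < t) by (destruct (Req_dec t 0); [exfalso; auto|lra]).
    split; [destruct (Req_dec x A), (Req_dec x B); try (exfalso; auto; fail); lra|].
    split; [exact HtI|].
    destruct (Hueq x t HtI) as [ut [uxx [Hujet Hueqn]]].
    set (Y := (Z0 i x + l * t) / eps).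
    destruct (HM x Hx) as [HMx1 [HMx2 HMx3]].
    set (xi := b * p1 x) in *.
    (* the touching wave has nearly the slope of the barrier *)
    assert (Hact : Rabs (xi - sg i) <= 2 * rho).
    { destruct (Hnear x Hx) as [j [Hj Hjd]]. fold xi in Hjd.
      assert (Hji : om j x t <= om i x t) by (rewrite <- Ei; apply finite_max_ge, Hj).
      pose proof (HsV i x t) as [H1 _]. pose proof (HsV j x t) as [_ H2]. fold xi in H1, H2.
      unfold om in Hji.
      assert (H3 : eps * (N * ((xi - sg i) * (xi - sg i))) <= eps * (5 / 2)) by lra.
      apply Rmult_le_reg_l in H3; [|exact He].
      assert (H4 : N * ((xi - sg i) * (xi - sg i)) <= N * (2 * rho * (2 * rho))) by nra.
      apply Rmult_le_reg_l in H4; [|exact HN].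
      apply Rabs_le; split; nra. }
    assert (Hq : Q0 < sg i * sg i) by (apply (Hslope x); auto).
    destruct (HWs i) as [_ [_ Hwave]]. specialize (Hwave Hq).
    fold (W i) (W1 i) (W2 i) in Hwave.
    destruct Hwave as [HdW [HdW1 [_ Hw]]]. specialize (Hw Y).
    destruct Hw as [Hw1 [Hw2 [Hw3 Hw4]]].
    exists (om i), (s * ut + - s * (W1 i Y * l)),
      (s * uxx + - s * (W2 i Y * (Z1 i x * Z1 i x / eps) + W1 i Y * Z2 i x)).
    split; [intros; apply finite_max_ge, Hi|]. split; [symmetry; exact Ei|].
    split.
    { unfold om. apply jet_lin; [exact Hujet|].
      apply (jet_wave (W i) (W1 i) (W2 i) (Z0 i) (Z1 i)); auto. }
    set (X := b * Z1 i x).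
    assert (EX : a * (Z1 i x * Z1 i x / eps) = X * X).
    { unfold X. rewrite <- Hba. field. lra. }
    assert (HXs : Rabs (X - sg i) <= 4 * rho).
    { replace (X - sg i) with ((xi - sg i) * (1 + s * (2 * N * a * p2 x))).
      2:{ unfold X, Z1, xi. rewrite <- Hba. ring. }
      rewrite Rabs_mult. replace (4 * rho) with (2 * rho * 2) by ring.
      apply Rmult_le_compat; try apply Rabs_pos; [exact Hact|].
      eapply Rle_trans; [apply Rabs_triang|]. rewrite Rabs_R1, HsR.
      rewrite Rabs_mult, (Rabs_right (2 * N * a)).
      2:{ apply Rle_ge, Rmult_le_pos; lra. }
      assert (2 * N * a * Rabs (p2 x) <= 2 * N * a * M); [|lra].
      apply Rmult_le_compat_l; [apply Rmult_le_pos; lra|exact HMx2]. }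
    pose proof (square_gap X (sg i) rho C (W1 i Y) (W2 i Y) ltac:(lra) HC ltac:(lra)
      (Hsg i) HXs Hw2 Hw3) as Hgap.
    assert (HZ2 : a * Rabs (Z2 i x) <= eta / 2).
    { eapply Rle_trans; [|exact Hsmall2]. apply Rmult_le_compat_l; [lra|].
      unfold Z2. eapply Rle_trans; [apply Rabs_triang|]. rewrite HsR.
      apply Rplus_le_compat; [exact HMx2|]. fold xi.
      replace (eps * N * (2 * (b * p2 x) * (b * p2 x) + 2 * (xi - sg i) * (b * p3 x))) with
        (2 * N * (a * (p2 x * p2 x) + (xi - sg i) * (eps * b) * p3 x))
        by (rewrite <- Hba; ring).
      rewrite Rabs_mult, (Rabs_right (2 * N)) by lra.
      apply Rmult_le_compat_l; [lra|].
      eapply Rle_trans; [apply Rabs_triang|]. rewrite !Rabs_mult.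
      rewrite (Rabs_right a) by lra. rewrite (Rabs_right eps), (Rabs_right b) by lra.
      pose proof (Rabs_pos (p2 x)). pose proof (Rabs_pos (p3 x)). pose proof (Rabs_pos (xi - sg i)).
      assert (Rabs (p2 x) * Rabs (p2 x) <= M * M) by (apply Rmult_le_compat; lra).
      apply Rplus_le_compat.
      - rewrite <- (Rmult_1_l (M * M)). apply Rmult_le_compat; try lra. nra.
      - apply Rmult_le_compat; try lra.
        + apply Rmult_le_pos; [lra|]. apply Rmult_le_pos; lra.
        + rewrite <- (Rmult_1_r (2 * rho)). apply Rmult_le_compat; try lra.
          apply Rmult_le_pos; lra. }
    assert (Hgdiff : s * (g (u x t / eps) - g (W i Y)) <= Lg / eps * om i x t).
    { eapply Rle_trans; [apply Hsabs|]. eapply Rle_trans; [apply HLg|].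
      assert (E : Rabs (u x t / eps - W i Y) = om i x t / eps).
      { rewrite <- HsR.
        replace (s * (u x t / eps - W i Y)) with (om i x t / eps).
        - apply Rabs_right. apply Rle_ge, Rdiv_le_0_compat; lra.
        - unfold om, V. fold Y. field. lra. }
      rewrite E. right. field. lra. }
    pose proof (Hsabs ((X * X - sg i * sg i) * W2 i Y)) as H5.
    pose proof (Hsabs (Z2 i x)) as H6.
    assert (H7 : a * W1 i Y * (s * Z2 i x) <= eta / 2 * W1 i Y).
    { apply Rle_trans with (a * W1 i Y * Rabs (Z2 i x)).
      - apply Rmult_le_compat_l; [apply Rmult_le_pos; lra|exact H6].
      - rewrite Rmult_assoc, (Rmult_comm (W1 i Y)), <- Rmult_assoc.
        apply Rmult_le_compat_r; lra. }
    assert (H8 : 40 * rho * C * W1 i Y <= eta / 2 * W1 i Y).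
    { apply Rmult_le_compat_r; [lra|]. rewrite <- Erho. nra. }
    replace (s * ut + - s * (W1 i Y * l) - a * (s * uxx + - s * (W2 i Y *
      (Z1 i x * Z1 i x / eps) + W1 i Y * Z2 i x))) with
      (s * (g (u x t / eps) - g (W i Y)) - s * (lam * W1 i Y - sg i * sg i * W2 i Y - g (W i Y))
       - (s * s) * eta * W1 i Y + s * ((X * X - sg i * sg i) * W2 i Y)
       + a * W1 i Y * (s * Z2 i x)).
    2:{ rewrite Hueqn, <- EX. unfold l. ring. }
    rewrite Hss. lra. }
  intros x t Hx Ht. destruct (Hnear x Hx) as [j [Hj Hjd]].
  pose proof (Hmax x t Hx Ht) as H1. pose proof (finite_max_ge om n j x t Hj) as H2.
  pose proof (HsV j x t) as [_ H3].
  assert (H4 : om j x t <= 0) by lra. unfold om in H4. lra.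
Qed.

End Barrier.

(** * Moduli of continuity, and barriers as the scale tends to 0 *)

Lemma at_right_0 (P : R -> Prop) :
  at_right 0 P <-> exists d, 0 < d /\ forall e, 0 < e < d -> P e.
Proof.
  split.
  - intros [d Hd]. exists d. split; [apply cond_pos|]. intros e He. apply Hd; [|lra].
    change (Rabs (e - 0) < d). rewrite Rabs_right; lra.
  - intros [d [Hd H]]. exists (mkposreal d Hd). intros e He He0. apply H.
    change (Rabs (e - 0) < d) in He. rewrite Rabs_right in He; lra.
Qed.

Lemma eventually_lt (c : R) : 0 < c -> at_right 0 (fun e => 0 < e < c).
Proof. intros Hc. apply at_right_0. exists c; split; [exact Hc|]. intros e He; exact He. Qed.

Lemma eventually_pos : at_right 0 (fun e => 0 < e).
Proof. generalize (eventually_lt 1 Rlt_0_1). apply filter_imp. intros e He; lra. Qed.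

Lemma eventually_Rpower_lt (r c : R) : 0 < r -> 0 < c -> at_right 0 (fun e => Rpower e r < c).
Proof.
  intros Hr Hc. apply at_right_0. exists (Rpower c (/ r)).
  split; [apply exp_pos|]. intros e He.
  apply Rlt_le_trans with (Rpower (Rpower c (/ r)) r).
  - apply Rlt_Rpower_l; assumption.
  - rewrite Rpower_mult, Rinv_l, Rpower_1; lra.
Qed.

Lemma cont_affine (u : R -> R -> R) (c h : R) : Rabs c <= 1 ->
  continuous_on_closed_half_plane u ->
  continuous_on_closed_half_plane (fun x t => u (c * x + h) t).
Proof.
  intros Hc Hu x t Ht. apply filterlim_locally. intros e.
  destruct (cont_eps u (c * x + h) t e Hu Ht (cond_pos e)) as [d [Hd H]].
  exists (mkposreal d Hd). intros [y s] [Hy Hs] Hs0. simpl in *.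
  change (Rabs (y - x) < d) in Hy. change (Rabs (s - t) < d) in Hs.
  apply H; try assumption.
  replace (c * y + h - (c * x + h)) with (c * (y - x)) by ring.
  rewrite Rabs_mult. pose proof (Rabs_pos (y - x)). pose proof (Rabs_pos c). nra.
Qed.

Lemma jet_affine (u : R -> R -> R) (c h x t ut uxx : R) :
  jet u (c * x + h) t ut uxx ->
  jet (fun y s => u (c * y + h) s) x t ut (c * c * uxx).
Proof.
  intros [Hut [ux [Hux Huxx]]]. split; [exact Hut|].
  assert (Haff : forall (f : R -> R) y l, is_derive f (c * y + h) l ->
    is_derive (fun y => f (c * y + h)) y (c * l)).
  { intros f y l Hf. apply (is_derive_comp f (fun y => c * y + h)); [exact Hf|].
    auto_derive; [trivial|ring]. }
  exists (fun y => c * ux (c * y + h)). split.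
  - intros y. apply (Haff (fun z => u z t)), Hux.
  - eapply is_derive_eq; [apply is_derive_scal, (Haff ux), Huxx|ring].
Qed.

Lemma growth_pos (u : R -> R -> R) (T : R) : 0 <= T -> linear_growth u ->
  exists C, 0 <= C /\ forall x t, 0 <= t <= T -> Rabs (u x t) <= C * (1 + Rabs x).
Proof.
  intros HT H. destruct (H T) as [C HC]. exists C. split; [|exact HC].
  specialize (HC 0 0 ltac:(lra)). rewrite Rabs_R0 in HC.
  pose proof (Rabs_pos (u 0 0)). lra.
Qed.

(** [u + eps k] is again a solution for every integer [k], by periodicity.  A
    translate of [u] lies initially below [u + L |h|], hence forever below
    [u + eps k], where [eps k] is [L |h|] rounded up. *)
Lemma space_modulus (g : R -> R) (Lg gm gM a eps L : R) (u : R -> R -> R) :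
  speed g Lg gm gM -> 0 <= a -> 0 < eps -> 0 <= L -> solves g a eps u ->
  (forall x y, Rabs (u x 0 - u y 0) <= L * Rabs (x - y)) ->
  forall x y t, 0 <= t -> Rabs (u x t - u y t) <= L * Rabs (x - y) + eps.
Proof.
  intros [HLg [Hgp _]] Ha He HL [Huc [Hug Hueq]] H0.
  pose proof (lipschitz_constant_nonneg g Lg HLg) as HL0.
  assert (Hone : forall h x t, 0 <= t -> u (1 * x + h) t - u x t <= L * Rabs h + eps).
  { intros h x t Ht.
    pose proof (Rabs_pos h) as Hh.
    assert (HLh : 0 <= L * Rabs h / eps).
    { apply Rdiv_le_0_compat; [apply Rmult_le_pos|]; lra. }
    destruct (nfloor_ex _ HLh) as [k [Hk1 Hk2]].
    assert (EL : L * Rabs h = L * Rabs h / eps * eps) by (field; lra).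
    set (n := S k). assert (En : INR n = INR k + 1) by apply S_INR.
    assert (Hn1 : L * Rabs h <= eps * INR n) by (rewrite EL, En; nra).
    assert (Hn2 : eps * INR n <= L * Rabs h + eps) by (rewrite EL, En; nra).
    destruct (growth_pos u t Ht Hug) as [C [HC HCb]].
    assert (Hw : u (1 * x + h) t - u x t - eps * INR n <= 0); [|lra].
    apply (max_principle (fun x t => u (1 * x + h) t - u x t - eps * INR n) a (Lg / eps)
      (C * (2 + Rabs h)) m_infty p_infty 0 t); try exact I; try lra.
    - apply Rdiv_le_0_compat; lra.
    - apply cont_minus; [apply cont_minus|apply cont_const]; [|exact Huc].
      apply cont_affine; [rewrite Rabs_R1; lra|exact Huc].
    - intros y s Hs. pose proof (HCb (1 * y + h) s Hs) as H1. pose proof (HCb y s Hs) as H2.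
      apply Rcomplements.Rabs_le_between in H1, H2.
      assert (Rabs (1 * y + h) <= Rabs y + Rabs h)
        by (rewrite Rmult_1_l; apply Rabs_triang).
      pose proof (Rabs_pos y). pose proof (pos_INR n).
      assert (C * (1 + Rabs (1 * y + h)) + C * (1 + Rabs y) <= C * (2 + Rabs h) * (1 + Rabs y)).
      { rewrite <- Rmult_plus_distr_l, Rmult_assoc. apply Rmult_le_compat_l; [exact HC|]. nra. }
      assert (0 <= eps * INR n) by (apply Rmult_le_pos; lra). lra.
    - intros y s _ _ Hs Hpos. split; [exact I|]. split; [exact I|].
      assert (Hs0 : 0 < s).
      { destruct (Req_dec s 0) as [->|]; [|lra]. exfalso.
        specialize (H0 (1 * y + h) y). replace (1 * y + h - y) with h in H0 by ring.
        apply Rcomplements.Rabs_le_between in H0. lra. }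
      split; [exact Hs0|].
      destruct (Hueq (1 * y + h) s Hs0) as [ut [uxx [Hj E]]].
      destruct (Hueq y s Hs0) as [ut' [uxx' [Hj' E']]].
      exists (ut - ut'), (uxx - uxx'). split.
      + apply (jet_ext (fun y s => 1 * (1 * u (1 * y + h) s + -1 * u y s) +
          1 * (- (eps * INR n)))); [intros; ring|].
        eapply jet_eq.
        * apply jet_lin.
          -- apply jet_lin; [apply jet_affine, Hj|exact Hj'].
          -- split; [apply (is_derive_const (- (eps * INR n)))|].
             exists (fun _ => 0). split; [intros z; apply (is_derive_const (- (eps * INR n)))|].
             apply (is_derive_const 0).
        * unfold zero; simpl; ring.
        * unfold zero; simpl; ring.
      + rewrite E, E'.
        assert (Hgg : g (u (1 * y + h) s / eps) - g (u y s / eps) <=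
          Lg / eps * (u (1 * y + h) s - u y s - eps * INR n)).
        { rewrite <- (periodic_nat g (u y s / eps) n Hgp).
          eapply Rle_trans; [apply Rle_abs|]. eapply Rle_trans; [apply HLg|].
          replace (u (1 * y + h) s / eps - (u y s / eps + INR n)) with
            ((u (1 * y + h) s - u y s - eps * INR n) / eps) by (field; lra).
          rewrite Rabs_right; [right; field; lra|].
          apply Rle_ge, Rdiv_le_0_compat; lra. }
        lra. }
  intros x y t Ht. apply Rabs_le. split.
  - pose proof (Hone (y - x) x t Ht) as H. replace (1 * x + (y - x)) with y in H by ring.
    rewrite Rabs_minus_sym in H. lra.
  - pose proof (Hone (x - y) y t Ht) as H. replace (1 * y + (x - y)) with x in H by ring. lra.
Qed.

(** Comparison with a parabola of opening [A] rising at the speed [2 A a + gM], which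
    bounds both its own diffusion and [g]; [L^2/(4 A)] lifts it above the initial
    cone of slope [L]. *)
Lemma time_modulus (g : R -> R) (Lg gm gM a eps L e1 A x t0 : R) (u : R -> R -> R) :
  speed g Lg gm gM -> 0 <= a -> 0 <= L -> 0 <= e1 -> 0 < A -> 0 <= t0 -> solves g a eps u ->
  (forall y, Rabs (u y t0 - u x t0) <= L * Rabs (y - x) + e1) ->
  forall t, t0 <= t ->
    Rabs (u x t - u x t0) <= e1 + L * L / (4 * A) + (2 * A * a + gM) * (t - t0).
Proof.
  intros [_ [_ [Hgm Hgb]]] Ha HL He1 HA Ht0 [Huc [Hug Hueq]] H0 t Ht.
  assert (HgM : 0 < gM) by (specialize (Hgb 0); lra).
  set (k := 2 * A * a + gM).
  assert (Hk : gM <= k) by (unfold k; assert (0 <= 2 * A * a) by (apply Rmult_le_pos; lra); lra).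
  destruct (growth_pos u t ltac:(lra) Hug) as [C [HC HCb]].
  assert (Hone : forall sg, sg = 1 \/ sg = -1 ->
    sg * (u x t - u x t0) - (e1 + L * L / (4 * A) + k * (t - t0)) <= 0).
  { intros sg Hsg.
    pose proof (sign_mul_le_abs sg Hsg) as HsR.
    assert (Hsg1 : sg <= 1) by (destruct Hsg; lra).
    set (w := fun y s => sg * u y s + 1 * (- sg * u x t0 - e1 - L * L / (4 * A)
      - A * ((y - x) * (y - x)) - k * (s - t0))).
    assert (HLA : 0 <= L * L / (4 * A)) by (apply Rdiv_le_0_compat; nra).
    assert (Hw : w x t <= 0).
    { apply (max_principle w a 0 (C + Rabs (u x t0)) m_infty p_infty t0 t);
        try exact I; try lra.
      - apply cont_plus; [apply cont_scal, Huc|]. apply cont_scal.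
        apply (cont_ext (fun y s => (- sg * u x t0 - e1 - L * L / (4 * A)
          - A * ((y - x) * (y - x))) - k * (s - t0))); [intros; ring|].
        apply cont_minus.
        + apply (cont_space (fun y => - sg * u x t0 - e1 - L * L / (4 * A)
            - A * ((y - x) * (y - x)))). intros y.
          apply (ex_derive_continuous (fun y => - sg * u x t0 - e1 - L * L / (4 * A)
            - A * ((y - x) * (y - x)))). auto_derive; trivial.
        + apply (cont_time (fun s => k * (s - t0))). intros s.
          apply (ex_derive_continuous (fun s => k * (s - t0))). auto_derive; trivial.
      - intros y s Hs. unfold w.
        pose proof (HCb y s ltac:(lra)) as H1. pose proof (HsR (u y s)) as H2.
        pose proof (HsR (- u x t0)) as H3. rewrite Rabs_Ropp in H3.
        pose proof (Rabs_pos y). pose proof (Rabs_pos (u x t0)).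
        assert (0 <= A * ((y - x) * (y - x))) by (apply Rmult_le_pos; [lra|apply Rle_0_sqr]).
        assert (0 <= k * (s - t0)) by (apply Rmult_le_pos; lra).
        nra.
      - intros y s _ _ Hs Hpos. split; [exact I|]. split; [exact I|].
        assert (Hs0 : t0 < s).
        { destruct (Req_dec s t0) as [->|]; [|lra]. exfalso. unfold w in Hpos.
          pose proof (HsR (u y t0 - u x t0)) as H1. specialize (H0 y).
          assert (H2 : L * Rabs (y - x) <= L * L / (4 * A) + A * ((y - x) * (y - x))).
          { replace ((y - x) * (y - x)) with (Rabs (y - x) * Rabs (y - x)).
            2:{ rewrite <- Rabs_mult. apply Rabs_right, Rle_ge, Rle_0_sqr. }
            set (r := Rabs (y - x)).
            assert (0 <= A * ((r - L / (2 * A)) * (r - L / (2 * A))))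
              by (apply Rmult_le_pos; [lra|apply Rle_0_sqr]).
            replace (A * ((r - L / (2 * A)) * (r - L / (2 * A)))) with
              (A * (r * r) + L * L / (4 * A) - L * r) in H by (field; lra). lra. }
          lra. }
        split; [exact Hs0|].
        destruct (Hueq y s ltac:(lra)) as [ut [uxx [Hj E]]].
        exists (sg * ut + 1 * (- k)), (sg * uxx + 1 * (- (2 * A))). split.
        + apply jet_lin; [exact Hj|]. split.
          * auto_derive; [trivial|ring].
          * exists (fun y => - (2 * A * (y - x))). split; [intros z|];
              (auto_derive; [trivial|ring]).
        + rewrite E. specialize (Hgb (u y s / eps)).
          assert (sg * g (u y s / eps) <= gM) by nra.
          unfold k. lra. }
    unfold w in Hw. replace ((x - x) * (x - x)) with 0 in Hw by ring. lra. }
  apply Rabs_le. pose proof (Hone 1 (or_introl eq_refl)). pose proof (Hone (-1) (or_intror eq_refl)).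
  lra.
Qed.

(** The smallness conditions hold eventually since [eps^alpha] tends to 0, and the
    natural slope [eps^((1 - alpha)/2)] does as well, because [alpha < 1]: a barrier
    whose slope is bounded away from 0 only involves waves of arbitrarily large
    slope. *)
Lemma barrier_comparison (g : R -> R) (Lg gm gM s lam C Q0 alpha A B T M p0 eta : R)
    (p p1 p2 p3 : R -> R) :
  speed g Lg gm gM -> s = 1 \/ s = -1 -> 0 <= C -> 0 <= Q0 ->
  (forall q, Q0 < q -> exists W W1 W2, wave g s lam q C W W1 W2) ->
  (forall x, is_derive p x (p1 x)) -> (forall x, is_derive p1 x (p2 x)) ->
  (forall x, is_derive p2 x (p3 x)) ->
  A <= B -> 0 <= T -> 0 <= M -> 0 < eta -> 0 < alpha < 1 ->
  (forall x, A <= x <= B -> Rabs (p1 x) <= M /\ Rabs (p2 x) <= M /\ Rabs (p3 x) <= M) ->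
  Q0 = 0 \/ (0 < p0 /\ forall x, A <= x <= B -> p0 <= Rabs (p1 x)) ->
  at_right 0 (fun eps => forall u, solves g (Rpower eps alpha) eps u ->
    (forall x t, A <= x <= B -> 0 <= t <= T -> t = 0 \/ x = A \/ x = B ->
       s * (u x t - p x - (lam + s * eta) * t) <= 0) ->
    forall x t, A <= x <= B -> 0 <= t <= T ->
      s * (u x t - p x - (lam + s * eta) * t) <= 3 * eps).
Proof.
  intros Hg Hs HC HQ0 Hwaves Hp Hp1 Hp2 HAB HT HM0 Heta Hal HM Hsteep.
  set (rho := eta / (80 * (C + 1))). set (N := 2 / (rho * rho)).
  assert (Hrho : 0 < rho) by (apply Rdiv_lt_0_compat; lra).
  assert (HN : 0 < N) by (apply Rdiv_lt_0_compat; [lra|nra]).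
  set (K1 := 2 * N * M + 1). set (K2 := M + 2 * N * (M * M + 2 * rho * M) + 1).
  assert (HK1 : 0 < K1).
  { unfold K1. assert (0 <= 2 * N * M) by (apply Rmult_le_pos; lra). lra. }
  assert (HK2 : 0 < K2).
  { unfold K2. assert (0 <= 2 * N * (M * M + 2 * rho * M)); [|lra].
    assert (0 <= M * M) by (apply Rmult_le_pos; lra).
    assert (0 <= rho * M) by (apply Rmult_le_pos; lra).
    apply Rmult_le_pos; lra. }
  assert (HB : exists P, 0 < P /\ (Q0 = 0 \/ (P = p0 /\ forall x, A <= x <= B -> p0 <= Rabs (p1 x)))).
  { destruct Hsteep as [H|[H1 H2]]; [exists 1|exists p0]; split; auto; lra. }
  destruct HB as [P [HP Hsteep']].
  assert (HS : 0 < P / (2 * rho + 1 + Q0)) by (apply Rdiv_lt_0_compat; lra).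
  pose proof (eventually_lt 1 Rlt_0_1) as E0.
  pose proof (eventually_Rpower_lt alpha 1 (proj1 Hal) Rlt_0_1) as E1.
  pose proof (eventually_Rpower_lt alpha (/ K1) (proj1 Hal) (Rinv_0_lt_compat _ HK1)) as E2.
  assert (HeK : 0 < eta / 2 / K2) by (apply Rdiv_lt_0_compat; lra).
  pose proof (eventually_Rpower_lt alpha (eta / 2 / K2) (proj1 Hal) HeK) as E3.
  pose proof (eventually_Rpower_lt ((1 - alpha) / 2) _ ltac:(lra) HS) as E4.
  generalize (filter_and _ _ E0 (filter_and _ _ E1 (filter_and _ _ E2 (filter_and _ _ E3 E4)))).
  clear E0 E1 E2 E3 E4. apply filter_imp.
  intros eps [[He0 He1] [H1 [H2 [H3 H4]]]] u Hu Hbd.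
  set (a := Rpower eps alpha) in *. set (c := Rpower eps ((1 - alpha) / 2)) in *.
  assert (Ha : 0 < a) by apply exp_pos. assert (Hc : 0 < c) by apply exp_pos.
  assert (Hca : c * c * a = eps).
  { unfold a, c. rewrite <- !Rpower_plus.
    replace ((1 - alpha) / 2 + (1 - alpha) / 2 + alpha) with 1 by field. apply Rpower_1, He0. }
  apply (barrier_at_scale g Lg gm gM Hg s lam C Q0 Hs HC Hwaves p p1 p2 p3 Hp Hp1 Hp2 A B T M eta
    HAB HT Heta HM a (/ c) eps u); fold rho; fold N; try assumption; try lra.
  - apply Rinv_0_lt_compat, Hc.
  - rewrite <- Hca. field. lra.
  - rewrite <- Hca. replace (c * c * a * / c) with (c * a) by (field; lra).
    assert (c < 1); [|nra].
    apply Rnot_le_lt; intros Hge. assert (1 * a <= c * c * a); [|].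
    { apply Rmult_le_compat_r; [lra|]. nra. }
    assert (a <= eps) by lra.
    assert (eps < a); [|lra].
    unfold a. rewrite <- (Rpower_1 eps He0) at 1. unfold Rpower. apply exp_increasing.
    assert (ln eps < 0) by (rewrite <- ln_1; apply ln_increasing; lra). nra.
  - assert (K1 * a < 1).
    { apply Rmult_lt_compat_l with (r := K1) in H2; [|exact HK1]. rewrite Rinv_r in H2; lra. }
    unfold K1 in H. nra.
  - assert (K2 * a < eta / 2).
    { apply Rmult_lt_compat_l with (r := K2) in H3; [|exact HK2].
      replace (K2 * (eta / 2 / K2)) with (eta / 2) in H3 by (field; lra). exact H3. }
    unfold K2 in H. nra.
  - intros x sg Hx Hsg Hd. destruct Hsteep' as [->|[-> Hst]].
    + assert (sg <> 0) by (intros ->; rewrite Rabs_R0 in Hsg; lra).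
      pose proof (Rsqr_pos_lt sg H). exact H0.
    + specialize (Hst x Hx).
      assert (Hcp : 2 * rho + 1 + Q0 <= / c * p0).
      { apply Rmult_le_reg_l with c; [exact Hc|].
        rewrite <- Rmult_assoc, Rinv_r, Rmult_1_l by lra.
        apply Rmult_lt_compat_r with (r := 2 * rho + 1 + Q0) in H4; [|lra].
        replace (p0 / (2 * rho + 1 + Q0) * (2 * rho + 1 + Q0)) with p0 in H4 by (field; lra).
        lra. }
      assert (Hxi : 2 * rho + 1 + Q0 <= Rabs (/ c * p1 x)).
      { rewrite Rabs_mult, (Rabs_right (/ c)) by (apply Rle_ge; left; apply Rinv_0_lt_compat, Hc).
        eapply Rle_trans; [exact Hcp|]. apply Rmult_le_compat_l; [|exact Hst].
        left; apply Rinv_0_lt_compat, Hc. }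
      assert (Hsgb : 1 + Q0 <= Rabs sg).
      { pose proof (Rabs_triang (/ c * p1 x - sg) sg) as Ht.
        replace (/ c * p1 x - sg + sg) with (/ c * p1 x) in Ht by ring. lra. }
      replace (sg * sg) with (Rabs sg * Rabs sg).
      2:{ rewrite <- Rabs_mult. apply Rabs_right, Rle_ge, Rle_0_sqr. }
      nra.
Qed.

(** * One-sided bounds for the limit *)

Section Limit.
Context (g : R -> R) (Lg gm gM : R) (Hg : speed g Lg gm gM).
Context (alpha : R) (Hal : 0 < alpha < 1) (L : R) (HL : 1 <= L).

Definition lipschitz_with (f : R -> R) : Prop := forall x y, Rabs (f x - f y) <= L * Rabs (x - y).

Definition Cauchy_solution (f : R -> R) (eps : R) (u : R -> R -> R) : Prop :=
  solves g (Rpower eps alpha) eps u /\ forall x, u x 0 = f x.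

Let cbar := mean g.
Let clow := / mean (fun w => / g w).

Lemma clow_pos : 0 < clow.
Proof.
  apply Rinv_0_lt_compat. apply RInt_gt_0; [lra| |].
  - intros w _. apply Rinv_0_lt_compat. exact (speed_pos g Lg gm gM Hg w).
  - intros w _. apply (cont_inv g).
    + exact (lipschitz_cont g Lg (proj1 Hg)).
    + exact (speed_pos g Lg gm gM Hg).
Qed.

Lemma clow_le_cbar : clow <= cbar.
Proof. exact (harmonic_le_mean g Lg gm gM Hg). Qed.

Lemma cbar_pos : 0 < cbar.
Proof. exact (mean_speed_pos g Lg gm gM Hg). Qed.

Lemma gM_pos : 0 < gM.
Proof. destruct Hg as [_ [_ [H0 Hb]]]. specialize (Hb 0); lra. Qed.

Lemma eventually_a_le_1 : at_right 0 (fun eps => 0 < eps /\ 0 <= Rpower eps alpha <= 1).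
Proof.
  pose proof (eventually_lt 1 Rlt_0_1) as E0.
  pose proof (eventually_Rpower_lt alpha 1 (proj1 Hal) Rlt_0_1) as E1.
  generalize (filter_and _ _ E0 E1). apply filter_imp.
  intros eps [H0 H1]. split; [lra|]. split; [left; apply exp_pos|lra].
Qed.

Lemma crude_bound (f : R -> R) (T : R) : lipschitz_with f -> 0 <= T ->
  at_right 0 (fun eps => forall u, Cauchy_solution f eps u ->
    forall x t, 0 <= t <= T -> Rabs (u x t - f x) <= L * L / 4 + (2 + gM) * T).
Proof.
  intros Hf HT. generalize eventually_a_le_1. apply filter_imp.
  intros eps [He Ha] u [Hu H0] x t Ht. pose proof gM_pos as HgM.
  pose proof (time_modulus g Lg gm gM (Rpower eps alpha) eps L 0 1 x 0 u Hg (proj1 Ha)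
    ltac:(lra) (Rle_refl 0) Rlt_0_1 (Rle_refl 0) Hu) as H.
  assert (H1 : forall y, Rabs (u y 0 - u x 0) <= L * Rabs (y - x) + 0).
  { intros y. rewrite !H0, Rplus_0_r. apply Hf. }
  specialize (H H1 t (proj1 Ht)). rewrite H0 in H.
  eapply Rle_trans; [exact H|].
  replace (4 * 1) with 4 by ring. rewrite Rplus_0_l. apply Rplus_le_compat_l.
  apply Rmult_le_compat; lra.
Qed.

(** A parabola touching [f] at [y] up to [eta / 4] uses waves of all slopes, so it
    moves at the speed [lam] common to all of them.  Laterally it is so high (or low)
    at distance [r] that the crude bound suffices. *)
Lemma pointwise_barrier (s lam C : R) (f : R -> R) (y T eta : R) :
  s = 1 \/ s = -1 ->
  (forall q, 0 < q -> exists W W1 W2, wave g s lam q C W W1 W2) ->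
  lipschitz_with f -> 0 <= T -> 0 < eta ->
  at_right 0 (fun eps => forall u, Cauchy_solution f eps u ->
    forall t, 0 <= t <= T -> s * (u y t - f y - lam * t) <= eta).
Proof.
  intros Hs Hwaves Hf HT Heta.
  assert (Hss : s * s = 1) by (destruct Hs as [->| ->]; ring).
  pose proof (sign_mul_le_abs s Hs) as HsR.
  assert (Habs : Rabs s = 1).
  { destruct Hs as [->| ->]; [apply Rabs_R1|rewrite Rabs_left; lra]. }
  pose proof gM_pos as HgM.
  set (de := eta / 4). set (A := L * L / (4 * de)). set (e1 := eta / (4 * (T + 1))).
  assert (Hde : 0 < de) by (unfold de; lra).
  assert (HLL : 1 <= L * L) by nra.
  assert (HA : 0 < A) by (apply Rdiv_lt_0_compat; lra).
  assert (He1 : 0 < e1) by (apply Rdiv_lt_0_compat; lra).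
  assert (He1T : e1 * T <= eta / 4).
  { assert (e1 * (T + 1) = eta / 4) by (unfold e1; field; lra). nra. }
  set (Cc := L * L / 4 + (2 + gM) * T).
  assert (HCc : 0 <= Cc).
  { unfold Cc. assert (0 <= (2 + gM) * T) by (apply Rmult_le_pos; lra). lra. }
  set (H := Cc + (Rabs lam + e1) * T).
  assert (HH : 0 <= H).
  { unfold H. pose proof (Rabs_pos lam).
    assert (0 <= (Rabs lam + e1) * T) by (apply Rmult_le_pos; lra). lra. }
  set (r := (L + H) / A + 1).
  assert (Hr : 1 <= r).
  { unfold r. assert (0 <= (L + H) / A) by (apply Rdiv_le_0_compat; lra). lra. }
  assert (HAr : L * r + H <= A * (r * r)).
  { assert (E : A * r = L + H + A) by (unfold r; field; lra).
    replace (A * (r * r)) with ((A * r) * r) by ring. rewrite E. nra. }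
  set (p := fun x => f y + s * (de + A * ((x - y) * (x - y)))).
  assert (Hyoung : forall z, L * Rabs z <= de + A * (z * z)).
  { intros z. replace (z * z) with (Rabs z * Rabs z).
    2:{ rewrite <- Rabs_mult. apply Rabs_right, Rle_ge, Rle_0_sqr. }
    set (w := Rabs z).
    assert (0 <= A * ((w - 2 * de / L) * (w - 2 * de / L)))
      by (apply Rmult_le_pos; [lra|apply Rle_0_sqr]).
    replace (A * ((w - 2 * de / L) * (w - 2 * de / L))) with (A * (w * w) + de - L * w) in H0
      by (unfold A; field; lra).
    lra. }
  assert (HC' : 0 <= Rmax C 0) by apply Rmax_r.
  assert (Hwaves' : forall q, 0 < q -> exists W W1 W2, wave g s lam q (Rmax C 0) W W1 W2).
  { intros q Hq. destruct (Hwaves q Hq) as [W [W1 [W2 HW]]].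
    exists W, W1, W2. apply (wave_weaken _ _ _ _ C); [apply Rmax_l|exact HW]. }
  pose proof (barrier_comparison g Lg gm gM s lam (Rmax C 0) 0 alpha (y - r) (y + r) T (2 * A * (r + 1)) 0 e1
    p (fun x => s * (2 * A * (x - y))) (fun _ => s * (2 * A)) (fun _ => 0)
    Hg Hs HC' (Rle_refl 0) Hwaves') as Hbar.
  assert (HAr1 : 0 <= A * (r + 1)) by (apply Rmult_le_pos; lra).
  assert (D1 : forall x, is_derive p x (s * (2 * A * (x - y)))).
  { intros x. unfold p. auto_derive; [trivial|ring]. }
  assert (D2 : forall x, is_derive (fun x => s * (2 * A * (x - y))) x (s * (2 * A))).
  { intros x. auto_derive; [trivial|ring]. }
  assert (D3 : forall x : R, is_derive (fun _ : R => s * (2 * A)) x 0).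
  { intros x. apply (is_derive_const (s * (2 * A))). }
  assert (HMb : forall x, y - r <= x <= y + r ->
    Rabs (s * (2 * A * (x - y))) <= 2 * A * (r + 1) /\ Rabs (s * (2 * A)) <= 2 * A * (r + 1) /\
    Rabs 0 <= 2 * A * (r + 1)).
  { intros x Hx. rewrite !Rabs_mult, Habs, Rabs_R0, (Rabs_right 2), (Rabs_right A) by lra.
    assert (Rabs (x - y) <= r + 1) by (apply Rabs_le; lra).
    pose proof (Rabs_pos (x - y)).
    split; [|split]; [|nra|lra]. rewrite Rmult_1_l. apply Rmult_le_compat_l; lra. }
  specialize (Hbar D1 D2 D3 ltac:(lra) HT ltac:(lra) He1 Hal HMb (or_introl eq_refl)).
  pose proof (crude_bound f T Hf HT) as Hcr.
  pose proof (eventually_lt (eta / 12) ltac:(lra)) as Hsm.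
  generalize (filter_and _ _ Hbar (filter_and _ _ Hcr Hsm)). apply filter_imp.
  clear Hbar Hcr Hsm. intros eps [Hbar [Hcr Hsm]] u Hu t Ht.
  specialize (Hcr u Hu). destruct Hu as [Hu H0].
  assert (Hfin : s * (u y t - p y - (lam + s * e1) * t) <= 3 * eps).
  { apply (Hbar u Hu); [|lra|exact Ht].
    intros x t' Hx Ht' Hbd.
    assert (Ep : s * (u x t' - p x - (lam + s * e1) * t') =
      s * (u x t' - f x) + s * (f x - f y) - (s * s) * (de + A * ((x - y) * (x - y)))
      - s * lam * t' - (s * s) * e1 * t') by (unfold p; ring).
    rewrite Ep, Hss.
    pose proof (HsR (f x - f y)) as K1. specialize (Hf x y).
    specialize (Hyoung (x - y)).
    assert (K4 : 0 <= e1 * t') by (apply Rmult_le_pos; lra).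
    destruct Hbd as [-> |Hbd].
    - rewrite H0, Rminus_diag. lra.
    - pose proof (HsR (u x t' - f x)) as K2. specialize (Hcr x t' Ht'). fold Cc in Hcr.
      assert (K3 : - (s * lam * t') <= (Rabs lam + e1) * T).
      { replace (- (s * lam * t')) with (s * - (lam * t')) by ring.
        eapply Rle_trans; [apply HsR|]. rewrite Rabs_Ropp, Rabs_mult, (Rabs_right t') by lra.
        pose proof (Rabs_pos lam). apply Rmult_le_compat; lra. }
      assert (Er : (x - y) * (x - y) = r * r) by (destruct Hbd as [->| ->]; ring).
      assert (Ear : Rabs (x - y) = r).
      { destruct Hbd as [->| ->]; [rewrite Rabs_left|rewrite Rabs_right]; lra. }
      rewrite Er. rewrite Ear in Hf. unfold H in HAr. lra. }
  assert (Ep : s * (u y t - p y - (lam + s * e1) * t) =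
    s * (u y t - f y - lam * t) - (s * s) * de - (s * s) * e1 * t) by (unfold p; ring).
  rewrite Ep, Hss in Hfin.
  assert (e1 * t <= e1 * T) by (apply Rmult_le_compat_l; lra).
  unfold de in Hfin. lra.
Qed.

Lemma speed_at_most_mean (f : R -> R) (y T eta : R) : lipschitz_with f -> 0 <= T -> 0 < eta ->
  at_right 0 (fun eps => forall u, Cauchy_solution f eps u ->
    forall t, 0 <= t <= T -> u y t <= f y + cbar * t + eta).
Proof.
  intros Hf HT He. destruct (super_wave g Lg gm gM Hg) as [C HC].
  generalize (pointwise_barrier 1 cbar C f y T eta (or_introl eq_refl) HC Hf HT He).
  apply filter_imp. intros eps H u Hu t Ht. specialize (H u Hu t Ht). lra.
Qed.

Lemma speed_at_least_harmonic (f : R -> R) (y T eta : R) : lipschitz_with f -> 0 <= T -> 0 < eta ->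
  at_right 0 (fun eps => forall u, Cauchy_solution f eps u ->
    forall t, 0 <= t <= T -> f y + clow * t - eta <= u y t).
Proof.
  intros Hf HT He. destruct (sub_wave_slow g Lg gm gM Hg) as [C HC].
  generalize (pointwise_barrier (-1) clow C f y T eta (or_intror eq_refl) HC Hf HT He).
  apply filter_imp. intros eps H u Hu t Ht. specialize (H u Hu t Ht). lra.
Qed.

(** The barrier [l - de exp (- k (x - x0))] is strictly increasing, so it moves at
    nearly the speed [cbar].  It is steep left of [x0], where it stays below [f] and
    sinks below any crude bound, and almost flat between [x0] and [y].  At [y] it is
    kept below the solution for all times up to [t] by the advance
    [(cbar - clow) t] of [f y], although the solution may only rise at the speed
    [clow] there. *)
Lemma slope_lower_bound (f : R -> R) (x0 y l t eta : R) :
  lipschitz_with f -> x0 <= y -> 0 <= t -> 0 < eta ->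
  (forall z, x0 <= z <= y -> l <= f z) -> l + (cbar - clow) * t <= f y ->
  at_right 0 (fun eps => forall u, Cauchy_solution f eps u -> l + cbar * t - eta <= u x0 t).
Proof.
  intros Hf Hxy Ht Heta Hpath Hy.
  pose proof gM_pos as HgM. pose proof cbar_pos as Hcb. pose proof clow_le_cbar as Hcc.
  set (e1 := Rmin (eta / (4 * (t + 1))) (cbar / 2)).
  assert (He1 : 0 < e1) by (apply Rmin_pos; [apply Rdiv_lt_0_compat|]; lra).
  assert (He1a : e1 * t <= eta / 4).
  { pose proof (Rmin_l (eta / (4 * (t + 1))) (cbar / 2)) as K. fold e1 in K.
    assert (eta / (4 * (t + 1)) * (t + 1) = eta / 4) by (field; lra). nra. }
  assert (He1b : e1 <= cbar / 2) by apply Rmin_r.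
  set (lam := cbar - e1).
  destruct (sub_wave_steep g Lg gm gM Hg lam) as [C [Q [HQ Hwaves]]];
    [unfold lam, cbar in *; lra|].
  assert (HC' : 0 <= Rmax C 0) by apply Rmax_r.
  assert (Hwaves' : forall q, Q < q -> exists W W1 W2, wave g (-1) lam q (Rmax C 0) W W1 W2).
  { intros q Hq. destruct (Hwaves q Hq) as [W [W1 [W2 HW]]].
    exists W, W1, W2. apply (wave_weaken _ _ _ _ C); [apply Rmax_l|exact HW]. }
  set (de := eta / 4). assert (Hde : 0 < de) by (unfold de; lra).
  set (k := 2 * L / de). assert (Hk : 0 < k) by (apply Rdiv_lt_0_compat; lra).
  assert (Edk : de * k = 2 * L) by (unfold k; field; lra).
  set (Cc := L * L / 4 + (2 + gM) * t).
  assert (HCc : 0 <= Cc).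
  { unfold Cc. assert (0 <= (2 + gM) * t) by (apply Rmult_le_pos; lra). nra. }
  set (r := Cc + cbar * t + 1).
  assert (Hcbt : 0 <= cbar * t) by (apply Rmult_le_pos; lra).
  assert (Hr : 1 <= r) by (unfold r; lra).
  set (E := fun x => exp (- k * (x - x0))).
  set (p := fun x => l - de * E x).
  set (e2 := de * E y). assert (He2 : 0 < e2) by (apply Rmult_lt_0_compat; [lra|apply exp_pos]).
  set (ER := exp (k * r)).
  set (M := (de * k + de * k * k + de * k * k * k) * ER).
  assert (Hk1 : 0 < de * k) by (apply Rmult_lt_0_compat; lra).
  assert (Hk2 : 0 < de * k * k) by (apply Rmult_lt_0_compat; lra).
  assert (Hk3 : 0 < de * k * k * k) by (apply Rmult_lt_0_compat; lra).
  assert (HER : 0 < ER) by apply exp_pos.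
  assert (HM : 0 <= M) by (unfold M; apply Rmult_le_pos; lra).
  assert (HE0 : forall x, 0 < E x) by (intros x; apply exp_pos).
  assert (Hexp : forall a b, a <= b -> exp a <= exp b).
  { intros a b [Hlt | ->]; [left; apply exp_increasing, Hlt|lra]. }
  assert (HEr : forall x, x0 - r <= x -> E x <= ER).
  { intros x Hx. apply Hexp. nra. }
  assert (HEy : forall x, x <= y -> E y <= E x).
  { intros x Hx. apply Hexp. nra. }
  assert (HE1 : forall x, 1 + k * (x0 - x) <= E x).
  { intros x. unfold E. replace (- k * (x - x0)) with (k * (x0 - x)) by ring. apply exp_ineq1_le. }
  pose proof (barrier_comparison g Lg gm gM (-1) lam (Rmax C 0) Q alpha (x0 - r) y t M (de * k * E y) e1
    p (fun x => de * k * E x) (fun x => - (de * k * k * E x)) (fun x => de * k * k * k * E x)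
    Hg (or_intror eq_refl) HC' HQ Hwaves') as Hbar.
  assert (D1 : forall x, is_derive p x (de * k * E x)).
  { intros x. unfold p, E. auto_derive; [trivial|]. unfold Rminus. ring. }
  assert (D2 : forall x, is_derive (fun x => de * k * E x) x (- (de * k * k * E x))).
  { intros x. unfold E. auto_derive; [trivial|]. unfold Rminus. ring. }
  assert (D3 : forall x, is_derive (fun x => - (de * k * k * E x)) x (de * k * k * k * E x)).
  { intros x. unfold E. auto_derive; [trivial|]. unfold Rminus. ring. }
  assert (HMb : forall x, x0 - r <= x <= y -> Rabs (de * k * E x) <= M /\
    Rabs (- (de * k * k * E x)) <= M /\ Rabs (de * k * k * k * E x) <= M).
  { intros x Hx. specialize (HEr x (proj1 Hx)). specialize (HE0 x).
    assert (K1 : 0 <= de * k * E x <= de * k * ER) by nra.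
    assert (K2 : 0 <= de * k * k * E x <= de * k * k * ER) by nra.
    assert (K3 : 0 <= de * k * k * k * E x <= de * k * k * k * ER) by nra.
    rewrite Rabs_Ropp, !Rabs_right by lra.
    assert (0 < de * k * ER) by (apply Rmult_lt_0_compat; lra).
    assert (0 < de * k * k * ER) by (apply Rmult_lt_0_compat; lra).
    assert (0 < de * k * k * k * ER) by (apply Rmult_lt_0_compat; lra).
    unfold M. lra. }
  assert (Hst : Q = 0 \/ (0 < de * k * E y /\
    forall x, x0 - r <= x <= y -> de * k * E y <= Rabs (de * k * E x))).
  { right. split; [apply Rmult_lt_0_compat; [lra|apply HE0]|].
    intros x Hx. pose proof (HE0 x). rewrite Rabs_right by nra.
    apply Rmult_le_compat_l; [lra|]. apply HEy; lra. }
  specialize (Hbar D1 D2 D3 ltac:(lra) Ht HM He1 Hal HMb Hst).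
  pose proof (crude_bound f t Hf Ht) as Hcr.
  pose proof (speed_at_least_harmonic f y t e2 Hf Ht He2) as Hlow.
  pose proof (eventually_lt (eta / 12) ltac:(lra)) as Hsm.
  generalize (filter_and _ _ Hbar (filter_and _ _ Hcr (filter_and _ _ Hlow Hsm))).
  apply filter_imp. clear Hbar Hcr Hlow Hsm. intros eps [Hbar [Hcr [Hlow Hsm]]] u Hu.
  specialize (Hcr u Hu). specialize (Hlow u Hu). destruct Hu as [Hu H0].
  assert (Hfx0 : l <= f x0) by (apply Hpath; lra).
  assert (Hlam : lam + -1 * e1 <= cbar) by (unfold lam; lra).
  assert (Hfin : -1 * (u x0 t - p x0 - (lam + -1 * e1) * t) <= 3 * eps).
  { apply (Hbar u Hu); [|lra|lra].
    intros x t' Hx Ht' Hbd.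
    assert (Hlt : (lam + -1 * e1) * t' <= cbar * t') by (apply Rmult_le_compat_r; lra).
    assert (p x + (lam + -1 * e1) * t' <= u x t'); [|lra].
    assert (Hleft : forall x, x <= x0 -> p x <= l - de - 2 * L * (x0 - x)).
    { intros v Hv. unfold p. specialize (HE1 v).
      assert (de * (1 + k * (x0 - v)) <= de * E v) by (apply Rmult_le_compat_l; lra).
      replace (2 * L * (x0 - v)) with (de * (k * (x0 - v))) by (rewrite <- Edk; ring). lra. }
    assert (Hfleft : forall x, x <= x0 -> l - L * (x0 - x) <= f x).
    { intros v Hv. specialize (Hf v x0). rewrite (Rabs_left1 (v - x0)) in Hf by lra.
      apply Rcomplements.Rabs_le_between in Hf. lra. }
    destruct Hbd as [-> | [-> | ->]].
    - rewrite H0. destruct (Rle_dec x x0) as [Hle|Hgt].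
      + specialize (Hleft x Hle). specialize (Hfleft x Hle).
        assert (0 <= L * (x0 - x)) by (apply Rmult_le_pos; lra). lra.
      + specialize (Hpath x ltac:(lra)).
        assert (0 < de * E x) by (apply Rmult_lt_0_compat; [lra|apply HE0]). unfold p. lra.
    - specialize (Hleft (x0 - r) ltac:(lra)). specialize (Hfleft (x0 - r) ltac:(lra)).
      specialize (Hcr (x0 - r) t' Ht'). fold Cc in Hcr.
      apply Rcomplements.Rabs_le_between in Hcr.
      replace (x0 - (x0 - r)) with r in * by ring.
      assert (cbar * t' <= cbar * t) by (apply Rmult_le_compat_l; lra).
      assert (Cc + cbar * t <= L * r) by (unfold r; nra).
      lra.
    - specialize (Hlow t' Ht'). unfold p. fold e2.
      assert ((cbar - clow) * t' <= (cbar - clow) * t) by (apply Rmult_le_compat_l; lra).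
      lra. }
  assert (Epx : p x0 = l - de).
  { unfold p, E. replace (- k * (x0 - x0)) with 0 by ring. rewrite exp_0. ring. }
  rewrite Epx in Hfin. unfold lam, de in Hfin. lra.
Qed.

(** Comparison with [h' = g(h/eps)], constant in space, started just above
    [l + (cbar - clow) t].  It rises at the speed [clow], thus reaches [l + cbar t]
    only at the final time [t] and stays above the values [l + cbar s] that bound the
    solution at the finite ends. *)
Lemma plateau_upper_bound (f : R -> R) (A B : Rbar) (x0 l t eta : R) :
  lipschitz_with f -> 0 <= t -> 0 < eta -> Rbar_le A x0 -> Rbar_le x0 B ->
  (forall a, A = Finite a -> f a <= l) -> (forall b, B = Finite b -> f b <= l) ->
  (forall z : R, Rbar_le A z -> Rbar_le z B -> f z <= l + (cbar - clow) * t) ->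
  at_right 0 (fun eps => forall u, Cauchy_solution f eps u -> u x0 t <= l + cbar * t + eta).
Proof.
  intros Hf Ht Heta HA HB HfA HfB Hmid.
  pose proof cbar_pos as Hcb. pose proof clow_le_cbar as Hcc.
  destruct Hg as [HLg [Hgp [Hgm Hgb]]].
  pose proof (lipschitz_constant_nonneg g Lg HLg) as HL0.
  destruct (periodic_flow g (lipschitz_cont g Lg HLg) Hgp (speed_pos g Lg gm gM Hg))
    as [HP [W [_ [HW [Hsurj HWb]]]]].
  set (e1 := eta / 3). assert (He1 : 0 < e1) by (unfold e1; lra).
  assert (Hend : forall c : Rbar, (forall a, c = Finite a -> f a <= l) ->
    at_right 0 (fun eps => forall u, Cauchy_solution f eps u -> forall a, c = Finite a ->
      forall s, 0 <= s <= t -> u a s <= l + cbar * s + e1)).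
  { intros c Hc. destruct c as [a| |].
    - generalize (speed_at_most_mean f a t e1 Hf Ht He1). apply filter_imp.
      intros eps H u Hu a' Ea s Hs. injection Ea as <-.
      specialize (H u Hu s Hs). specialize (Hc a eq_refl). lra.
    - generalize eventually_a_le_1. apply filter_imp. intros eps _ u _ a Ea; discriminate Ea.
    - generalize eventually_a_le_1. apply filter_imp. intros eps _ u _ a Ea; discriminate Ea. }
  pose proof (eventually_lt e1 He1) as Hsm.
  generalize (filter_and _ _ (Hend A HfA) (filter_and _ _ (Hend B HfB)
    (filter_and _ _ Hsm eventually_a_le_1))).
  apply filter_imp. clear Hend Hsm. intros eps [HuA [HuB [Hsm [He Ha]]]] u Hu.
  specialize (HuA u Hu). specialize (HuB u Hu). destruct Hu as [[Huc [Hug Hueq]] H0].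
  set (l0 := l + (cbar - clow) * t + 2 * e1).
  destruct (Hsurj (l0 / eps)) as [y0 Hy0].
  set (h := fun s => eps * W (y0 + s / eps)).
  assert (Hh : forall s, l0 + clow * s - eps <= h s <= l0 + clow * s + eps).
  { intros s. unfold h. specialize (HWb (y0 + s / eps) y0). rewrite Hy0 in HWb.
    apply Rcomplements.Rabs_le_between in HWb.
    replace ((y0 + s / eps - y0) / RInt (fun w => / g w) 0 1) with (clow * s / eps) in HWb.
    2:{ unfold clow, mean. field. split; lra. }
    set (d := W (y0 + s / eps) - l0 / eps - clow * s / eps) in HWb.
    replace (eps * W (y0 + s / eps)) with (l0 + clow * s + eps * d) by (unfold d; field; lra).
    nra. }
  assert (Hdh : forall s, is_derive h s (g (h s / eps))).
  { intros s. unfold h. eapply is_derive_eq.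
    - apply is_derive_scal. apply (is_derive_comp W (fun s => y0 + s / eps) s
        (g (W (y0 + s / eps))) (/ eps)); [apply HW|].
      auto_derive; [lra|field; lra].
    - unfold scal; simpl; unfold mult; simpl.
      replace (eps * W (y0 + s / eps) / eps) with (W (y0 + s / eps)) by (field; lra).
      field. lra. }
  destruct (growth_pos u t Ht Hug) as [C [HC HCb]].
  assert (Hc0 : 0 <= clow * t) by (apply Rmult_le_pos; [left; apply clow_pos|lra]).
  assert (Hw : 1 * u x0 t + -1 * h t <= 0).
  { apply (max_principle (fun x s => 1 * u x s + -1 * h s) (Rpower eps alpha) (Lg / eps)
      (C + (Rabs l0 + eps)) A B 0 t); try assumption; try lra.
    - apply Rdiv_le_0_compat; lra.
    - apply cont_plus; [apply cont_scal, Huc|]. apply cont_scal.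
      apply (cont_time h), (derive_cont h _ Hdh).
    - intros x s Hs. specialize (HCb x s Hs). specialize (Hh s).
      apply Rcomplements.Rabs_le_between in HCb.
      assert (0 <= clow * s) by (apply Rmult_le_pos; [left; apply clow_pos|lra]).
      pose proof (Rabs_pos x). pose proof (Rle_abs (- l0)) as K. rewrite Rabs_Ropp in K.
      pose proof (Rabs_pos l0).
      assert (0 <= (Rabs l0 + eps) * Rabs x) by (apply Rmult_le_pos; lra). lra.
    - intros x s HAx HxB Hs Hpos.
      assert (Hmono : (cbar - clow) * s <= (cbar - clow) * t) by (apply Rmult_le_compat_l; lra).
      specialize (Hh s). unfold l0 in Hh.
      assert (Hs0 : 0 < s).
      { destruct (Req_dec s 0) as [->|]; [|lra]. exfalso. rewrite H0 in Hpos.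
        specialize (Hmid x HAx HxB). lra. }
      assert (HA' : A <> Finite x).
      { intros E. specialize (HuA x E s Hs). lra. }
      assert (HB' : B <> Finite x).
      { intros E. specialize (HuB x E s Hs). lra. }
      split; [|split; [|split; [exact Hs0|]]].
      + destruct (Rbar_le_lt_or_eq_dec _ _ HAx) as [|E]; [assumption|contradiction].
      + destruct (Rbar_le_lt_or_eq_dec _ _ HxB) as [|E]; [assumption|].
        symmetry in E; contradiction.
      + destruct (Hueq x s Hs0) as [ut [uxx [Hj E]]].
        exists (1 * ut + -1 * g (h s / eps)), (1 * uxx + -1 * 0). split.
        * apply jet_lin; [exact Hj|]. split; [apply Hdh|].
          exists (fun _ => 0). split; [intros z; apply (is_derive_const (h s))|].
          apply (is_derive_const 0).
        * rewrite E.
          assert (g (u x s / eps) - g (h s / eps) <= Lg / eps * (1 * u x s + -1 * h s)); [|lra].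
          eapply Rle_trans; [apply Rle_abs|]. eapply Rle_trans; [apply HLg|].
          replace (u x s / eps - h s / eps) with ((1 * u x s + -1 * h s) / eps) by (field; lra).
          rewrite Rabs_right; [right; field; lra|].
          apply Rle_ge, Rdiv_le_0_compat; lra. }
  specialize (Hh t). unfold l0, e1 in *. lra.
Qed.

End Limit.

(** * Convergence *)

Lemma solves_reflect (g : R -> R) (a eps : R) (u : R -> R -> R) :
  solves g a eps u -> solves g a eps (fun x t => u (-1 * x + 0) t).
Proof.
  intros [Huc [Hug Hueq]]. split; [|split].
  - apply cont_affine; [rewrite Rabs_left; lra|exact Huc].
  - intros T. destruct (Hug T) as [C HC]. exists C. intros x t Ht.
    replace (Rabs x) with (Rabs (-1 * x + 0)); [apply HC, Ht|].
    rewrite <- (Rabs_Ropp x). f_equal; ring.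
  - intros x t Ht. destruct (Hueq (-1 * x + 0) t Ht) as [ut [uxx [Hj E]]].
    exists ut, uxx. split; [|exact E].
    eapply jet_eq; [apply jet_affine, Hj|reflexivity|ring].
Qed.

Lemma lip_reflect (L : R) (f : R -> R) : lipschitz_with L f -> lipschitz_with L (fun x => f (-1 * x + 0)).
Proof.
  intros Hf x y. eapply Rle_trans; [apply Hf|]. right. f_equal.
  rewrite <- Rabs_Ropp. f_equal. ring.
Qed.

Lemma Cauchy_solution_reflect (g : R -> R) (alpha eps : R) (f : R -> R) (u : R -> R -> R) :
  Cauchy_solution g alpha f eps u ->
  Cauchy_solution g alpha (fun x => f (-1 * x + 0)) eps (fun x t => u (-1 * x + 0) t).
Proof.
  intros [Hu H0]. split; [apply solves_reflect, Hu|]. intros x; apply H0.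
Qed.

(** Follow [f] to the right of [x0] up to the first point where it is at most [l], or
    to infinity; no point before it can have reached [c]. *)
Lemma blocked_on_right (L : R) (f : R -> R) (x0 l c : R) :
  lipschitz_with L f -> l <= c -> l < f x0 ->
  ~ (exists y, x0 <= y /\ (forall z, x0 <= z <= y -> l <= f z) /\ c <= f y) ->
  exists B : Rbar, Rbar_le x0 B /\ (forall b, B = Finite b -> f b <= l) /\
    forall z : R, x0 <= z -> Rbar_le z B -> f z <= c.
Proof.
  intros Hf Hlc Hx0 Hno.
  assert (Hbelow : forall z, x0 <= z -> (forall r, x0 <= r <= z -> l <= f r) -> f z <= c).
  { intros z Hz Hp. apply Rnot_lt_le; intros Hlt. apply Hno. exists z.
    split; [exact Hz|]. split; [exact Hp|lra]. }
  set (S := fun z => x0 <= z /\ forall r, x0 <= r <= z -> l < f r).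
  assert (HS0 : S x0).
  { split; [lra|]. intros r Hr. replace r with x0 by lra. exact Hx0. }
  destruct (classic (bound S)) as [Hb|Hunb].
  - destruct (completeness S Hb (ex_intro _ x0 HS0)) as [b [Hub Hlub]].
    assert (Hxb : x0 <= b) by (apply Hub, HS0).
    assert (Hbefore : forall r, x0 <= r < b -> l < f r).
    { intros r Hr. apply NNPP; intros Hn.
      assert (b <= r); [|lra]. apply Hlub. intros z [Hz Hp].
      apply Rnot_lt_le; intros Hlt. apply Hn, Hp; lra. }
    assert (Hfb : f b <= l).
    { apply Rnot_lt_le; intros Hlt.
      set (d := (f b - l) / (Rabs L + 1)).
      assert (HL : 0 < Rabs L + 1) by (pose proof (Rabs_pos L); lra).
      assert (Hd : 0 < d) by (apply Rdiv_lt_0_compat; lra).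
      assert (b + d / 2 <= b); [|lra]. apply Hub. split; [lra|]. intros r Hr.
      destruct (Rlt_dec r b) as [H|H]; [apply Hbefore; lra|].
      pose proof (Hf r b) as Hl. rewrite (Rabs_right (r - b)) in Hl by lra.
      apply Rcomplements.Rabs_le_between in Hl.
      assert (L * (r - b) <= (Rabs L + 1) * (r - b)).
      { apply Rmult_le_compat_r; [lra|]. pose proof (Rle_abs L); lra. }
      assert ((Rabs L + 1) * (r - b) <= (Rabs L + 1) * (d / 2)) by (apply Rmult_le_compat_l; lra).
      assert ((Rabs L + 1) * (d / 2) = (f b - l) / 2) by (unfold d; field; lra).
      lra. }
    exists (Finite b). split; [exact Hxb|]. split.
    + intros b' E; injection E as <-; exact Hfb.
    + intros z Hz Hzb. simpl in Hzb. destruct (Req_dec z b) as [->|Hne]; [lra|].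
      apply Hbelow; [exact Hz|]. intros r Hr. left. apply Hbefore; lra.
  - exists p_infty. split; [exact I|]. split; [intros b E; discriminate E|].
    intros z Hz _. apply Hbelow; [exact Hz|]. intros r Hr.
    apply Rnot_lt_le; intros Hlt. apply Hunb. exists r. intros y [Hy Hp].
    apply Rnot_lt_le; intros Hry. specialize (Hp r ltac:(lra)). lra.
Qed.

Section Convergence.
Context (g : R -> R) (Lg gm gM : R) (Hg : speed g Lg gm gM).
Context (alpha : R) (Hal : 0 < alpha < 1) (L : R) (HL : 1 <= L).
Context (f : R -> R) (Hf : lipschitz_with L f).
Context (ueps : R -> R -> R -> R)
  (Hsol : forall eps, 0 < eps -> Cauchy_solution g alpha f eps (ueps eps)).

Let cbar := mean g.
Let clow := / mean (fun w => / g w).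

(** Every level [l] is asymptotically either a lower or an upper bound at
    [(x0, t)], in the frame moving at the speed [cbar]: either some point reachable
    from [x0] above the level [l] has enough advance, or [x0] is blocked on both
    sides. *)
Lemma level_dichotomy (x0 l t : R) : 0 <= t ->
  (forall eta, 0 < eta -> at_right 0 (fun eps => l + cbar * t - eta <= ueps eps x0 t)) \/
  (forall eta, 0 < eta -> at_right 0 (fun eps => ueps eps x0 t <= l + cbar * t + eta)).
Proof.
  intros Ht.
  pose proof eventually_pos as Hpos.
  assert (Hcc : clow <= cbar) by exact (clow_le_cbar g Lg gm gM Hg).
  assert (Hct : 0 <= (cbar - clow) * t) by (apply Rmult_le_pos; lra).
  set (c := l + (cbar - clow) * t).
  assert (Hplateau : forall A B : Rbar, Rbar_le A x0 -> Rbar_le x0 B ->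
    (forall a, A = Finite a -> f a <= l) -> (forall b, B = Finite b -> f b <= l) ->
    (forall z : R, Rbar_le A z -> Rbar_le z B -> f z <= c) ->
    forall eta, 0 < eta -> at_right 0 (fun eps => ueps eps x0 t <= l + cbar * t + eta)).
  { intros A B HA HB HfA HfB Hmid eta Heta.
    generalize (filter_and _ _ Hpos (plateau_upper_bound g Lg gm gM Hg alpha Hal L HL f A B x0 l t
      eta Hf Ht Heta HA HB HfA HfB Hmid)).
    apply filter_imp. intros eps [He H]. apply H, Hsol, He. }
  destruct (Rle_lt_dec (f x0) l) as [Hlow|Hhigh].
  { right. apply (Hplateau x0 x0); simpl; try lra.
    - intros a E; injection E as <-; exact Hlow.
    - intros a E; injection E as <-; exact Hlow.
    - intros z Hz1 Hz2. replace z with x0 by lra. unfold c; lra. }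
  destruct (classic (exists y, x0 <= y /\ (forall z, x0 <= z <= y -> l <= f z) /\ c <= f y))
    as [[y [Hy [Hp Hfy]]]|Hright].
  { left. intros eta Heta.
    generalize (filter_and _ _ Hpos (slope_lower_bound g Lg gm gM Hg alpha Hal L HL f x0 y l t eta
      Hf Hy Ht Heta Hp Hfy)).
    apply filter_imp. intros eps [He H]. apply H, Hsol, He. }
  set (f' := fun x => f (-1 * x + 0)).
  assert (Hf' : lipschitz_with L f') by (apply lip_reflect, Hf).
  assert (Ex0 : -1 * (- x0) + 0 = x0) by ring.
  destruct (classic (exists y, - x0 <= y /\ (forall z, - x0 <= z <= y -> l <= f' z) /\ c <= f' y))
    as [[y [Hy [Hp Hfy]]]|Hleft].
  { left. intros eta Heta.
    generalize (filter_and _ _ Hpos (slope_lower_bound g Lg gm gM Hg alpha Hal L HL f' (- x0) y l t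
      eta Hf' Hy Ht Heta Hp Hfy)).
    apply filter_imp. intros eps [He H].
    specialize (H _ (Cauchy_solution_reflect g alpha eps f _ (Hsol eps He))).
    simpl in H. rewrite Ex0 in H. exact H. }
  right.
  destruct (blocked_on_right L f x0 l c Hf ltac:(unfold c; lra) Hhigh Hright) as
    [B [HB [HfB HmB]]].
  destruct (blocked_on_right L f' (- x0) l c Hf' ltac:(unfold c; lra)) as [A [HA [HfA HmA]]].
  { unfold f'. rewrite Ex0. exact Hhigh. }
  { exact Hleft. }
  apply (Hplateau (Rbar_opp A) B).
  - destruct A as [a| |]; simpl in *; try easy. lra.
  - exact HB.
  - intros a E. destruct A as [a'| |]; simpl in E; try discriminate E. injection E as <-.
    specialize (HfA a' eq_refl). unfold f' in HfA.
    replace (-1 * a' + 0) with (- a') in HfA by ring. exact HfA.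
  - exact HfB.
  - intros z HAz HzB. destruct (Rle_dec x0 z) as [Hz|Hz]; [apply HmB; assumption|].
    replace z with (-1 * (- z) + 0) by ring. apply (HmA (- z)); [lra|].
    destruct A as [a| |]; simpl in *; try easy. lra.
Qed.

(** The limit is the supremum of the levels that are lower bounds, carried along at
    the speed [cbar]. *)
Lemma pointwise_limit (x t : R) : 0 <= t ->
  exists U, forall eta, 0 < eta -> at_right 0 (fun eps => Rabs (ueps eps x t - U) < eta).
Proof.
  intros Ht.
  pose proof eventually_pos as Hpos.
  set (E := fun l => forall eta, 0 < eta ->
    at_right 0 (fun eps => l + cbar * t - eta <= ueps eps x t)).
  set (K := L * L / 4 + (2 + gM) * t).
  assert (Hcr : at_right 0 (fun eps => Rabs (ueps eps x t - f x) <= K)).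
  { generalize (filter_and _ _ Hpos (crude_bound g Lg gm gM Hg alpha Hal L HL f t Hf Ht)).
    apply filter_imp. intros eps [He H]. apply (H _ (Hsol eps He)). lra. }
  assert (Hne : E (f x - K - cbar * t)).
  { intros eta Heta. generalize Hcr. apply filter_imp. intros eps H.
    apply Rcomplements.Rabs_le_between in H. lra. }
  assert (Hbd : bound E).
  { exists (f x + K + 1 - cbar * t). intros l Hl.
    destruct (filter_ex _ (filter_and _ _ Hcr (Hl 1 Rlt_0_1))) as [eps [H1 H2]].
    apply Rcomplements.Rabs_le_between in H1. lra. }
  destruct (completeness E Hbd (ex_intro _ _ Hne)) as [S [Hub Hlub]].
  exists (S + cbar * t). intros eta Heta.
  assert (Hl : exists l, E l /\ S - eta / 2 < l).
  { apply NNPP; intros Hn. assert (S <= S - eta / 2); [|lra].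
    apply Hlub. intros l Hl. apply Rnot_lt_le; intros Hlt. apply Hn. exists l; auto. }
  destruct Hl as [l [Hl HlS]].
  assert (Hup : ~ E (S + eta / 2)).
  { intros H. specialize (Hub _ H). lra. }
  destruct (level_dichotomy x (S + eta / 2) t Ht) as [H|H]; [contradiction|].
  assert (He4 : 0 < eta / 4) by lra.
  generalize (filter_and _ _ (Hl (eta / 4) He4) (H (eta / 4) He4)).
  apply filter_imp. intros eps [H1 H2]. apply Rabs_def1; lra.
Qed.

Lemma space_modulus_eps (eps : R) : 0 < eps -> forall x y t, 0 <= t ->
  Rabs (ueps eps x t - ueps eps y t) <= L * Rabs (x - y) + eps.
Proof.
  intros He. destruct (Hsol eps He) as [Hu H0].
  apply (space_modulus g Lg gm gM (Rpower eps alpha)); try assumption; try lra.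
  - left; apply exp_pos.
  - intros x y. rewrite !H0. apply Hf.
Qed.

(** The opening [A = L^2 / eta] balances the two errors of [time_modulus]. *)
Lemma time_modulus_eps (eta : R) : 0 < eta -> exists d, 0 < d /\
  at_right 0 (fun eps => forall x t s, 0 <= t -> 0 <= s -> Rabs (t - s) <= d ->
    Rabs (ueps eps x t - ueps eps x s) <= eta).
Proof.
  intros Heta. set (A := L * L / eta).
  assert (HLL : 1 <= L * L) by nra.
  assert (HA : 0 < A) by (apply Rdiv_lt_0_compat; lra).
  assert (HgM : 0 < gM) by exact (gM_pos g Lg gm gM Hg).
  set (k := 2 * A + gM). assert (Hk : 0 < k) by (unfold k; lra).
  exists (eta / (4 * k)). split; [apply Rdiv_lt_0_compat; lra|].
  generalize (filter_and _ _ (eventually_a_le_1 alpha Hal)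
    (eventually_lt (eta / 4) ltac:(lra))).
  apply filter_imp. intros eps [[He Ha] Hsm].
  assert (Hone : forall x t s, 0 <= s -> s <= t -> t - s <= eta / (4 * k) ->
    Rabs (ueps eps x t - ueps eps x s) <= eta).
  { intros x t s Hs Hst Hd.
    destruct (Hsol eps He) as [Hu _].
    eapply Rle_trans.
    - apply (time_modulus g Lg gm gM (Rpower eps alpha) eps L eps A x s (ueps eps) Hg);
        try assumption; try lra.
      intros y. apply space_modulus_eps; assumption.
    - assert (E : L * L / (4 * A) = eta / 4) by (unfold A; field; lra).
      rewrite E.
      assert ((2 * A * Rpower eps alpha + gM) * (t - s) <= k * (eta / (4 * k))).
      { apply Rmult_le_compat; try lra.
        - apply Rplus_le_le_0_compat; [apply Rmult_le_pos|]; lra.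
        - unfold k. apply Rplus_le_compat_r. rewrite <- (Rmult_1_r (2 * A)) at 2.
          apply Rmult_le_compat_l; lra. }
      replace (k * (eta / (4 * k))) with (eta / 4) in H by (field; lra). lra. }
  intros x t s Ht Hs Hd. apply Rcomplements.Rabs_le_between in Hd.
  destruct (Rle_dec s t) as [H|H].
  - apply Hone; lra.
  - rewrite Rabs_minus_sym. apply Hone; lra.
Qed.

(** The functions are equicontinuous up to an error that vanishes with [eps], so
    pointwise convergence is locally uniform: on a row by [space_modulus_eps], then
    on a box by [time_modulus_eps]. *)
Lemma locally_uniform_limit (U : R -> R -> R) :
  (forall x t, 0 <= t -> forall eta, 0 < eta ->
     at_right 0 (fun eps => Rabs (ueps eps x t - U x t) < eta)) ->
  forall M T eta, 0 <= M -> 0 <= T -> 0 < eta ->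
    at_right 0 (fun eps => forall x t, - M <= x <= M -> 0 <= t <= T ->
      Rabs (ueps eps x t - U x t) < eta).
Proof.
  intros HU M T eta HM HT Heta.
  (* moduli of continuity pass to the limit *)
  assert (Hclose : forall x t y s e, 0 <= t -> 0 <= s ->
    at_right 0 (fun eps => Rabs (ueps eps y s - ueps eps x t) <= e) ->
    Rabs (U y s - U x t) <= e).
  { intros x t y s e Ht Hs Hd. apply le_epsilon. intros r Hr.
    assert (Hr2 : 0 < r / 2) by lra.
    destruct (filter_ex _ (filter_and _ _ Hd (filter_and _ _ (HU x t Ht (r / 2) Hr2)
      (HU y s Hs (r / 2) Hr2)))) as [eps [H1 [H2 H3]]].
    apply Rcomplements.Rabs_le_between in H1. apply Rabs_def2 in H2, H3.
    apply Rabs_le; lra. }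
  pose proof eventually_pos as Hpos.
  assert (Hrow : forall t, 0 <= t -> forall e, 0 < e ->
    at_right 0 (fun eps => forall x, - M <= x <= M -> Rabs (ueps eps x t - U x t) < e)).
  { intros t Ht e He.
    apply (interval_cover (fun p q => at_right 0 (fun eps => forall x, p <= x <= q ->
      Rabs (ueps eps x t - U x t) < e)) (- M) M); [lra| |].
    - intros c _. exists (e / (8 * L)). split; [apply Rdiv_lt_0_compat; lra|].
      intros p q Hp Hpq Hq.
      assert (Hmod : forall x eps, p <= x <= q -> 0 < eps < e / 8 ->
        Rabs (ueps eps x t - ueps eps c t) <= e / 4).
      { intros x eps Hx Hsm. eapply Rle_trans; [apply space_modulus_eps; lra|].
        assert (Rabs (x - c) <= e / (8 * L)) by (apply Rabs_le; lra).
        assert (L * Rabs (x - c) <= L * (e / (8 * L))) by (apply Rmult_le_compat_l; lra).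
        replace (L * (e / (8 * L))) with (e / 8) in H0 by (field; lra). lra. }
      pose proof (eventually_lt (e / 8) ltac:(lra)) as Hsm.
      assert (He4 : 0 < e / 4) by lra.
      generalize (filter_and _ _ Hsm (HU c t Ht (e / 4) He4)).
      apply filter_imp. intros eps [H1 H2] x Hx.
      assert (H3 : Rabs (U x t - U c t) <= e / 4).
      { apply Hclose; [exact Ht|exact Ht|]. generalize Hsm. apply filter_imp.
        intros eps' H'. apply Hmod; assumption. }
      pose proof (Hmod x eps Hx H1) as H4.
      apply Rcomplements.Rabs_le_between in H3, H4. apply Rabs_def2 in H2.
      apply Rabs_def1; lra.
    - intros p q r Hpqr H1 H2. generalize (filter_and _ _ H1 H2). apply filter_imp.
      intros eps [K1 K2] x Hx. destruct (Rle_dec x q); [apply K1|apply K2]; lra. }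
  assert (Hbox : at_right 0 (fun eps => forall t, 0 <= t -> 0 <= t <= T -> forall x, - M <= x <= M ->
      Rabs (ueps eps x t - U x t) < eta)).
  { destruct (time_modulus_eps (eta / 4) ltac:(lra)) as [d [Hd Hmod]].
    apply (interval_cover (fun p q => at_right 0 (fun eps => forall t, 0 <= t -> p <= t <= q ->
      forall x, - M <= x <= M -> Rabs (ueps eps x t - U x t) < eta)) 0 T); [lra| |].
    - intros c Hc. exists d. split; [exact Hd|]. intros p q Hp Hpq Hq.
      assert (He4 : 0 < eta / 4) by lra.
      generalize (filter_and _ _ Hmod (Hrow c (proj1 Hc) (eta / 4) He4)).
      apply filter_imp. intros eps [H1 H2] t Ht0 Ht x Hx.
      assert (Htc : Rabs (t - c) <= d) by (apply Rabs_le; lra).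
      assert (H3 : Rabs (U x t - U x c) <= eta / 4).
      { apply Hclose; [lra|lra|]. generalize Hmod. apply filter_imp.
        intros eps' H'. apply H'; try assumption; lra. }
      specialize (H1 x t c Ht0 ltac:(lra) Htc). specialize (H2 x Hx).
      apply Rcomplements.Rabs_le_between in H1, H3. apply Rabs_def2 in H2.
      apply Rabs_def1; lra.
    - intros p q r Hpqr H1 H2. generalize (filter_and _ _ H1 H2). apply filter_imp.
      intros eps [K1 K2] t Ht0 Ht. destruct (Rle_dec t q); [apply K1|apply K2]; lra. }
  generalize Hbox. apply filter_imp. intros eps H x t Hx Ht. apply H; lra.
Qed.

Lemma family_converges : exists U, converges_locally_uniformly ueps U.
Proof.
  assert (Hch : forall p : R * R, exists U, 0 <= snd p -> forall eta, 0 < eta ->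
    at_right 0 (fun eps => Rabs (ueps eps (fst p) (snd p) - U) < eta)).
  { intros [x t]. simpl. destruct (Rle_dec 0 t) as [Ht|Ht].
    - destruct (pointwise_limit x t Ht) as [U HU]. exists U. intros _; exact HU.
    - exists 0. intros H; contradiction. }
  destruct (functional_choice _ Hch) as [V HV].
  exists (fun x t => V (x, t)). intros M T eta Heta.
  pose proof (locally_uniform_limit (fun x t => V (x, t)) (fun x t Ht => HV (x, t) Ht)
    (Rmax M 0) (Rmax T 0) eta (Rmax_r _ _) (Rmax_r _ _) Heta) as H.
  apply at_right_0 in H. destruct H as [d [Hd H]].
  exists d. split; [exact Hd|]. intros eps He x t [Hx Ht].
  pose proof (Rmax_l M 0). pose proof (Rmax_l T 0).
  apply Rcomplements.Rabs_le_between in Hx. apply (H eps He); lra.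
Qed.

End Convergence.

Lemma classical_solution_solves (g u0 : R -> R) (alpha eps : R) (u : R -> R -> R) :
  is_solution g u0 alpha eps u -> Cauchy_solution g alpha u0 eps u.
Proof.
  intros [Hc [Hreg [Hgr [Heq H0]]]].
  split; [split; [exact Hc|split; [exact Hgr|]]|exact H0].
  intros x t Ht. destruct (Hreg (/ 2) ltac:(lra)) as [Hd _].
  exists (D_t u x t), (D_xx u x t). split.
  - destruct (Hd x t Ht) as [H1 _]. split; [apply Derive_correct, H1|].
    exists (fun y => Derive (fun z => u z t) y). split.
    + intros y. apply (Derive_correct (fun z => u z t)). apply (Hd y t Ht).
    + destruct (Hd x t Ht) as [_ [_ H2]].
      apply (Derive_correct (fun y => Derive (fun z => u z t) y)). exact H2.
  - specialize (Heq x t Ht). lra.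
Qed.

Theorem theorem5p12 :
  forall (g : R -> R) (alpha : R) (u0 : R -> R),
    Lipschitz g -> Z_periodic g -> (forall y : R, 0 < g y) ->
    0 < alpha < 1 ->
    Lipschitz u0 ->
    forall ueps : R -> R -> R -> R,
      (forall eps : R, 0 < eps -> is_solution g u0 alpha eps (ueps eps)) ->
      exists u : R -> R -> R,
        converges_locally_uniformly ueps u /\
        (forall v : R -> R -> R, converges_locally_uniformly ueps v ->
           forall x t : R, 0 <= t -> v x t = u x t).
Proof.
  intros g alpha u0 [Lg HLg] Hgp Hgpos Hal [L0 HL0] ueps Hsol.
  assert (Hper : periodic g) by (intros x; exact (Hgp x 1%Z)).
  pose proof (lipschitz_cont g Lg HLg) as Hgc.
  destruct (periodic_min g Hgc Hper) as [wm Hm].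
  destruct (periodic_max g Hgc Hper) as [wM HM].
  assert (Hspeed : speed g Lg (g wm) (g wM)).
  { split; [exact HLg|]. split; [exact Hper|]. split; [apply Hgpos|]. intros w; auto. }
  assert (Hlip : lipschitz_with (Rmax L0 1) u0).
  { intros x y. eapply Rle_trans; [apply HL0|].
    apply Rmult_le_compat_r; [apply Rabs_pos|apply Rmax_l]. }
  destruct (family_converges g Lg (g wm) (g wM) Hspeed alpha Hal (Rmax L0 1) (Rmax_r _ _) u0 Hlip ueps)
    as [u Hu].
  { intros eps He. apply classical_solution_solves, Hsol, He. }
  exists u. split; [exact Hu|].
  intros v Hv x t Ht. apply cond_eq. intros e He.
  destruct (Hu (Rabs x) t (e / 2) ltac:(lra)) as [d1 [Hd1 H1]].
  destruct (Hv (Rabs x) t (e / 2) ltac:(lra)) as [d2 [Hd2 H2]].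
  set (eps := Rmin d1 d2 / 2).
  assert (Heps : 0 < eps < d1 /\ eps < d2).
  { unfold eps. pose proof (Rmin_l d1 d2). pose proof (Rmin_r d1 d2).
    assert (0 < Rmin d1 d2) by (apply Rmin_pos; assumption). lra. }
  assert (Hbox : box (Rabs x) 0 t x t) by (split; lra).
  specialize (H1 eps ltac:(lra) x t Hbox). specialize (H2 eps ltac:(lra) x t Hbox).
  apply Rabs_def2 in H1, H2. apply Rabs_def1; lra.
Qed.
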